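(* Let $\mathcal{R}_{\mathrm{i}}^{\mathrm{s}}=L^{-1}I(\mathbf{Y}_{\mathrm{s}};\mathbf{g}\,|\,\mathbf{x})$ be the sensing rate of the ISAC system described in the context. Then $$\mathcal{R}_{\mathrm{i}}^{\mathrm{s}}=L^{-1}\log_2\det\left(\mathbf{I}_M+pL\sigma_{\mathrm{s}}^{-2}\mathbf{R}\right),$$ where $\mathbf{R}=\mathbb{E}\{\mathbf{g}\mathbf{g}^{\mathsf{H}}\}\in\mathbb{C}^{M\times M}$ is the correlation matrix of $\mathbf{g}$. Moreover, as $p\to\infty$ (all other parameters fixed), $$\mathcal{R}_{\mathrm{i}}^{\mathrm{s}}=\frac{\mathsf{r}}{L}\log_2p+\frac1L\sum_{a=1}^{\mathsf{r}}\log_2\left(\frac{L\lambda_a}{\sigma_{\mathrm{s}}^2}\right)+o(1),$$ where $\mathsf{r}=\mathrm{rank}(\mathbf{R})$ and $\lambda_1,\dots,\lambda_{\mathsf{r}}$ are the positive eigenvalues of $\mathbf{R}$ (with multiplicity).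
   Context: Let $M,L\ge1$ be integers and $p,\sigma_{\mathrm{s}}^2>0$. The transmitted signal vector $\mathbf{x}\in\mathbb{C}^{L\times1}$ is $\mathbf{x}^{\mathsf{T}}=\sqrt{p}\,[\sqrt{\alpha_{\mathrm{N}}},\sqrt{\alpha_{\mathrm{F}}}]\,\mathbf{S}$, with $\alpha_{\mathrm{N}},\alpha_{\mathrm{F}}>0$, $\alpha_{\mathrm{N}}+\alpha_{\mathrm{F}}=1$, $\alpha_{\mathrm{N}}<\alpha_{\mathrm{F}}$, and where the data matrix $\mathbf{S}\in\mathbb{C}^{2\times L}$ satisfies $\mathbf{S}\mathbf{S}^{\mathsf{H}}=L\mathbf{I}_2$. The received radar echo is $\mathbf{Y}_{\mathrm{s}}=\mathbf{g}\mathbf{x}^{\mathsf{T}}+\mathbf{N}_{\mathrm{s}}\in\mathbb{C}^{M\times L}$, where $\mathbf{N}_{\mathrm{s}}$ has i.i.d. $\mathcal{CN}(0,\sigma_{\mathrm{s}}^2)$ entries, and the target response vector is $\mathbf{g}=\sum_k\beta_k\mathbf{a}(\theta_k)\in\mathbb{C}^{M\times1}$, a finite sum with fixed vectors $\mathbf{a}(\theta_k)\in\mathbb{C}^{M\times 1}$ (receive array steering vectors) and independent $\beta_k\sim\mathcal{CN}(0,\sigma_k^2)$. The quantities $\mathbf{x}$, $\mathbf{g}$, $\mathbf{N}_{\mathrm{s}}$ are mutually independent. $I(X;Y|Z)$ denotes the mutual information (in bits) between $X$ and $Y$ conditioned on $Z$. *)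

(* Defs.v *)
From HB Require Import structures.
From mathcomp Require Import all_boot all_order all_algebra.
From mathcomp Require Import complex.
From mathcomp Require Import all_classical all_reals all_analysis.

Set Implicit Arguments.
Unset Strict Implicit.
Unset Printing Implicit Defensive.

Import Order.TTheory GRing.Theory Num.Theory.
Import numFieldNormedType.Exports.

Local Open Scope classical_set_scope.
Local Open Scope ring_scope.
Local Open Scope complex_scope.
Local Open Scope sesquilinear_scope.
Local Open Scope charge_scope.

Definition log2 {R : realType} (x : R) : R := ln x / ln 2.

(* The Borel sigma-algebra of C, through the identification z = (Re z, Im z)
   with R * R. *)
Definition re_im {R : realType} (z : R[i]) : R * R := (complex.Re z, complex.Im z).

HB.instance Definition _ (R : realType) := isPointed.Build R[i] 0.

Definition cborel (R : realType) : Type :=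
  g_sigma_algebra_preimageType (@re_im R).
HB.instance Definition _ (R : realType) := Measurable.on (cborel R).

(* The Borel sigma-algebra of C^(m x n): the smallest one for which every
   matrix entry is measurable. *)
Definition cmx_gen (R : realType) (m n : nat) : set (set 'M[R[i]]_(m, n)) :=
  [set A | exists i j (B : set (cborel R)),
     measurable B /\ A = [set X : 'M[R[i]]_(m, n) | B (X i j)]].

Definition cmx (R : realType) (m n : nat) : Type :=
  g_sigma_algebraType (@cmx_gen R m n).
HB.instance Definition _ (R : realType) (m n : nat) :=
  Measurable.on (cmx R m n).

HB.instance Definition _ d1 d2 (T1 : measurableType d1)
    (T2 : measurableType d2) :=
  isMeasurableFun.Build _ _ (T1 * T2)%type T1 fst measurable_fst.
HB.instance Definition _ d1 d2 (T1 : measurableType d1)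
    (T2 : measurableType d2) :=
  isMeasurableFun.Build _ _ (T1 * T2)%type T2 snd measurable_snd.

(* Kullback-Leibler divergence D(mu || nu), in bits. *)
Definition kl_div d (T : measurableType d) (R : realType)
    (mu nu : probability T R) : \bar R :=
  if `[< mu `<< nu >] then
    (\int[mu]_t
      (log2 (fine (('d (charge_of_finite_measure mu) '/d nu) t)))%:E)%E
  else +oo%E.

(* Mutual information, in bits, of a pair with joint law mu. *)
Definition mutual_info d1 d2 (T1 : measurableType d1) (T2 : measurableType d2)
    (R : realType) (mu : probability (T1 * T2)%type R) : \bar R :=
  kl_div mu (distribution mu fst \x distribution mu snd)%E.

(* kappa is a regular conditional distribution of X given Z. *)
Definition regular_cond_dist d d1 d2 (Omega : measurableType d)
    (T1 : measurableType d1) (T2 : measurableType d2) (R : realType)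
    (P : probability Omega R) (X : Omega -> T1) (Z : Omega -> T2)
    (kappa : T2 -> pprobability T1 R) : Prop :=
  measurable_fun setT kappa /\
  forall (A : set T1) (C : set T2), measurable A -> measurable C ->
    P (X @^-1` A `&` Z @^-1` C) = (\int[P]_(w in Z @^-1` C) kappa (Z w) A)%E.

(* I(X; Y | Z), in bits: the average over Z of the mutual information of the
   conditional law of (X, Y) given Z.  For random variables in standard Borel
   spaces a regular conditional distribution kappa exists and is unique up to a
   null set of values of Z, so that exactly one v satisfies the condition; the
   default value 0 is only used when there is no kappa. *)
Definition cond_mutual_info d d1 d2 d3 (Omega : measurableType d)
    (T1 : measurableType d1) (T2 : measurableType d2) (T3 : measurableType d3)
    (R : realType) (P : probability Omega R)
    (X : Omega -> T1) (Y : Omega -> T2) (Z : Omega -> T3) : \bar R :=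
  xget 0%E [set v : \bar R | exists kappa : T3 -> pprobability (T1 * T2)%type R,
    regular_cond_dist P (fun w => (X w, Y w)) Z kappa /\
    v = (\int[P]_w mutual_info (kappa (Z w)))%E].

Definition mutually_independent d d' (Omega : measurableType d)
    (T : measurableType d') (R : realType) (P : probability Omega R)
    (I : finType) (X : I -> Omega -> T) : Prop :=
  forall B : I -> set T, (forall i, measurable (B i)) ->
    P [set w | forall i, B i (X i w)] =
    (\prod_(i : I) fine (P (X i @^-1` B i)))%:E.

Definition mutually_independent3 d d1 d2 d3 (Omega : measurableType d)
    (T1 : measurableType d1) (T2 : measurableType d2) (T3 : measurableType d3)
    (R : realType) (P : probability Omega R)
    (X : Omega -> T1) (Y : Omega -> T2) (Z : Omega -> T3) : Prop :=
  forall (A : set T1) (B : set T2) (C : set T3),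
    measurable A -> measurable B -> measurable C ->
    P (X @^-1` A `&` Y @^-1` B `&` Z @^-1` C) =
    (P (X @^-1` A) * P (Y @^-1` B) * P (Z @^-1` C))%E.

(* The centered real Gaussian law with variance v; normal_prob takes the
   standard deviation, and is not the point mass when that is 0. *)
Definition centered_gaussian (R : realType) (v : R) (A : set R) : \bar R :=
  if v == 0 then \d_(0 : R) A else normal_prob 0 (Num.sqrt v) A.

(* Z ~ CN(0, v), circularly symmetric: the real and imaginary parts are
   independent, centered Gaussian of variance v / 2. *)
Definition complex_gaussian d (Omega : measurableType d) (R : realType)
    (P : probability Omega R) (Z : Omega -> R[i]) (v : R) : Prop :=
  forall A B : set R, measurable A -> measurable B ->
    P [set w | A (complex.Re (Z w)) /\ B (complex.Im (Z w))] =
    (centered_gaussian (v / 2) A * centered_gaussian (v / 2) B)%E.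

Definition complex_expectation d (Omega : measurableType d) (R : realType)
    (P : probability Omega R) (Z : Omega -> R[i]) : R[i] :=
  fine 'E_P[fun w => complex.Re (Z w)] +i* fine 'E_P[fun w => complex.Im (Z w)].

Definition correlation_mx d (Omega : measurableType d) (R : realType)
    (P : probability Omega R) (M : nat) (g : Omega -> 'cV[R[i]]_M) :
    'M[R[i]]_M :=
  \matrix_(i, j) complex_expectation P (fun w => (g w *m (g w)^t*) i j).

(* With multiplicity, as roots of the characteristic polynomial. *)
Definition eigenvalues (R : realType) (n : nat) (A : 'M[R[i]]_n) : seq R[i] :=
  sval (closed_field_poly_normal (char_poly A)).

(* In R[i], 0 < z means that z is real and positive. *)
Definition positive_eigenvalues (R : realType) (n : nat) (A : 'M[R[i]]_n) :
    seq R :=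
  [seq complex.Re z | z <- eigenvalues A & 0 < z].

(* x, where x^T = sqrt p [sqrt alphaN, sqrt alphaF] S *)
Definition transmit_signal (R : realType) (L : nat) (p alphaN alphaF : R)
    (S : 'M[R[i]]_(2, L)) : 'cV[R[i]]_L :=
  ((Num.sqrt p)%:C *:
    ((\row_(j < 2) (Num.sqrt (if j == 0 then alphaN else alphaF))%:C) *m S))^T.

Definition target_response (R : realType) (M K : nat) (a : 'I_K -> 'cV[R[i]]_M)
    (beta : 'I_K -> R[i]) : 'cV[R[i]]_M :=
  \sum_(k < K) beta k *: a k.

Definition radar_echo (R : realType) (M L : nat) (g : 'cV[R[i]]_M)
    (x : 'cV[R[i]]_L) (N : 'M[R[i]]_(M, L)) : 'M[R[i]]_(M, L) :=
  g *m x^T + N.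

Definition sensing_rate d (Omega : measurableType d) (R : realType)
    (P : probability Omega R) (M L : nat) (g : Omega -> cmx R M 1)
    (x : Omega -> cmx R L 1) (N : Omega -> cmx R M L) : \bar R :=
  let Y : Omega -> cmx R M L := fun w => radar_echo (g w) (x w) (N w) in
  ((L%:R^-1)%:E * cond_mutual_info P Y g x)%E.

(* Main.v *)
(** Condition on [x = z] and put [t = |z|^2] and [c = sigma2s^-1]. Since [N] is
  Gaussian, shifting it by [g z^T] multiplies its law by
  [exp (c (2 Re <g z^T, N> - t |g|^2))] (Cameron-Martin). Averaging this weight
  over [g], one Gaussian summand of [g] at a time, gives
  [det (1 + c t R)^-1 exp (u^* T u)] with [u = c Y conj z] and
  [T = (1 + c t R)^-1 R]. Hence the joint law of [(Y, g)] has an explicit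
  positive density [h] with respect to the product of its marginals, and the
  mutual information is [E (log2 h)]; the second moments of [g] and [N] make the
  quadratic terms of [ln h] cancel on average, which leaves
  [log2 (det (1 + c t R))]. This depends on [z] only through [t = p L], which is
  constant because [S S^* = L]. Any other regular conditional distribution agrees
  with this one for almost every value of [x], the sigma-algebra being countably
  generated. Diagonalising [R] turns the determinant into the product of
  [1 + p L lambda / sigma2s] over the positive eigenvalues, hence the asymptotics. *)

Require Import Defs.
From HB Require Import structures.
From mathcomp Require Import all_boot all_order all_algebra.
From mathcomp Require Import complex.
From mathcomp Require Import all_classical all_reals all_analysis.
From mathcomp Require Import measurable_realfun.
From mathcomp Require Import ring lra.

Import Order.TTheory GRing.Theory Num.Theory.
Import numFieldNormedType.Exports.

Local Open Scope classical_set_scope.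
Local Open Scope ring_scope.
Local Open Scope complex_scope.
Local Open Scope sesquilinear_scope.

Set Implicit Arguments.
Unset Strict Implicit.
Unset Printing Implicit Defensive.

(** * Weighted laws, measurability and independence *)

(** No joint Lebesgue density of [(Y, g)] is available: variances may be 0 and the vectors [a k]
    need not span, so the law of [g] can be singular. Every change of law is therefore a weight
    relative to the law of [N] or to a product of laws, and laws are compared on generating
    rectangles; the only Lebesgue integrals are one-dimensional.

    For fixed [z] the quadratic form in [g] is the scalar [c t], but integrating out one summand
    destroys this. The exponential moment is hence proved for all self-adjoint positive semidefinite
    [Q], a class closed under the rank-one change.

    The cancellation on average has this source: with [D = 1 + c t R], the filtered output
    [v = Y conj z] has second moment [(t / c) D], and [T D = R]. The term in [T] thus averages to
    [c t tr R], while the terms linear and quadratic in [g] average to [2 c t tr R] and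
    [- c t tr R].

    The definition of conditional mutual information ranges over all kernels [kappa], and
    measurability of [w -> mutual_info (kappa (Z w))] is not at hand. Its integral is evaluated from
    its constancy off a null set alone. *)

Section density.
Local Open Scope ereal_scope.
Context d (T : measurableType d) (R : realType) (mu : {measure set T -> \bar R}).
Variable u : T -> R.
Hypotheses (u0 : forall x, (0 <= u x)%R) (mu_u : measurable_fun [set: T] u).

(** The two proofs are arguments so that the measure structure attached below, which depends on
    them, can be inferred from the term alone. *)
Definition density_measure (_ : forall x, (0 <= u x)%R)
    (_ : measurable_fun [set: T] u) (A : set T) : \bar R :=
  \int[mu]_(x in A) (u x)%:E.

Local Notation nu := (density_measure u0 mu_u).

Let mEu : measurable_fun [set: T] (EFin \o u). Proof. exact/measurable_EFinP. Qed.

Let nu_set0 : nu set0 = 0. Proof. exact: integral_set0. Qed.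

Let nu_ge0 A : 0 <= nu A.
Proof. by apply: integral_ge0 => x _; rewrite lee_fin. Qed.

Let nu_sigma_additive : semi_sigma_additive nu.
Proof.
by apply: semi_sigma_additive_nng_induced => // x; rewrite lee_fin.
Qed.

HB.instance Definition _ :=
  isMeasure.Build _ _ _ nu nu_set0 nu_ge0 nu_sigma_additive.

Import HBNNSimple.

(** Both sides are monotone limits along simple functions [h n] increasing to [f]. By linearity only
    indicators of level sets remain, and for these the identity is the definition of [nu]. *)
Lemma ge0_integral_density_measure (f : T -> \bar R) :
  measurable_fun [set: T] f -> (forall x, 0 <= f x) ->
  \int[nu]_x f x = \int[mu]_x (f x * (u x)%:E).
Proof.
move=> mf f0.
pose h := nnsfun_approx measurableT mf.
have nd_h x : {homo h ^~ x : a b / (a <= b)%N >-> (a <= b)%R}.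
  by move=> a b ab; exact/lefP/nd_nnsfun_approx.
have cvg_h x : EFin \o h ^~ x @ \oo --> f x.
  exact: (@cvg_nnsfun_approx _ _ _ _ measurableT f mf (fun x _ => f0 x)).
transitivity (limn (fun n => \int[nu]_x (h n x)%:E)).
  rewrite -monotone_convergence//=.
  - by apply: eq_integral => x _; apply/esym/cvg_lim => //; exact: cvg_h.
  - by move=> n; apply/measurable_EFinP.
  - by move=> n x _; rewrite lee_fin.
  - by move=> x _ a b ab; rewrite lee_fin; exact: nd_h.
transitivity (limn (fun n => \int[mu]_x ((h n x)%:E * (u x)%:E))); last first.
  rewrite -monotone_convergence//=.
  - apply: eq_integral => x _; apply/cvg_lim => //.
    by apply: cvgeZr => //; exact: cvg_h.
  - by move=> n; apply: emeasurable_funM => //; apply/measurable_EFinP.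
  - by move=> n x _; rewrite mule_ge0// lee_fin.
  - by move=> x _ a b ab; rewrite lee_wpmul2r// lee_fin//; exact: nd_h.
congr (limn _); apply/funext => n.
transitivity (\int[nu]_x (\sum_(y \in range (h n))
    (y * \1_(h n @^-1` [set y]) x)%:E)).
  by apply: eq_integral => x _; rewrite /= fimfunE -fsumEFin.
transitivity (\int[mu]_x (\sum_(y \in range (h n))
    ((y * \1_(h n @^-1` [set y]) x)%:E * (u x)%:E))); last first.
  apply: eq_integral => x _; rewrite -ge0_mule_fsuml => [|y].
    by rewrite fsumEFin // -(fimfunE _ x).
  exact: nnfun_muleindic_ge0.
rewrite ge0_integral_fsum//; last 2 first.
  - by move=> y; apply/measurable_EFinP; exact: measurable_funM.
  - by move=> y x _; exact: nnfun_muleindic_ge0.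
rewrite ge0_integral_fsum//; last 2 first.
  - move=> y; apply: emeasurable_funM => //.
    by apply/measurable_EFinP; exact: measurable_funM.
  - by move=> y x _; rewrite mule_ge0 ?lee_fin//; exact: nnfun_muleindic_ge0.
apply: eq_fsbigr => y; rewrite inE => -[x0 _ <-].
have hx0 : (0 <= h n x0)%R by [].
transitivity ((h n x0)%:E * \int[nu]_x (\1_(h n @^-1` [set h n x0]) x)%:E).
  rewrite -ge0_integralZl//.
  - by apply/measurable_EFinP.
transitivity ((h n x0)%:E *
    \int[mu]_x ((\1_(h n @^-1` [set h n x0]) x)%:E * (u x)%:E)); last first.
  rewrite -ge0_integralZl//.
  - by apply: eq_integral => x _; rewrite EFinM -muleA.
  - by apply: emeasurable_funM => //; apply/measurable_EFinP.
  - by move=> x _; rewrite mule_ge0// lee_fin.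
congr (_ * _); rewrite integral_indic// setIT.
rewrite /density_measure [LHS]integral_mkcond; apply: eq_integral => x _.
by rewrite patchE indicE; case: ifP => _; rewrite ?mul1e ?mul0e.
Qed.

End density.

Section weighted_laws.
Local Open Scope ereal_scope.
Context d1 d2 d (T1 : measurableType d1) (T2 : measurableType d2)
  (T : measurableType d) (R : realType).
Variables (m1 : {measure set T1 -> \bar R}) (m2 : {measure set T2 -> \bar R}).
Variables (X : T1 -> T) (Y : T2 -> T) (u : T1 -> R) (v : T2 -> R).
Hypotheses (mX : measurable_fun [set: T1] X) (mY : measurable_fun [set: T2] Y).
Hypotheses (u0 : forall x, (0 <= u x)%R) (v0 : forall x, (0 <= v x)%R).
Hypotheses (mu : measurable_fun [set: T1] u) (mv : measurable_fun [set: T2] v).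

(** The images of the two weighted measures agree on a generating system closed under intersection
    and have finite mass, so they are one measure. The weights live on the sample spaces, hence no
    density on [T] is ever required. *)
Lemma ge0_integral_weighted_law (G : set (set T)) :
  measurable = <<s G >> -> setI_closed G -> G setT ->
  \int[m1]_x (u x)%:E < +oo ->
  (forall A, G A ->
    \int[m1]_(x in X @^-1` A) (u x)%:E = \int[m2]_(x in Y @^-1` A) (v x)%:E) ->
  forall phi : T -> \bar R, measurable_fun [set: T] phi ->
    (forall t, 0 <= phi t) ->
    \int[m1]_x (phi (X x) * (u x)%:E) = \int[m2]_x (phi (Y x) * (v x)%:E).
Proof.
move=> GE GI GT ufin uv phi mphi phi0.
pose n1 := density_measure m1 u0 mu; pose n2 := density_measure m2 v0 mv.
rewrite -(@ge0_integral_density_measure _ _ _ m1 _ u0 mu (phi \o X)); last 2 first.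
- exact: (measurableT_comp mphi mX).
- by move=> x; exact: phi0.
rewrite -(@ge0_integral_density_measure _ _ _ m2 _ v0 mv (phi \o Y)); last 2 first.
- exact: (measurableT_comp mphi mY).
- by move=> x; exact: phi0.
have := @ge0_integral_pushforward _ _ _ _ R X mX n1 setT phi measurableT mphi
  (fun y _ => phi0 y).
rewrite preimage_setT => <-.
have := @ge0_integral_pushforward _ _ _ _ R Y mY n2 setT phi measurableT mphi
  (fun y _ => phi0 y).
rewrite preimage_setT => <-.
(* [pose] abstracts over the measurability proof required by the measure
   structure of [pushforward]. *)
pose p1 : {measure set T -> \bar R} := pushforward n1 X.
pose p2 : {measure set T -> \bar R} := pushforward n2 Y.
have p12 A : measurable A -> p1 mX A = p2 mY A.
  apply: (measure_unique G (fun=> setT) GE GI) => //.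
  by rewrite bigcup_const.
apply: (@eq_measure_integral _ _ _ setT (p2 mY) (p1 mX) phi) => A mA _.
exact: p12.
Qed.

End weighted_laws.

(** * Measurability of complex and matrix valued maps *)

Section complex_measurability.
Context d (T : measurableType d) (R : realType).
Implicit Types f g : T -> R[i].

(** Stated for maps into [R[i]] itself, where the ring operations are available;
    [complex_measurableP] passes to the measurable type [cborel R]. *)
Definition complex_measurable f :=
  measurable_fun [set: T] (fun t => complex.Re (f t)) /\
  measurable_fun [set: T] (fun t => complex.Im (f t)).

Lemma complex_measurable_cst c : complex_measurable (fun=> c).
Proof. by split; exact: measurable_cst. Qed.

Lemma complex_measurableD f g : complex_measurable f -> complex_measurable g ->
  complex_measurable (fun t => f t + g t).
Proof.
move=> [mf mf'] [mg mg']; split.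
- rewrite (_ : (fun t => _) =
    (fun t => complex.Re (f t) + complex.Re (g t))); first exact: measurable_funD.
  by apply/funext => t; rewrite raddfD.
- rewrite (_ : (fun t => _) =
    (fun t => complex.Im (f t) + complex.Im (g t))); first exact: measurable_funD.
  by apply/funext => t; rewrite raddfD.
Qed.

Lemma complex_measurableM f g : complex_measurable f -> complex_measurable g ->
  complex_measurable (fun t => f t * g t).
Proof.
move=> [mf mf'] [mg mg']; split.
- rewrite (_ : (fun t => _) = (fun t => complex.Re (f t) * complex.Re (g t) -
      complex.Im (f t) * complex.Im (g t))).
    by apply: measurable_funB; exact: measurable_funM.
  by apply/funext => t; case: (f t) => ? ?; case: (g t).
- rewrite (_ : (fun t => _) = (fun t => complex.Re (f t) * complex.Im (g t) +
      complex.Im (f t) * complex.Re (g t))).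
    by apply: measurable_funD; exact: measurable_funM.
  by apply/funext => t; case: (f t) => ? ?; case: (g t).
Qed.

Lemma complex_measurable_conj f : complex_measurable f ->
  complex_measurable (fun t => (f t)^*%C).
Proof.
move=> [mf mf']; split.
- rewrite (_ : (fun t => _) = (fun t => complex.Re (f t))) //.
  by apply/funext => t; case: (f t).
- rewrite (_ : (fun t => _) = (fun t => - complex.Im (f t))).
    exact: measurable_funN.
  by apply/funext => t; case: (f t).
Qed.

Lemma complex_measurable_sum I (s : seq I) (P : pred I) (h : I -> T -> R[i]) :
  (forall i, complex_measurable (h i)) ->
  complex_measurable (fun t => \sum_(i <- s | P i) h i t).
Proof.
move=> mh; elim: s => [|i s IH].
  rewrite (_ : (fun t => _) = (fun=> 0)); first exact: complex_measurable_cst.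
  by apply/funext => t; rewrite big_nil.
rewrite (_ : (fun t => _) = (fun t =>
  (if P i then h i t else 0) + \sum_(i <- s | P i) h i t)).
  apply: complex_measurableD => //.
  by case: (P i) => //; exact: complex_measurable_cst.
by apply/funext => t; rewrite big_cons; case: (P i); rewrite ?add0r.
Qed.

Lemma complex_measurableP (f : T -> cborel R) :
  measurable_fun [set: T] f <-> complex_measurable f.
Proof.
have -> : complex_measurable f <-> measurable_fun [set: T] (@re_im R \o f).
  split=> [[mf mf']|/measurable_fun_pairP[mf mf']]; last by split.
  exact: (measurable_fun_pair mf mf').
split=> mf.
- move=> _ B mB; rewrite setTI.
  have := mf measurableT (@re_im R @^-1` B); rewrite setTI; apply.
  by exists B => //; rewrite setTI.
- move=> _ _ [B mB <-]; rewrite !setTI.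
  by have := mf measurableT B mB; rewrite setTI.
Qed.

Definition mx_measurable m n (f : T -> 'M[R[i]]_(m, n)) :=
  forall i j, complex_measurable (fun t => f t i j).

Lemma mx_measurableP m n (f : T -> cmx R m n) :
  measurable_fun [set: T] f <-> mx_measurable f.
Proof.
split=> [mf i j|mf].
- apply/(@complex_measurableP (fun t => (f t : 'M[R[i]]_(m, n)) i j)).
  move=> _ B mB; rewrite setTI.
  have := mf measurableT [set X : 'M[R[i]]_(m, n) | B (X i j)]; rewrite setTI; apply.
  by apply: sub_sigma_algebra; exists i, j, B.
- apply: (@measurability _ _ _ (cmx R m n) _ f (@cmx_gen R m n) erefl).
  move=> _ [_ [i [j [B [mB ->]]]] <-].
  rewrite setTI.
  have /complex_measurableP := mf i j => /(_ measurableT B mB).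
  by rewrite setTI.
Qed.

Lemma mx_measurable_cst m n (A : 'M[R[i]]_(m, n)) : mx_measurable (fun=> A).
Proof. by move=> i j; exact: complex_measurable_cst. Qed.

Lemma mx_measurableD m n (f g : T -> 'M[R[i]]_(m, n)) :
  mx_measurable f -> mx_measurable g -> mx_measurable (fun t => f t + g t).
Proof.
move=> mf mg i j; under eq_fun do rewrite mxE.
exact: complex_measurableD.
Qed.

Lemma mx_measurableM m n k (f : T -> 'M[R[i]]_(m, n)) (g : T -> 'M[R[i]]_(n, k)) :
  mx_measurable f -> mx_measurable g -> mx_measurable (fun t => f t *m g t).
Proof.
move=> mf mg i j; under eq_fun do rewrite mxE.
by apply: complex_measurable_sum => l; exact: complex_measurableM.
Qed.

Lemma mx_measurableZ m n (f : T -> R[i]) (g : T -> 'M[R[i]]_(m, n)) :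
  complex_measurable f -> mx_measurable g -> mx_measurable (fun t => f t *: g t).
Proof.
move=> mf mg i j; under eq_fun do rewrite mxE.
exact: complex_measurableM.
Qed.

Lemma mx_measurable_tr m n (f : T -> 'M[R[i]]_(m, n)) :
  mx_measurable f -> mx_measurable (fun t => (f t)^T).
Proof. by move=> mf i j; under eq_fun do rewrite mxE; exact: mf. Qed.

Lemma mx_measurable_adj m n (f : T -> 'M[R[i]]_(m, n)) :
  mx_measurable f -> mx_measurable (fun t => (f t)^t*).
Proof.
move=> mf i j; under eq_fun do rewrite !mxE.
exact/complex_measurable_conj/mf.
Qed.

Lemma mx_measurable_sum m n I (s : seq I) (P : pred I)
    (h : I -> T -> 'M[R[i]]_(m, n)) :
  (forall i, mx_measurable (h i)) ->
  mx_measurable (fun t => \sum_(i <- s | P i) h i t).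
Proof.
move=> mh i j; under eq_fun do rewrite summxE.
by apply: complex_measurable_sum => l; exact: mh.
Qed.

End complex_measurability.

Lemma mx_measurable_id (R : realType) m n :
  mx_measurable (fun X : cmx R m n => (X : 'M[R[i]]_(m, n))).
Proof. by apply/(@mx_measurableP _ _ _ _ _ id); exact: measurable_id. Qed.

Lemma measurable_sigma d (T : measurableType d) : @measurable d T = <<s measurable >>.
Proof. by rewrite sigma_algebra_id//; exact: sigma_algebra_measurable. Qed.

Section pair_laws.
Local Open Scope ereal_scope.
Context d1 d2 da db (T1 : measurableType d1) (T2 : measurableType d2)
  (Ta : measurableType da) (Tb : measurableType db) (R : realType).
Variables (m1 : {measure set T1 -> \bar R}) (m2 : {measure set T2 -> \bar R}).

Lemma ge0_integral_weighted_pair_law (X : T1 -> Ta) (X' : T1 -> Tb)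
    (Y : T2 -> Ta) (Y' : T2 -> Tb) (u : T1 -> R) (v : T2 -> R) :
  measurable_fun [set: T1] X -> measurable_fun [set: T1] X' ->
  measurable_fun [set: T2] Y -> measurable_fun [set: T2] Y' ->
  measurable_fun [set: T1] u -> measurable_fun [set: T2] v ->
  (forall x, 0 <= u x)%R -> (forall x, 0 <= v x)%R ->
  \int[m1]_x (u x)%:E < +oo ->
  (forall A B, measurable A -> measurable B ->
    \int[m1]_(x in X @^-1` A `&` X' @^-1` B) (u x)%:E =
    \int[m2]_(x in Y @^-1` A `&` Y' @^-1` B) (v x)%:E) ->
  forall phi : Ta * Tb -> \bar R, measurable_fun [set: Ta * Tb] phi ->
    (forall t, 0 <= phi t) ->
    \int[m1]_x (phi (X x, X' x) * (u x)%:E) =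
    \int[m2]_x (phi (Y x, Y' x) * (v x)%:E).
Proof.
move=> mX mX' mY mY' mu mv u0 v0 ufin uv phi mphi phi0.
pose G : set (set (Ta * Tb)) := [set A `*` B | A in measurable & B in measurable].
apply: (@ge0_integral_weighted_law _ _ _ _ _ (Ta * Tb)%type _ m1 m2
  (fun x => (X x, X' x)) (fun x => (Y x, Y' x)) u v _ _ u0 v0 mu mv G) => //.
- exact: measurable_fun_pair.
- exact: measurable_fun_pair.
- exact: measurable_prod_measurableType.
- move=> /= _ _ [X1 mX1 [X2 mX2 <-]] [Y1 mY1 [Y2 mY2 <-]].
  rewrite -setXI; exists (X1 `&` Y1); first exact: measurableI.
  by exists (X2 `&` Y2) => //; exact: measurableI.
- by exists setT => //; exists setT => //; rewrite setXTT.
- by move=> _ [A mA [B mB <-]]; exact: uv.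
Qed.

End pair_laws.

Definition independent_pair d d1 d2 (Omega : measurableType d)
    (T1 : measurableType d1) (T2 : measurableType d2) (R : realType)
    (P : probability Omega R) (X : Omega -> T1) (Y : Omega -> T2) : Prop :=
  forall A B, measurable A -> measurable B ->
    P (X @^-1` A `&` Y @^-1` B) = (P (X @^-1` A) * P (Y @^-1` B))%E.

Lemma integral_one d (T : measurableType d) (R : realType)
    (m : {measure set T -> \bar R}) (A : set T) :
  measurable A -> (\int[m]_(x in A) (1%R : R)%:E = m A)%E.
Proof. by move=> mA; rewrite (integral_cst m mA) mul1e. Qed.

Lemma probability_integral_cst d (T : measurableType d) (R : realType)
    (P : probability T R) (r : R) : (\int[P]_x r%:E = r%:E)%E.
Proof.
rewrite (integral_cst P measurableT) -[RHS]mule1; congr (_ * _)%E.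
exact: probability_setT.
Qed.

Lemma mem_preimage_set (T U : Type) (f : T -> U) (A : set U) t :
  (t \in f @^-1` A) = (f t \in A).
Proof. by apply/idP/idP; rewrite !inE. Qed.

(** * Independence: Tonelli and product formulas *)

Section independence.
Local Open Scope ereal_scope.
Context d d1 d2 (Omega : measurableType d)
  (T1 : measurableType d1) (T2 : measurableType d2) (R : realType).
Variable P : probability Omega R.

Lemma measurable_preimage d' (T : measurableType d') (X : Omega -> T) A :
  measurable_fun [set: Omega] X -> measurable A -> measurable (X @^-1` A).
Proof. by move=> mX mA; have := mX measurableT A mA; rewrite setTI. Qed.

(** The space [P \x P] supplies an independent copy: by independence, [(X, Y)] under [P] and
    [(X \o fst, Y \o snd)] under [P \x P] agree on rectangles, hence have the same law. Tonelli then
    gives the iterated integral. *)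
Lemma ge0_integral_indep (X : Omega -> T1) (Y : Omega -> T2) :
  measurable_fun [set: Omega] X -> measurable_fun [set: Omega] Y ->
  independent_pair P X Y ->
  forall phi : T1 * T2 -> \bar R, measurable_fun [set: T1 * T2] phi ->
    (forall t, 0 <= phi t) ->
  \int[P]_w phi (X w, Y w) = \int[P]_w \int[P]_w' phi (X w, Y w').
Proof.
move=> mX mY XY phi mphi phi0.
have mX' : measurable_fun [set: Omega * Omega] (X \o fst).
  exact: (measurableT_comp mX measurable_fst).
have mY' : measurable_fun [set: Omega * Omega] (Y \o snd).
  exact: (measurableT_comp mY measurable_snd).
transitivity (\int[P \x P]_w phi (X w.1, Y w.2)).
  have := @ge0_integral_weighted_pair_law _ _ _ _ _ _ _ _ _ P (P \x P)
     X Y (X \o fst) (Y \o snd) (cst 1%R) (cst 1%R).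
  move=> /(_ mX mY mX' mY' (@measurable_cst _ _ _ _ _ _) (@measurable_cst _ _ _ _ _ _)).
  move=> /(_ (fun=> ler01) (fun=> ler01)).
  have -> : \int[P]_x (cst 1%R x)%:E = 1 :> \bar R.
    exact: probability_integral_cst.
  move=> /(_ (ltry _)).
  move=> /(_ _ phi mphi phi0) H.
  transitivity (\int[P]_x (phi (X x, Y x) * (cst 1%R x)%:E)).
    by apply: eq_integral => w _; rewrite mule1.
  rewrite H.
    by apply: eq_integral => w _; rewrite /= mule1.
  move=> A B mA mB.
  rewrite [LHS]integral_one; last first.
    by apply: measurableI; exact: measurable_preimage.
  have -> : (X \o fst) @^-1` A `&` (Y \o snd) @^-1` B =
            (X @^-1` A) `*` (Y @^-1` B) by [].
  rewrite [RHS]integral_one; last by apply: measurableX; exact: measurable_preimage.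
  rewrite [LHS]XY// [RHS]product_measure1E//; exact: measurable_preimage.
rewrite fubini_tonelli1//.
exact: (measurableT_comp mphi (measurable_fun_pair mX' mY')).
Qed.

End independence.

Section mutual_independence.
Local Open Scope ereal_scope.
Context d d' (Omega : measurableType d) (T : measurableType d') (R : realType).
Variable P : probability Omega R.
Variables (I : finType) (X : I -> Omega -> T).
Hypothesis mX : forall i, measurable_fun [set: Omega] (X i).
Hypothesis iX : mutually_independent P X.

Let updated (h : I -> T -> R) j f i := if i == j then f else h i.

Let prodE (h : I -> T -> R) j f w : (\prod_i updated h j f i (X i w) =
  f (X j w) * \prod_(i | i != j) h i (X i w))%R.
Proof.
rewrite (bigD1 j)//= /updated eqxx; congr *%R.
by apply: eq_bigr => i /negbTE ->.
Qed.

Lemma mutually_independent_integral_prod (h : I -> T -> R) :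
  (forall i t, 0 <= h i t)%R -> (forall i, measurable_fun [set: T] (h i)) ->
  (forall i, \int[P]_w (h i (X i w))%:E < +oo) ->
  \int[P]_w (\prod_i h i (X i w))%:E =
  (\prod_i fine (\int[P]_w (h i (X i w))%:E))%:E.
Proof.
pose good (h : I -> T -> R) := [/\ forall i t, (0 <= h i t)%R,
  forall i, measurable_fun [set: T] (h i) &
  forall i, \int[P]_w (h i (X i w))%:E < +oo].
pose conclusion (h : I -> T -> R) := \int[P]_w (\prod_i h i (X i w))%:E =
  (\prod_i fine (\int[P]_w (h i (X i w))%:E))%:E.
have indic_int D i : measurable D ->
    \int[P]_w ((\1_D : T -> R) (X i w))%:E = P (X i @^-1` D).
  move=> mD; rewrite -integral_one; last exact: measurable_preimage.
  rewrite [RHS]integral_mkcond; apply: eq_integral => w _.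
  by rewrite patchE indicE mem_preimage_set; case: (X i w \in D).
(* Induction on a list [s] outside of which every factor is an indicator. With [s] empty the claim
   is the definition of mutual independence; each step frees one factor. *)
suff gen (s : seq I) h' : good h' -> (forall i, i \notin s ->
    exists2 B, measurable B & h' i = \1_B) -> conclusion h'.
  move=> h0 mh hfin; apply: (gen (enum I)) => // i.
  by rewrite mem_enum.
elim: s h' => [|j s IH] h'.
  move=> _ /(_ _ isT) hB.
  have /choice[B hB'] : forall i, exists B, measurable B /\ h' i = \1_B.
    by move=> i; have [B mB ->] := hB i; exists B.
  have mB i : measurable (B i) by have [] := hB' i.
  have hE i : h' i = \1_(B i) by have [] := hB' i.
  rewrite /conclusion.
  under [in RHS]eq_bigr do rewrite hE indic_int//.
  rewrite -(iX mB).
  have mXB : measurable [set w | forall i, B i (X i w)].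
    rewrite (_ : [set _ | _] = \bigcap_i (X i @^-1` B i)).
      by apply: fin_bigcap_measurable => // i _; exact: measurable_preimage.
    by apply/seteqP; split => [w H i _|w H i]; exact: H.
  rewrite -integral_one// [RHS]integral_mkcond; apply: eq_integral => w _.
  rewrite patchE; case: ifPn => [/set_mem/= H|].
    by rewrite big1// => i _; rewrite hE indicE mem_set//; exact: H.
  rewrite notin_setE/=.
  move=> /existsNP[i Hi]; rewrite (bigD1 i)//= hE indicE (memNset Hi).
  by rewrite mul0r.
move=> [h0 mh hfin] hB.
have good_upd D : measurable D -> good (updated h' j \1_D).
  move=> mD; split=> [i t|i|i]; rewrite /updated; case: ifP => // _.
    rewrite indic_int//.
    exact: (le_lt_trans (probability_le1 _ (measurable_preimage (mX _) mD)) (ltry _)).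
have concl_upd D : measurable D -> conclusion (updated h' j \1_D).
  move=> mD; apply: IH; first exact: good_upd.
  move=> i si; rewrite /updated; case: ifPn => ij; first by exists D.
  by apply: hB; rewrite inE negb_or ij.
pose u w := (\prod_(i | i != j) h' i (X i w))%R.
pose c := (\prod_(i | i != j) fine (\int[P]_w (h' i (X i w))%:E))%R.
have rhsE f : (\prod_i fine (\int[P]_w (updated h' j f i (X i w))%:E) =
    fine (\int[P]_w (f (X j w))%:E) * c)%R.
  rewrite (bigD1 j)//= {1}/updated eqxx; congr *%R.
  by apply: eq_bigr => i /negbTE; rewrite /updated => ->.
have u0 w : (0 <= u w)%R by apply: prodr_ge0 => i _.
have c0 : (0 <= c)%R.
  by apply: prodr_ge0 => i _; apply: fine_ge0; apply: integral_ge0 => w _; rewrite lee_fin.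
have mu : measurable_fun [set: Omega] u.
  have -> : u = fun w => (\prod_i (if i != j then h' i (X i w) else 1))%R.
    by apply/funext => w; rewrite /u big_mkcond.
  apply: measurable_prod => i _; case: (i != j) => //.
  exact: (measurableT_comp (mh i) (mX i)).
(* Putting the indicator of [D] at the coordinate [j] in the induction hypothesis shows that the
   weight [u], the product of the other factors, and the constant [c] give [X j] the same weighted
   law. Any [h' j] may then be integrated against it. *)
have uD D : measurable D ->
    \int[P]_(x in X j @^-1` D) (u x)%:E = \int[P]_(x in X j @^-1` D) c%:E.
  move=> mD; have := concl_upd D mD; rewrite /conclusion rhsE indic_int//.
  rewrite integral_cst; last exact: measurable_preimage.
  rewrite EFinM fineK; last exact: fin_num_measure (measurable_preimage (mX _) mD).
  rewrite muleC => <-; rewrite integral_mkcond; apply: eq_integral => w _.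
  rewrite prodE patchE indicE mem_preimage_set.
  by case: (X j w \in D) => /=; rewrite ?mul1r ?mul0r.
have ufin : \int[P]_x (u x)%:E < +oo.
  have := uD setT measurableT; rewrite preimage_setT => ->.
  by rewrite probability_integral_cst ltry.
have mhj : measurable_fun [set: T] (EFin \o h' j) by exact/measurable_EFinP.
transitivity (\int[P]_x ((EFin \o h' j) (X j x) * (u x)%:E)).
  by apply: eq_integral => w _; rewrite (bigD1 j)//= EFinM.
transitivity (\int[P]_x ((EFin \o h' j) (X j x) * c%:E)).
  exact: (@ge0_integral_weighted_law _ _ _ _ _ _ _ P P (X j) (X j) u (cst c)
    (mX j) (mX j) u0 (fun=> c0) mu (@measurable_cst _ _ _ _ _ _) measurable
    (measurable_sigma T) (@measurableI _ _) measurableT ufin uD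
    (EFin \o h' j) mhj (fun t => h0 j t)).
rewrite ge0_integralZr//=; last 2 first.
- exact: (measurableT_comp mhj (mX j)).
- by move=> w _; rewrite lee_fin.
rewrite (bigD1 j)//= EFinM fineK// ge0_fin_numE ?hfin//.
by apply: integral_ge0 => w _; rewrite lee_fin.
Qed.

End mutual_independence.

Section independent_partial_sums.
Context d (Omega : measurableType d) (R : realType) (P : probability Omega R).
Variables (I : finType) (X : I -> Omega -> cborel R).
Hypothesis mX : forall i, measurable_fun [set: Omega] (X i).
Hypothesis iX : mutually_independent P X.
Variables (m n : nat) (a : I -> 'M[R[i]]_(m, n)).

(** Indexed by a list, so that the partial sums of the target response are of the same form and an
    induction can peel off one Gaussian summand. *)
Definition linear_combination (s : seq I) (w : Omega) : cmx R m n :=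
  \sum_(k <- s) (X k w : R[i]) *: a k.

Lemma measurable_linear_combination s :
  measurable_fun [set: Omega] (linear_combination s).
Proof.
apply/mx_measurableP; apply: mx_measurable_sum => k.
apply: mx_measurableZ; first exact/complex_measurableP.
exact: mx_measurable_cst.
Qed.

Let rest (s : seq I) (B : I -> set (cborel R)) :=
  [set w | forall i, i \notin s -> B i (X i w)].

Let pr (s : seq I) (B : I -> set (cborel R)) : R :=
  \prod_(i | i \notin s) fine (P (X i @^-1` B i)).

Let measurable_rest s B : (forall i, measurable (B i)) -> measurable (rest s B).
Proof.
move=> mB; rewrite (_ : rest s B = \bigcap_(i in [set i | i \notin s]) (X i @^-1` B i)).
  apply: fin_bigcap_measurable => [|i _]; last exact: measurable_preimage.
  exact: (sub_finite_set (@subsetT _ _) (@finite_finset I setT)).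
by apply/seteqP; split => [w H i si|w H i si]; exact: H.
Qed.

(** Strengthened for the induction: the partial sum is independent of the whole family of remaining
    variables at once. The step moves [X j] from that family into the sum. *)
Let linear_combination_indep s : uniq s ->
  forall A B, measurable A -> (forall i, measurable (B i)) ->
  P (linear_combination s @^-1` A `&` rest s B) =
  (P (linear_combination s @^-1` A) * (pr s B)%:E)%E.
Proof.
elim: s => [_ A B mA mB|j s IH /= /andP[js us] A B mA mB].
  have PB : P (rest [::] B) = (pr [::] B)%:E.
    have -> : rest [::] B = [set w | forall i, B i (X i w)].
      by apply/seteqP; split => w /= H i; [exact: H|move=> _; exact: H].
    exact: iX.
  have [A0|A0] := pselect (A (0 : 'M[R[i]]_(m, n))).
    have -> : linear_combination [::] @^-1` A = setT.
      by apply/seteqP; split => // w _; rewrite /preimage/= /linear_combination big_nil.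
    rewrite setTI PB -[LHS]mul1e; congr (_ * _)%E.
    exact/esym/probability_setT.
  have -> : linear_combination [::] @^-1` A = set0.
    by apply/seteqP; split => // w; rewrite /preimage/= /linear_combination big_nil.
  by rewrite set0I measure0 mul0e.
pose c := pr (j :: s) B.
have c0 : 0 <= c by apply: prodr_ge0 => i _; exact: fine_ge0.
pose E := rest (j :: s) B.
have mE : measurable E by exact: measurable_rest.
have mSs := measurable_linear_combination s.
pose upd D (C : I -> set (cborel R)) i := if i == j then D else C i.
have mupd D C : measurable D -> (forall i, measurable (C i)) ->
    forall i, measurable (upd D C i).
  by move=> mD mC i; rewrite /upd; case: eqP.
have restE D C : rest s (upd D C) = X j @^-1` D `&` rest (j :: s) C.
  apply/seteqP; split=> [w H|w [Dw H] i si].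
    split; first by have := H j js; rewrite /upd eqxx.
    move=> i; rewrite inE negb_or => /andP[ij si].
    by have := H i si; rewrite /upd (negbTE ij).
  rewrite /upd; case: eqP => [->//|/eqP ij].
  by apply: H; rewrite inE negb_or ij.
have prE D C : pr s (upd D C) = fine (P (X j @^-1` D)) * pr (j :: s) C.
  rewrite /pr (bigD1 j)//= /upd eqxx; congr (_ * _).
  apply: eq_big => i; first by rewrite inE negb_or andbC.
  by move=> /andP[_ /negbTE ->].
have restT : rest (j :: s) (fun=> setT) = setT by apply/seteqP; split.
have prT : pr (j :: s) (fun=> setT) = 1.
  rewrite /pr big1// => i _; rewrite preimage_setT.
  by rewrite (_ : P _ = 1%E)//; exact: probability_setT.
have mDX D : measurable D -> measurable (X j @^-1` D).
  exact: measurable_preimage.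
have PX D : measurable D -> P (X j @^-1` D) \is a fin_num.
  by move=> mD; apply: fin_num_measure; exact: mDX.
pose phi (z : cmx R m n * cborel R) : \bar R :=
  (\1_A ((z.1 : 'M[R[i]]_(m, n)) + (z.2 : R[i]) *: a j : cmx R m n))%:E.
have mphi : measurable_fun setT phi.
  apply/measurable_EFinP; apply: (measurableT_comp (measurable_indic mA)).
  apply/mx_measurableP; apply: mx_measurableD.
    apply/(@mx_measurableP _ _ _ _ _ (fst : _ -> cmx R m n)).
    exact: measurable_fst.
  apply: mx_measurableZ; last exact: mx_measurable_cst.
  apply/(@complex_measurableP _ _ _ (snd : _ -> cborel R)).
  exact: measurable_snd.
have phi0 z : (0 <= phi z)%E by rewrite lee_fin.
have E0 w : 0 <= (\1_E w : R) by [].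
have mIE : measurable_fun setT (\1_E : Omega -> R) by exact: measurable_indic.
have int1E : (\int[P]_x (\1_E x : R)%:E < +oo)%E.
  by rewrite integral_indic// setIT ltey_eq fin_num_measure.
(* Weighting by the event [E] about the remaining variables only multiplies the law of the pair
   (partial sum, [X j]) by [c]. On rectangles this follows from two uses of the induction
   hypothesis, with the events [B] and with trivial events. *)
have H := @ge0_integral_weighted_pair_law _ _ _ _ _ _ _ _ _ P P
  (linear_combination s) (X j) (linear_combination s) (X j) \1_E (cst c)
  mSs (mX j) mSs (mX j) mIE (@measurable_cst _ _ _ _ _ _) E0 (fun=> c0) int1E.
have sumE w : linear_combination (j :: s) w =
    (linear_combination s w : 'M[R[i]]_(m, n)) + (X j w : R[i]) *: a j.
  by rewrite /linear_combination big_cons addrC.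
have mS := measurable_linear_combination (j :: s).
rewrite -integral_one; last by apply: measurableI => //; exact: measurable_preimage.
rewrite -[in RHS]integral_one; last exact: measurable_preimage.
transitivity (\int[P]_x (phi (linear_combination s x, X j x) * (\1_E x)%:E))%E.
  rewrite [LHS]integral_mkcond; apply: eq_integral => w _.
  rewrite patchE in_setI mem_preimage_set sumE /phi !indicE.
  by case: (_ \in A); case: (w \in E); rewrite /= ?mule1 ?mule0 ?mul0e.
rewrite H//.
  transitivity ((\int[P]_x phi (linear_combination s x, X j x)) * c%:E)%E.
    rewrite -ge0_integralZr//.
    exact: (measurableT_comp mphi (measurable_fun_pair mSs (mX j))).
  congr (_ * _)%E; rewrite [RHS]integral_mkcond; apply: eq_integral => w _.
  rewrite patchE mem_preimage_set sumE /phi !indicE.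
  by case: (_ \in A).
move=> A' D mA' mD.
have mAD : measurable (linear_combination s @^-1` A' `&` X j @^-1` D).
  by apply: measurableI; [exact: measurable_preimage|exact: mDX].
transitivity (P (linear_combination s @^-1` A' `&` rest s (upd D B))).
  rewrite restE setIA -integral_one; last exact: measurableI.
  rewrite integral_mkcond [RHS]integral_mkcond; apply: eq_integral => w _.
  rewrite !patchE !in_setI indicE -/E.
  by case: (_ && _); case: (_ \in E).
rewrite IH//; last exact: mupd.
rewrite [RHS](integral_cst P mAD c%:E).
transitivity (c%:E * (P (linear_combination s @^-1` A') *
    (pr s (upd D (fun=> setT)))%:E))%E.
  by rewrite !prE prT mulr1 EFinM fineK ?PX// muleA muleC.
congr (_ * _)%E; rewrite -IH//; last exact: mupd.
by rewrite restE restT setIT.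
Qed.

Lemma independent_linear_combination s j : uniq s -> j \notin s ->
  independent_pair P (linear_combination s) (X j).
Proof.
move=> us js A D mA mD.
pose B i := if i == j then D else setT.
have mB i : measurable (B i) by rewrite /B; case: eqP.
have := linear_combination_indep us mA mB.
have -> : rest s B = X j @^-1` D.
  apply/seteqP; split=> w; first by move=> /(_ j js); rewrite /B eqxx.
  by move=> Dw i _; rewrite /B; case: eqP => [->|].
move=> ->; congr (_ * _)%E.
rewrite /pr (bigD1 j)//= {1}/B eqxx big1 ?mulr1.
  by rewrite fineK//; apply: fin_num_measure; exact: measurable_preimage.
move=> i /andP[_ /negbTE ij]; rewrite /B ij preimage_setT.
by rewrite (_ : P _ = 1%E)//; exact: probability_setT.
Qed.

End independent_partial_sums.

(** * Gaussian random variables *)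

Section real_gaussian.
Context (R : realType).
Local Notation leb := (@lebesgue_measure R).

Lemma ge0_integral_lebesgue_shift (a : R) (f : R -> \bar R) :
  measurable_fun [set: R] f -> (forall x, (0 <= f x)%E) ->
  (\int[leb]_x f (x + a)%R = \int[leb]_x f x)%E.
Proof.
move=> mf f0.
pose sh : measurableTypeR R -> measurableTypeR R := fun x => x + a.
have msh : measurable_fun setT sh by exact: measurable_funD.
transitivity (\int[pushforward leb sh]_x f x)%E.
  by rewrite (@ge0_integral_pushforward _ _ _ _ _ sh msh)//= => y _; exact: f0.
pose p : {measure set (measurableTypeR R) -> \bar R} := pushforward leb sh.
apply: (@eq_measure_integral _ _ _ setT leb (p msh)) => A mA _.
apply/esym/lebesgue_measure_unique => //= _ [[b c]] _ <-.
rewrite /p/= /pushforward.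
have -> : sh @^-1` `]b, c] = `](b - a)%R, (c - a)%R]%classic.
  by apply/seteqP; split=> x /=; rewrite /sh !in_itv/= ltrBlDr lerBrDr.
rewrite /= !lebesgue_measure_itv/= !lte_fin ltrD2r.
by case: ifP => // _; rewrite !EFinB; congr (_%:E); ring.
Qed.

Lemma ge0_integral_normal_prob m (s : R) (f : R -> \bar R) :
  measurable_fun [set: R] f -> (forall x, (0 <= f x)%E) ->
  (\int[normal_prob m s]_x f x = \int[leb]_x (f x * (normal_pdf m s x)%:E))%E.
Proof.
move=> mf f0.
have mpdf := measurable_normal_pdf m s.
rewrite -(@ge0_integral_density_measure _ _ _ leb _ (normal_pdf_ge0 m s) mpdf f mf f0).
exact: eq_measure_integral.
Qed.

Lemma normal_pdf_peakE m (s x : R) : s != 0 ->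
  normal_pdf m s x = normal_peak s * normal_fun m s x.
Proof. by move=> s0; rewrite normal_pdfE. Qed.

Lemma normal_pdf_shift (v : R) (a x : R) : 0 < v ->
  normal_pdf 0 (Num.sqrt v) (x - a) =
  normal_pdf 0 (Num.sqrt v) x * expR ((2 * a * x - a ^+ 2) / (2 * v)).
Proof.
move=> v0; have s0 : Num.sqrt v != 0 by rewrite gt_eqF// sqrtr_gt0.
rewrite !normal_pdf_peakE// -[RHS]mulrA; congr (_ * _).
rewrite /normal_fun -expRD; congr expR; rewrite sqr_sqrtr ?ltW//.
by field; rewrite gt_eqF.
Qed.

(** One-dimensional Cameron-Martin formula: translation invariance of Lebesgue measure moves the
    shift onto the density, and the weight is the ratio of the shifted density to the centered
    one. *)
Lemma ge0_integral_normal_prob_shift (v a : R) (f : R -> \bar R) : 0 < v ->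
  measurable_fun [set: R] f -> (forall x, (0 <= f x)%E) ->
  (\int[normal_prob 0 (Num.sqrt v)]_x f (x + a)%R =
   \int[normal_prob 0 (Num.sqrt v)]_x
     (f x * (expR ((2 * a * x - a ^+ 2) / (2 * v)))%:E))%E.
Proof.
move=> v0 mf f0.
have mfa : measurable_fun [set: R] (fun x => f (x + a)).
  by apply: (measurableT_comp mf); exact: measurable_funD.
have mexp : measurable_fun [set: R] (fun x => expR ((2 * a * x - a ^+ 2) / (2 * v))).
  apply: measurableT_comp => //; apply: measurable_funM => //.
  by apply: measurable_funB => //; exact: measurable_funM.
have mg : measurable_fun [set: R]
    (fun x => f x * (normal_pdf 0 (Num.sqrt v) (x - a))%:E)%E.
  apply: emeasurable_funM => //; apply/measurable_EFinP.
  apply: (measurableT_comp (measurable_normal_pdf _ _)).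
  exact: measurable_funB.
rewrite ge0_integral_normal_prob//.
rewrite ge0_integral_normal_prob; last 2 first.
- by apply: emeasurable_funM => //; exact/measurable_EFinP.
- by move=> x; rewrite mule_ge0// lee_fin expR_ge0.
transitivity (\int[leb]_x (f x * (normal_pdf 0 (Num.sqrt v) (x - a))%:E))%E.
  rewrite -(@ge0_integral_lebesgue_shift a _ mg).
    by apply: eq_integral => x _; rewrite addrK.
  by move=> x; rewrite mule_ge0// lee_fin normal_pdf_ge0.
apply: eq_integral => x _; rewrite normal_pdf_shift// EFinM.
by rewrite -muleA; congr (_ * _)%E; rewrite muleC.
Qed.

(** Completing the square: the precision [1 / v] grows to [1 / v + 2 q = k / v], so the integrand is
    a constant times the normal density of variance [v / k] and mean [2 v w / k], which integrates
    to 1. *)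
Lemma integral_normal_prob_quadratic (v w q : R) : 0 < v -> 0 <= q ->
  (\int[normal_prob 0 (Num.sqrt v)]_x (expR (2 * x * w - q * x ^+ 2))%:E =
   ((Num.sqrt (1 + 2 * v * q))^-1 * expR (2 * v * w ^+ 2 / (1 + 2 * v * q)))%:E)%E.
Proof.
move=> v0 q0; set k := 1 + 2 * v * q.
have k0 : 0 < k by rewrite /k ltr_pwDl// mulr_ge0// mulr_ge0// ltW.
have me : measurable_fun [set: R] (fun x => expR (2 * x * w - q * x ^+ 2)).
  apply: measurableT_comp => //; apply: measurable_funB.
    by apply: measurable_funM => //; exact: measurable_funM.
  by apply: measurable_funM => //; exact: measurable_funX.
rewrite ge0_integral_normal_prob; last 2 first.
- exact/measurable_EFinP.
- by move=> x; rewrite lee_fin expR_ge0.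
pose c := (Num.sqrt k)^-1 * expR (2 * v * w ^+ 2 / k).
pose m' := 2 * v * w / k.
pose s' := Num.sqrt (v / k).
have vk0 : 0 < v / k by rewrite divr_gt0.
transitivity (\int[leb]_x (c%:E * (normal_pdf m' s' x)%:E))%E.
  apply: eq_integral => x _; rewrite -!EFinM; congr EFin.
  rewrite !normal_pdf_peakE ?gt_eqF ?sqrtr_gt0//.
  rewrite /normal_fun /c /m' /normal_peak mulrCA.
  rewrite [RHS](_ : _ = ((Num.sqrt k)^-1 *
      (Num.sqrt (s' ^+ 2 * pi *+ 2))^-1) * (expR (2 * v * w ^+ 2 / k) *
      expR (- (x - 2 * v * w / k) ^+ 2 / (s' ^+ 2 *+ 2)))); last by ring.
  congr (_ * _).
    rewrite -invfM -sqrtrM ?ltW//.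
    suff -> : k * (s' ^+ 2 * pi *+ 2) = Num.sqrt v ^+ 2 * pi *+ 2 by [].
    rewrite !sqr_sqrtr ?ltW//.
    by field; rewrite gt_eqF.
  rewrite -!expRD; congr expR; rewrite !sqr_sqrtr ?ltW//.
  rewrite /k; field.
  by rewrite !gt_eqF.
have c0 : 0 <= c by rewrite mulr_ge0 ?expR_ge0// invr_ge0 sqrtr_ge0.
rewrite ge0_integralZl//; last 2 first.
- by apply/measurable_EFinP; exact: measurable_normal_pdf.
- by move=> x _; rewrite lee_fin normal_pdf_ge0.
by rewrite integral_normal_pdf mule1.
Qed.

End real_gaussian.

Section gaussian_variable.
Context d (Omega : measurableType d) (R : realType) (P : probability Omega R).

Definition gaussian_law (v : R) (X : Omega -> R) :=
  forall A, measurable A -> P (X @^-1` A) = centered_gaussian v A.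

Variables (v : R) (X : Omega -> R).
Hypotheses (mX : measurable_fun [set: Omega] X) (lX : gaussian_law v X).

Lemma ge0_integral_gaussian_law (f : R -> \bar R) : v != 0 ->
  measurable_fun [set: R] f -> (forall x, (0 <= f x)%E) ->
  (\int[P]_w f (X w) = \int[normal_prob 0 (Num.sqrt v)]_x f x)%E.
Proof.
move=> v0 mf f0.
have := @ge0_integral_pushforward _ _ _ (measurableTypeR R) R X mX P setT f measurableT mf
  (fun y _ => f0 y).
rewrite preimage_setT => <-.
pose p : {measure set (measurableTypeR R) -> \bar R} :=
  pushforward P (X : Omega -> measurableTypeR R).
apply: (@eq_measure_integral _ _ _ setT (normal_prob 0 (Num.sqrt v)) (p mX)).
by move=> A mA _; rewrite /p/= /pushforward lX// /centered_gaussian (negbTE v0).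
Qed.

Lemma integral_gaussian_law0 (f : R -> \bar R) : v = 0 ->
  measurable_fun [set: R] f -> (forall x, (0 <= f x)%E) ->
  (\int[P]_w f (X w) = f 0%R)%E.
Proof.
move=> v0 mf f0.
have := @ge0_integral_pushforward _ _ _ (measurableTypeR R) R X mX P setT f measurableT mf
  (fun y _ => f0 y).
rewrite preimage_setT => <-.
pose p : {measure set (measurableTypeR R) -> \bar R} :=
  pushforward P (X : Omega -> measurableTypeR R).
transitivity (\int[@dirac _ (measurableTypeR R) 0%R R]_x f x)%E.
  apply: (@eq_measure_integral _ _ _ setT (@dirac _ (measurableTypeR R) 0%R R) (p mX)).
  by move=> A mA _; rewrite /p/= /pushforward lX// /centered_gaussian v0 eqxx.
by rewrite integral_dirac// diracT mul1e.
Qed.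

Hypothesis v_ge0 : 0 <= v.

(** The variance 0 is covered, both sides then being 1, so that degenerate coefficients [beta k]
    need no separate treatment later. *)
Lemma integral_gaussian_quadratic (w q : R) : 0 <= q ->
  (\int[P]_t (expR (2 * X t * w - q * X t ^+ 2))%:E =
   ((Num.sqrt (1 + 2 * v * q))^-1 * expR (2 * v * w ^+ 2 / (1 + 2 * v * q)))%:E)%E.
Proof.
move=> q0.
have me : measurable_fun [set: R] (fun x => (expR (2 * x * w - q * x ^+ 2))%:E).
  apply/measurable_EFinP; apply: measurableT_comp => //; apply: measurable_funB.
    by apply: measurable_funM => //; exact: measurable_funM.
  by apply: measurable_funM => //; exact: measurable_funX.
have e0 (x : R) : (0 <= (expR (2 * x * w - q * x ^+ 2))%:E)%E.
  by rewrite lee_fin expR_ge0.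
have [v0|v0] := eqVneq v 0.
  rewrite (integral_gaussian_law0 v0 me e0) v0 expr0n/=.
  by rewrite !(mulr0, mul0r, subr0, addr0, sqrtr1, invr1, mul1r).
rewrite (ge0_integral_gaussian_law v0 me e0) integral_normal_prob_quadratic//.
by rewrite lt0r v0.
Qed.

Lemma ge0_integral_gaussian_shift (a : R) (f : R -> \bar R) : 0 < v ->
  measurable_fun [set: R] f -> (forall x, (0 <= f x)%E) ->
  (\int[P]_w f (X w + a)%R =
   \int[P]_w (f (X w) * (expR ((2 * a * X w - a ^+ 2) / (2 * v)))%:E))%E.
Proof.
move=> v0 mf f0.
have mexp : measurable_fun [set: R] (fun x => expR ((2 * a * x - a ^+ 2) / (2 * v))).
  apply: measurableT_comp => //; apply: measurable_funM => //.
  by apply: measurable_funB => //; exact: measurable_funM.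
rewrite (@ge0_integral_gaussian_law (fun x => f (x + a)))//; last 2 first.
- by rewrite gt_eqF.
- by apply: (measurableT_comp mf); exact: measurable_funD.
rewrite ge0_integral_normal_prob_shift//.
rewrite (@ge0_integral_gaussian_law
  (fun x => f x * (expR ((2 * a * x - a ^+ 2) / (2 * v)))%:E)%E)//.
- by rewrite gt_eqF.
- by apply: emeasurable_funM => //; exact/measurable_EFinP.
- by move=> x; rewrite mule_ge0// lee_fin expR_ge0.
Qed.

Lemma gaussian_law_opp : gaussian_law v (fun w => - X w).
Proof.
move=> A mA.
have mNA : measurable (-%R @^-1` A : set R).
  rewrite -[X in measurable X]setTI.
  exact: (@measurable_funN _ _ _ setT id (@measurable_id _ _ setT)).
rewrite (_ : _ @^-1` A = X @^-1` (-%R @^-1` A))// lX// /centered_gaussian.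
have [v0|v0] := eqVneq v 0.
  by rewrite !diracE mem_preimage_set oppr0.
have s0 : Num.sqrt v != 0 by rewrite gt_eqF// sqrtr_gt0 lt0r v0.
have mpdf := measurable_normal_pdf 0 (Num.sqrt v).
rewrite /normal_prob integral_mkcond [RHS]integral_mkcond.
pose n : measurableTypeR R -> measurableTypeR R := -%R.
have mn : measurable_fun setT n.
  exact: (@measurable_funN _ _ _ setT id (@measurable_id _ _ setT)).
have pdfN x : normal_pdf 0 (Num.sqrt v) (- x) = normal_pdf 0 (Num.sqrt v) x.
  by rewrite !normal_pdf_peakE// /normal_fun !subr0 sqrrN.
pose g : R -> \bar R := ((fun x : R => (normal_pdf 0 (Num.sqrt v) x)%:E) \_ A)%E.
have mg : measurable_fun setT g.
  apply/(measurable_restrictT _ mA); apply/measurable_EFinP.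
  exact: measurable_funTS.
have g0 y : (0 <= g y)%E.
  by rewrite /g patchE; case: ifP => // _; rewrite lee_fin normal_pdf_ge0.
transitivity (\int[pushforward (@lebesgue_measure R) n]_x g x)%E; last first.
  pose p : {measure set (measurableTypeR R) -> \bar R} :=
    pushforward (@lebesgue_measure R) n.
  apply: (@eq_measure_integral _ _ _ setT lebesgue_measure (p mn)) => B mB _.
  exact: lebesgue_measureN.
rewrite (ge0_integral_pushforward mn _ measurableT mg (fun y _ => g0 y)).
apply: eq_integral => x _; rewrite /= /g !patchE /n pdfN.
by rewrite (_ : (x \in _) = (- x \in A)) ?mem_preimage_set.
Qed.

(** The second moment is read off the exponential moment: [f n] is the difference quotient at 0 of
    [- expR (- t X ^+ 2)] in [t]. It tends to [X ^+ 2] under domination, while its integral is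
    explicit and tends to [v]. *)
Lemma integral_gaussian_square : (\int[P]_w (X w ^+ 2)%:E = v%:E)%E.
Proof.
pose t (n : nat) : R := n.+1%:R^-1.
have t0 n : 0 < t n by rewrite invr_gt0.
pose f n w : R := (1 - expR (- (t n * X w ^+ 2))) / t n.
have mX2 : measurable_fun [set: Omega] (fun w => X w ^+ 2) by exact: measurable_funX.
have mexp n : measurable_fun [set: Omega] (fun w => expR (- (t n * X w ^+ 2))).
  apply: measurableT_comp => //; apply: measurable_funN.
  exact: measurable_funM.
have mf n : measurable_fun [set: Omega] (fun w => (f n w)%:E).
  by apply/measurable_EFinP; apply: measurable_funM => //; exact: measurable_funB.
have f_ge n w : X w ^+ 2 / (1 + t n * X w ^+ 2) <= f n w.
  have y0 := sqr_ge0 (X w).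
  set y := X w ^+ 2 in y0 *.
  rewrite /f -/y ler_pdivlMr//.
  have e1 : 0 < 1 + t n * y by rewrite ltr_pwDl// mulr_ge0// ltW.
  have : expR (- (t n * y)) <= (1 + t n * y)^-1.
    by rewrite expRN lef_pV2 ?posrE ?expR_gt0// expR_ge1Dx.
  suff -> : y / (1 + t n * y) * t n = 1 - (1 + t n * y)^-1 by lra.
  by field; rewrite gt_eqF.
have f_le n w : f n w <= X w ^+ 2.
  rewrite /f ler_pdivrMr//.
  by have := expR_ge1Dx (- (t n * X w ^+ 2)); lra.
have f_ge0 n w : 0 <= f n w.
  apply: le_trans (f_ge n w); rewrite divr_ge0 ?sqr_ge0//.
  by rewrite addr_ge0// mulr_ge0 ?sqr_ge0// ltW.
have cvgt : t @ \oo --> (0 : R) by exact: cvg_harmonic.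
have cvgf w : f ^~ w @ \oo --> X w ^+ 2.
  apply: (@squeeze_cvgr _ \oo _ _ (fun n => X w ^+ 2 / (1 + t n * X w ^+ 2))
      (fun=> X w ^+ 2) (f ^~ w)).
  - by apply: nearW => n; rewrite f_ge f_le.
  - rewrite -[X in _ --> X](_ : X w ^+ 2 / (1 + 0 * X w ^+ 2) = _); last first.
      by rewrite mul0r addr0 divr1.
    apply: cvgM; first exact: cvg_cst.
    apply: cvgV; first by rewrite mul0r addr0 oner_neq0.
    apply: cvgD; first exact: cvg_cst.
    by apply: cvgM => //; exact: cvg_cst.
  - exact: cvg_cst.
(* The dominating function: [X ^+ 2 / 2] is at most [expR |X|], hence at most [expR X + expR (- X)].
   The exponents are written so that the exponential moment with [q = 0] and [w] equal to plus or
   minus one half applies. *)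
pose g w : R := 2 * (expR (2 * X w * 2^-1) + expR (2 * X w * - 2^-1)).
have exp_int (c : R) : (\int[P]_w (expR (2 * X w * c))%:E < +oo)%E.
  have := @integral_gaussian_quadratic c 0 (lexx _).
  under eq_integral do rewrite mul0r subr0.
  by move=> ->; rewrite ltry.
have mexpc (c : R) : measurable_fun [set: Omega] (fun w => expR (2 * X w * c)).
  apply: measurableT_comp => //; apply: measurable_funM => //.
  exact: measurable_funM.
have iexp (c : R) : P.-integrable [set: Omega] (EFin \o (fun w => expR (2 * X w * c))).
  apply/integrableP; split; first exact/measurable_EFinP.
  under eq_integral do rewrite /= ger0_norm ?expR_ge0//.
  exact: exp_int.
have ig : P.-integrable [set: Omega] (EFin \o g).
  rewrite (_ : EFin \o g = (fun w => 2%:E *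
    ((EFin \o (fun w => expR (2 * X w * 2^-1))) w +
     (EFin \o (fun w => expR (2 * X w * - 2^-1))) w)))%E.
    by apply: integrableZl => //; exact: integrableD.
  by apply/funext => w /=; rewrite -EFinD -EFinM.
have gub w : X w ^+ 2 <= g w.
  have := expR_ge1Dxn 1 (normr_ge0 (X w)).
  rewrite real_normK ?num_real// /g.
  have e1 := expR_ge0 (2 * X w * 2^-1).
  have e2 := expR_ge0 (2 * X w * - 2^-1).
  have [X0|X0] := leP 0 (X w).
    rewrite ger0_norm// (_ : 2 * X w * 2^-1 = X w) in e1 *; last by field.
    by rewrite (_ : 2`! = 2)%N//; lra.
  rewrite ltr0_norm// (_ : 2 * X w * - 2^-1 = - X w) in e2 *; last by field.
  by rewrite (_ : 2`! = 2)%N//; lra.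
have mX2E : measurable_fun [set: Omega] (fun w => (X w ^+ 2)%:E).
  exact/measurable_EFinP.
have cvgfE w : (f n w)%:E @[n --> \oo] --> (X w ^+ 2)%:E.
  by apply: cvg_EFin; [exact: nearW|exact: cvgf].
have dom w n : (`|(f n w)%:E| <= (g w)%:E)%E.
  by rewrite abse_EFin lee_fin ger0_norm// (le_trans (f_le n w)).
have [_ _ cvg1] := @dominated_convergence _ _ _ P setT measurableT
  (fun n w => (f n w)%:E) (fun w => (X w ^+ 2)%:E) (EFin \o g) mf mX2E
  (aeW _ (fun w _ => cvgfE w)) ig (aeW _ (fun w n _ => dom w n)).
have intf n : (\int[P]_w (f n w)%:E =
    ((1 - (Num.sqrt (1 + 2 * v * t n))^-1) / t n)%:E)%E.
  have quad := @integral_gaussian_quadratic 0 (t n) (ltW (t0 n)).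
  have expE w : 2 * X w * 0 - t n * X w ^+ 2 = - (t n * X w ^+ 2).
    by rewrite mulr0 sub0r.
  rewrite (eq_integral (fun w => (expR (- (t n * X w ^+ 2)))%:E)) in quad; last first.
    by move=> w _; rewrite expE.
  rewrite expr0n/= mulr0 mul0r expR0 mulr1 in quad.
  have iexpn : P.-integrable [set: Omega] (fun w => (expR (- (t n * X w ^+ 2)))%:E).
    apply/integrableP; split; first exact/measurable_EFinP.
    under eq_integral do rewrite /= ger0_norm ?expR_ge0//.
    by rewrite quad ltry.
  have i1 : P.-integrable [set: Omega] (fun=> 1%E : \bar R).
    exact: (finite_measure_integrable_cst P 1%R).
  transitivity ((t n)^-1%:E *
      \int[P]_w (1%E - (expR (- (t n * X w ^+ 2)))%:E))%E.
    rewrite -integralZl//; last exact: integrableB.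
    by apply: eq_integral => w _; rewrite -EFinB -EFinM /f mulrC.
  rewrite integralB// quad (_ : \int[P]_w 1 = 1)%E; last first.
    exact: (probability_integral_cst P 1%R).
  by rewrite -EFinB -EFinM mulrC.
have cvg2 : (\int[P]_w (f n w)%:E)%E @[n --> \oo] --> v%:E.
  under eq_fun do rewrite intf.
  apply: cvg_EFin; first exact: nearW.
  (* Rationalising with [s ^+ 2 - 1 = 2 v t] removes the indeterminate quotient; at [s = 1] the new
     form has the value [2 v / (1 * 2) = v]. *)
  have sE n : (1 - (Num.sqrt (1 + 2 * v * t n))^-1) / t n = 2 * v /
      (Num.sqrt (1 + 2 * v * t n) * (Num.sqrt (1 + 2 * v * t n) + 1)).
    have k0 : 0 < 1 + 2 * v * t n.
      by rewrite ltr_pwDl// mulr_ge0 ?mulr_ge0// ltW.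
    have s0 : 0 < Num.sqrt (1 + 2 * v * t n) by rewrite sqrtr_gt0.
    have s2 := sqr_sqrtr (ltW k0).
    set s := Num.sqrt _ in s0 s2 *.
    have -> : 2 * v = (s ^+ 2 - 1) / t n by rewrite s2; field; rewrite gt_eqF.
    by field; rewrite !gt_eqF// addr_gt0.
  rewrite (_ : fine \o _ = fun n => 2 * v /
      (Num.sqrt (1 + 2 * v * t n) * (Num.sqrt (1 + 2 * v * t n) + 1))); last first.
    by apply/funext => n /=; exact: sE.
  have cvgs : Num.sqrt (1 + 2 * v * t n) @[n --> \oo] --> (1 : R).
    rewrite -[X in _ --> X](_ : Num.sqrt (1 + 2 * v * 0) = _); last first.
      by rewrite mulr0 addr0 sqrtr1.
    apply: continuous_cvg; first exact: sqrt_continuous.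
    apply: cvgD; first exact: cvg_cst.
    by apply: cvgM => //; exact: cvg_cst.
  rewrite -[X in _ --> X](_ : 2 * v / (1 * (1 + 1)) = _); last by field.
  apply: cvgM; first exact: cvg_cst.
  apply: cvgV; first by rewrite mul1r.
  by apply: cvgM => //; apply: cvgD => //; exact: cvg_cst.
exact: (cvg_unique (@ereal_hausdorff R) cvg1 cvg2).
Qed.

End gaussian_variable.

(** * Circularly symmetric complex Gaussian variables *)

Section complex_gaussian_variable.
Context d (Omega : measurableType d) (R : realType) (P : probability Omega R).
Variables (s : R) (Z : Omega -> R[i]).
Hypotheses (mZ : complex_measurable Z) (lZ : complex_gaussian P Z s).
Local Notation X := (fun w => complex.Re (Z w)).
Local Notation Y := (fun w => complex.Im (Z w)).

Let mX : measurable_fun [set: Omega] X. Proof. by case: mZ. Qed.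
Let mY : measurable_fun [set: Omega] Y. Proof. by case: mZ. Qed.

Lemma centered_gaussianT (v : R) : centered_gaussian v setT = 1%E.
Proof.
rewrite /centered_gaussian; case: eqP => _; first by rewrite diracT.
exact: (@probability_setT _ _ _ (normal_prob 0 (Num.sqrt v))).
Qed.

Lemma complex_gaussian_Re : gaussian_law P (s / 2) X.
Proof.
move=> A mA; have := lZ mA measurableT; rewrite centered_gaussianT mule1 => <-.
by congr (P _); apply/seteqP; split => // w [].
Qed.

Lemma complex_gaussian_Im : gaussian_law P (s / 2) Y.
Proof.
move=> A mA; have := lZ measurableT mA; rewrite centered_gaussianT mul1e => <-.
by congr (P _); apply/seteqP; split => // w [].
Qed.

Lemma complex_gaussian_indep : independent_pair P X Y.
Proof.
move=> A B mA mB; rewrite (complex_gaussian_Re mA) (complex_gaussian_Im mB).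
exact: lZ.
Qed.

Hypothesis s_ge0 : 0 <= s.

Let s2_ge0 : 0 <= s / 2. Proof. by rewrite divr_ge0. Qed.

Lemma complex_gaussian_opp : complex_gaussian P (fun w => - Z w) s.
Proof.
move=> A B mA mB.
have lRe := gaussian_law_opp complex_gaussian_Re s2_ge0.
have lIm := gaussian_law_opp complex_gaussian_Im s2_ge0.
rewrite -(lRe _ mA) -(lIm _ mB).
have mN (C : set R) : measurable C -> measurable (-%R @^-1` C : set R).
  move=> mC; rewrite -[X in measurable X]setTI.
  exact: (@measurable_funN _ _ _ setT id (@measurable_id _ _ setT)).
rewrite -(complex_gaussian_indep (mN _ mA) (mN _ mB)); congr (P _).
by apply/seteqP; split => w; rewrite /preimage/= !raddfN.
Qed.

Lemma integral_complex_gaussian_square :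
  (\int[P]_w (complex.Re (Z w) ^+ 2 + complex.Im (Z w) ^+ 2)%:E = s%:E)%E.
Proof.
under eq_integral do rewrite EFinD.
have mX2 : measurable_fun [set: Omega] (fun w => (X w ^+ 2)%:E).
  by apply/measurable_EFinP; exact: measurable_funX.
have mY2 : measurable_fun [set: Omega] (fun w => (Y w ^+ 2)%:E).
  by apply/measurable_EFinP; exact: measurable_funX.
rewrite ge0_integralD//; last 2 first.
- by move=> w _; rewrite lee_fin sqr_ge0.
- by move=> w _; rewrite lee_fin sqr_ge0.
rewrite (integral_gaussian_square mX complex_gaussian_Re s2_ge0).
rewrite (integral_gaussian_square mY complex_gaussian_Im s2_ge0).
by rewrite -EFinD; congr EFin; field.
Qed.

(** The exponent separates into the real and imaginary parts, both of variance [s / 2]. Each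
    contributes the factor [(1 + s q)] to the power minus one half, so the square roots disappear
    from the product. *)
Lemma integral_complex_gaussian_quadratic (c : R[i]) (q : R) : 0 <= q ->
  (\int[P]_w (expR (2 * complex.Re (c^*%C * Z w) -
      q * (complex.Re (Z w) ^+ 2 + complex.Im (Z w) ^+ 2)))%:E =
   ((1 + s * q)^-1 * expR (s / (1 + s * q) *
      (complex.Re c ^+ 2 + complex.Im c ^+ 2)))%:E)%E.
Proof.
move=> q0; case: c => a b /=.
pose e (a x : R) := expR (2 * x * a - q * x ^+ 2).
have me c : measurable_fun [set: R] (e c).
  apply: measurableT_comp => //; apply: measurable_funB.
    by apply: measurable_funM => //; exact: measurable_funM.
  by apply: measurable_funM => //; exact: measurable_funX.
have eE c x : (0 <= (e c x)%:E)%E by rewrite lee_fin expR_ge0.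
have meX : measurable_fun setT (fun w => (e a (X w))%:E).
  by apply/measurable_EFinP; exact: measurableT_comp.
have meY : measurable_fun setT (fun w => (e b (Y w))%:E).
  by apply/measurable_EFinP; exact: measurableT_comp.
pose phi (z : R * R) := ((e a z.1)%:E * (e b z.2)%:E)%E.
have mphi : measurable_fun setT phi.
  apply: emeasurable_funM; apply/measurable_EFinP.
    exact: (measurableT_comp (me a) measurable_fst).
  exact: (measurableT_comp (me b) measurable_snd).
transitivity (\int[P]_w phi (X w, Y w))%E.
  apply: eq_integral => w _; rewrite /phi -EFinM /e -expRD; congr (expR _)%:E.
  by case: (Z w) => x y /=; ring.
rewrite (ge0_integral_indep mX mY complex_gaussian_indep mphi); last first.
  by move=> z; rewrite /phi mule_ge0.
transitivity (\int[P]_w ((e a (X w))%:E * \int[P]_w' (e b (Y w'))%:E))%E.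
  by apply: eq_integral => w _; rewrite -ge0_integralZl.
rewrite ge0_integralZr//; last exact: integral_ge0.
rewrite (integral_gaussian_quadratic mX complex_gaussian_Re)//.
rewrite (integral_gaussian_quadratic mY complex_gaussian_Im)//.
have -> : 2 * (s / 2) * q = s * q by field.
have k0 : 0 < 1 + s * q by rewrite ltr_pwDl// mulr_ge0.
rewrite -EFinM; congr EFin; rewrite mulrACA -invfM -expr2 sqr_sqrtr ?ltW//.
by rewrite -expRD; congr (_ * expR _); field; rewrite gt_eqF.
Qed.

Lemma ge0_integral_complex_gaussian_shift (c : R[i]) (f : cborel R -> \bar R) :
  0 < s -> measurable_fun [set: cborel R] f -> (forall z, 0 <= f z)%E ->
  (\int[P]_w f (Z w + c)%R =
   \int[P]_w (f (Z w) * (expR ((2 * complex.Re (c^*%C * Z w) -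
      (complex.Re c ^+ 2 + complex.Im c ^+ 2)) / s))%:E))%E.
Proof.
move=> s0 mf f0; case: c => a b.
have s20 : 0 < s / 2 by rewrite divr_gt0.
pose e (a x : R) := expR ((2 * a * x - a ^+ 2) / (2 * (s / 2))).
have me c : measurable_fun [set: R] (e c).
  apply: measurableT_comp => //; apply: measurable_funM => //.
  by apply: measurable_funB => //; exact: measurable_funM.
have e0 c x : (0 <= (e c x)%:E)%E by rewrite lee_fin expR_ge0.
pose g (z : R * R) := f (z.1 +i* z.2).
have mg : measurable_fun setT g.
  apply: (measurableT_comp mf).
  by apply/(@complex_measurableP _ _ _ (fun z : R * R => z.1 +i* z.2 : cborel R)); split.
have g0 z : (0 <= g z)%E by exact: f0.
have mXa : measurable_fun setT (fun w => X w + a) by exact: measurable_funD.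
have mYb : measurable_fun setT (fun w => Y w + b) by exact: measurable_funD.
have XYab : independent_pair P (fun w => X w + a) (fun w => Y w + b).
  move=> A B mA mB.
  have mt (C : set R) k : measurable C -> measurable ((fun x => x + k) @^-1` C : set R).
    move=> mC; rewrite -[X in measurable X]setTI.
    exact: (@measurable_funD _ _ _ setT id (cst k) (@measurable_id _ _ setT)).
  exact: (complex_gaussian_indep (mt _ a mA) (mt _ b mB)).
transitivity (\int[P]_w g (X w + a, Y w + b)%R)%E.
  by apply: eq_integral => w _; rewrite /g; case: (Z w).
rewrite (ge0_integral_indep mXa mYb XYab mg g0).
(* The inner integral after shifting the imaginary part only. The real part is shifted next, with
   [F] as integrand, and independence reassembles the two weights into one. *)
pose F x := (\int[P]_w (g (x, Y w) * (e b (Y w))%:E))%E.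
have mgx x : measurable_fun setT (fun y => g (x, y)).
  exact: (measurableT_comp mg (measurable_fun_pair (@measurable_cst _ _ _ _ _ _)
    (@measurable_id _ _ _))).
have mF : measurable_fun setT F.
  pose h (z : R * Omega) := (g (z.1, Y z.2) * (e b (Y z.2))%:E)%E.
  have mYs : measurable_fun setT (fun z : R * Omega => Y z.2).
    exact: (measurableT_comp mY measurable_snd).
  apply: (@measurable_fun_fubini_tonelli_F _ _ _ _ _ P h); last by move=> z; rewrite /h mule_ge0.
  apply: emeasurable_funM.
    exact: (measurableT_comp mg (measurable_fun_pair measurable_fst mYs)).
  by apply/measurable_EFinP; exact: (measurableT_comp (me b) mYs).
transitivity (\int[P]_w F (X w + a)%R)%E.
  apply: eq_integral => w _.
  exact: (@ge0_integral_gaussian_shift _ _ _ _ _ _ mY complex_gaussian_Im b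
    (fun y => g (_, y)) s20 (mgx _) (fun=> g0 _)).
rewrite (ge0_integral_gaussian_shift mX complex_gaussian_Re)//; last first.
  by move=> x; apply: integral_ge0 => w _; rewrite mule_ge0.
pose phi (z : R * R) := (g z * (e b z.2)%:E * (e a z.1)%:E)%E.
have mphi : measurable_fun setT phi.
  apply: emeasurable_funM; last first.
    by apply/measurable_EFinP; exact: (measurableT_comp (me a) measurable_fst).
  apply: emeasurable_funM => //.
  by apply/measurable_EFinP; exact: (measurableT_comp (me b) measurable_snd).
transitivity (\int[P]_w phi (X w, Y w))%E; last first.
  apply: eq_integral => w _; rewrite /phi /g -muleA -EFinM -expRD.
  case: (Z w) => x y /=; congr (_ * (expR _)%:E)%E.
  by field; rewrite gt_eqF.
rewrite (ge0_integral_indep mX mY complex_gaussian_indep mphi); last first.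
  by move=> z; rewrite /phi !mule_ge0.
apply: eq_integral => w _; rewrite -ge0_integralZr//.
- apply: emeasurable_funM; first exact: (measurableT_comp (mgx _) mY).
  by apply/measurable_EFinP; exact: (measurableT_comp (me b) mY).
- by move=> w' _; rewrite mule_ge0.
Qed.

End complex_gaussian_variable.

(** * Exponential moments of the target response *)

(** Both products in [e1] equal the block matrix with rows [1, u] and [- v, 1]; comparing the
    determinants of the block-triangular factors gives the identity. *)
Lemma det_1D_rank_one (F : comNzRingType) n (u : 'cV[F]_n) (v : 'rV[F]_n) :
  \det (1%:M + u *m v) = 1 + (v *m u) 0 0.
Proof.
have e1 : block_mx 1%:M 0 (- v) 1%:M *m block_mx 1%:M u 0 (1%:M + v *m u) =
    block_mx (1%:M + u *m v) u 0 1%:M *m block_mx 1%:M 0 (- v) (1%:M : 'M[F]_1).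
  rewrite !mulmx_block !(mul1mx, mulmx1, mul0mx, mulmx0, addr0, add0r).
  by rewrite mulNmx mulmxN addrK addrCA addNr addr0.
have := congr1 determinant e1.
rewrite !det_mulmx !det_lblock !det_ublock !det1 !(mul1r, mulr1) => <-.
by rewrite det_mx11 !mxE eqxx.
Qed.

Section self_adjoint_forms.
Context (R : realType) (n : nat).
Local Notation C := R[i].
Implicit Types (u x y a : 'cV[C]_n) (Q W : 'M[C]_n).

Definition dotc u x : C := (u^t* *m x) 0 0.

Definition self_adjoint Q := Q^t* = Q.

Definition positive_semidef Q := forall x, 0 <= complex.Re (dotc x (Q *m x)).

Definition sqnormc (z : C) : R := complex.Re z ^+ 2 + complex.Im z ^+ 2.

Lemma sqnormcE z : (sqnormc z)%:C = z^*%C * z.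
Proof.
case: z => x y; apply/eqP; rewrite eq_complex /=.
by apply/andP; split; apply/eqP; rewrite /sqnormc /=; ring.
Qed.

Lemma sqnormc_ge0 z : 0 <= sqnormc z.
Proof. by rewrite addr_ge0 ?sqr_ge0. Qed.

Lemma adjmxD m k (A B : 'M[C]_(m, k)) : (A + B)^t* = A^t* + B^t*.
Proof. by rewrite linearD/= map_mxD. Qed.

Lemma adjmxN m k (A : 'M[C]_(m, k)) : (- A)^t* = - A^t*.
Proof. by rewrite linearN/= map_mxN. Qed.

Lemma adjmxM m k l (A : 'M[C]_(m, k)) (B : 'M[C]_(k, l)) :
  (A *m B)^t* = B^t* *m A^t*.
Proof. by rewrite trmx_mul map_mxM. Qed.

Lemma adjmxZ m k (c : C) (A : 'M[C]_(m, k)) : (c *: A)^t* = c^*%C *: A^t*.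
Proof. by rewrite linearZ/= map_mxZ. Qed.

Lemma adjmx1 m : (1%:M : 'M[C]_m)^t* = 1%:M.
Proof. by rewrite tr_scalar_mx map_scalar_mx rmorph1. Qed.

Lemma mulmx_dotcr m u x (A : 'M[C]_(m, 1)) : A *m (u^t* *m x) = dotc u x *: A.
Proof. by rewrite [u^t* *m x]mx11_scalar mul_mx_scalar. Qed.

Lemma dotc_conj u x : (dotc u x)^*%C = dotc x u.
Proof.
rewrite /dotc; have := adjmxM (u^t*) x; rewrite trmxCK => <-.
by rewrite !mxE.
Qed.

Lemma dotcDr u x y : dotc u (x + y) = dotc u x + dotc u y.
Proof. by rewrite /dotc mulmxDr mxE. Qed.

Lemma dotcNr u x : dotc u (- x) = - dotc u x.
Proof. by rewrite /dotc mulmxN mxE. Qed.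

Lemma dotcZr c u x : dotc u (c *: x) = c * dotc u x.
Proof. by rewrite /dotc -scalemxAr mxE. Qed.

Lemma dotcDl u v x : dotc (u + v) x = dotc u x + dotc v x.
Proof. by rewrite /dotc adjmxD mulmxDl mxE. Qed.

Lemma dotcNl u x : dotc (- u) x = - dotc u x.
Proof. by rewrite /dotc adjmxN mulNmx mxE. Qed.

Lemma dotcZl c u x : dotc (c *: u) x = c^*%C * dotc u x.
Proof. by rewrite /dotc adjmxZ -scalemxAl mxE. Qed.

Lemma dotcMl Q u x : dotc (Q *m u) x = dotc u (Q^t* *m x).
Proof. by rewrite /dotc adjmxM mulmxA. Qed.

Lemma self_adjoint_dotc Q u x : self_adjoint Q -> dotc (Q *m u) x = dotc u (Q *m x).
Proof. by move=> QH; rewrite dotcMl QH. Qed.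

Lemma self_adjoint_dotc_real Q x : self_adjoint Q ->
  dotc x (Q *m x) = (complex.Re (dotc x (Q *m x)))%:C.
Proof.
move=> QH; have : (dotc x (Q *m x))^*%C = dotc x (Q *m x).
  by rewrite dotc_conj self_adjoint_dotc.
case: (dotc _ _) => p q [] /esym/eqP; rewrite -subr_eq0 opprK -mulr2n.
by rewrite mulrn_eq0/= => /eqP ->.
Qed.

(** The exponent of an unnormalised Gaussian weight in [x], with linear term [u] and quadratic form
    [Q]. This family of exponents is stable under integrating out a Gaussian direction. *)
Definition qexponent Q u x : R :=
  2 * complex.Re (dotc u x) - complex.Re (dotc x (Q *m x)).

(** Isolates the dependence on the scalar [z]: what remains is the exponent of
    [integral_complex_gaussian_quadratic], with linear coefficient [dotc a (u - Q *m x)] and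
    curvature [dotc a (Q *m a)]. *)
Lemma qexponentD Q u x a z : self_adjoint Q ->
  qexponent Q u (x + z *: a) = qexponent Q u x +
    (2 * complex.Re ((dotc a (u - Q *m x))^*%C * z) -
     complex.Re (dotc a (Q *m a)) * sqnormc z).
Proof.
move=> QH; rewrite /qexponent dotc_conj (dotcDl u) dotcNl (self_adjoint_dotc x a QH).
rewrite mulmxDr -scalemxAr !(dotcDr, dotcDl) !(dotcZr, dotcZl).
rewrite -(self_adjoint_dotc a x QH) -(dotc_conj x (Q *m a)).
rewrite (self_adjoint_dotc_real a QH).
case: (dotc u x) => ? ?; case: (dotc u a) => ? ?; case: z => ? ?.
case: (dotc x (Q *m a)) => ? ?; case: (dotc x (Q *m x)) => ? ?.
by rewrite /sqnormc /=; ring.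
Qed.

Section rank_one_update.
Variables (Q : 'M[C]_n) (a : 'cV[C]_n) (s : R).
Hypotheses (QH : self_adjoint Q) (Qpsd : positive_semidef Q) (s0 : 0 <= s).
Let q := complex.Re (dotc a (Q *m a)).
Let k := s / (1 + s * q).
(* [W] is kept abstract so that rewriting with associativity does not unfold it. *)
Variable W : 'M[C]_n.
Hypothesis WE : W = a *m a^t*.

(* Integrating out an independent Gaussian summand [b *: a] with [b ~ CN(0, s)]
   turns the quadratic form [Q] into [downdate] and the linear term [u] into
   [downdate_vec u]. *)
Definition downdate : 'M[C]_n := Q - k%:C *: (Q *m W *m Q).

Definition downdate_vec u : 'cV[C]_n := u - k%:C *: (Q *m W *m u).

Let q0 : 0 <= q. Proof. exact: Qpsd. Qed.

Let sq0 : 0 < 1 + s * q. Proof. by rewrite ltr_pwDl// mulr_ge0. Qed.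

Let kE : k * (1 + s * q) = s. Proof. by rewrite /k divfK// gt_eqF. Qed.

(** The relation behind every Sherman-Morrison cancellation below: the rank-one terms always collect
    into [s - k (1 + s q)]. *)
Let kEC : k%:C * (1 + s%:C * q%:C) = s%:C :> C.
Proof.
apply/eqP; rewrite eq_complex /=; apply/andP; split; apply/eqP; last by ring.
by rewrite -[RHS]kE; ring.
Qed.

Let WH : W^t* = W. Proof. by rewrite WE adjmxM trmxCK. Qed.

Let kH : (k%:C)^*%C = k%:C :> C. Proof. exact: conjc_real. Qed.

Let Wx x : W *m x = dotc a x *: a.
Proof. by rewrite WE -mulmxA mulmx_dotcr. Qed.

Let WQW : W *m Q *m W = q%:C *: W.
Proof.
rewrite {2}WE mulmxA -(mulmxA W Q a) Wx -scalemxAl self_adjoint_dotc_real//.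
by rewrite -WE.
Qed.

Lemma self_adjoint_downdate : self_adjoint downdate.
Proof.
by rewrite /self_adjoint /downdate adjmxD adjmxN adjmxZ (adjmxM _ Q) (adjmxM Q W) WH QH kH mulmxA.
Qed.

Lemma dotc_downdate x : complex.Re (dotc x (downdate *m x)) =
  complex.Re (dotc x (Q *m x)) - k * sqnormc (dotc a (Q *m x)).
Proof.
rewrite /downdate mulmxBl -scalemxAl -!mulmxA Wx -scalemxAr.
rewrite dotcDr dotcNr !dotcZr -(self_adjoint_dotc x a QH).
rewrite -(dotc_conj a (Q *m x)).
case: (dotc x (Q *m x)) => ? ?; case: (dotc a (Q *m x)) => ? ?.
by rewrite /sqnormc /=; ring.
Qed.

Lemma positive_semidef_downdate : positive_semidef downdate.
Proof.
move=> x; rewrite dotc_downdate.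
set b := dotc a (Q *m x).
(* Testing [Q] on this vector bounds its form at [x] below by [(2 k - k ^+ 2 q) |b| ^+ 2]. Since
   [k q <= 1], this is at least [k |b| ^+ 2], the amount subtracted by [downdate]. *)
have := Qpsd (x - (k%:C * b) *: a).
rewrite mulmxBr -scalemxAr !(dotcDr, dotcNr, dotcDl, dotcNl, dotcZr, dotcZl).
rewrite (self_adjoint_dotc_real a QH) -/b -/q.
rewrite -(self_adjoint_dotc x a QH) -(dotc_conj a (Q *m x)) -/b.
have k_ge0 : 0 <= k by rewrite divr_ge0// ltW.
have kq1 : 0 <= k * (1 - k * q) * sqnormc b.
  rewrite mulr_ge0 ?sqnormc_ge0// mulr_ge0// subr_ge0.
  rewrite /k mulrAC ler_pdivrMr// mul1r; lra.
case: (dotc x (Q *m x)) => X ?; move: kq1; rewrite /sqnormc; case: b => b1 b2 /=.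
by move=> h1 h2; lra.
Qed.

(** The left side is the exponent left after integrating over the scalar coefficient of [a].
    Expanding the square separates a term free of [x] from a new exponent of the same shape, which
    is what dictates [downdate] and [downdate_vec]. *)
Lemma qexponent_downdate u x :
  qexponent Q u x + k * sqnormc (dotc a (u - Q *m x)) =
  k * sqnormc (dotc a u) + qexponent downdate (downdate_vec u) x.
Proof.
rewrite /qexponent dotc_downdate /downdate_vec dotcDl dotcNl dotcZl kH.
rewrite -mulmxA Wx -scalemxAr dotcZl dotcDr dotcNr self_adjoint_dotc//.
case: (dotc u x) => ? ?; case: (dotc x (Q *m x)) => ? ?.
case: (dotc a u) => ? ?; case: (dotc a (Q *m x)) => ? ?.
by rewrite /sqnormc /=; ring.
Qed.

Variable R' : 'M[C]_n.
Let Rs := R' + s%:C *: W.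
Let B := 1%:M + s%:C *: (W *m Q).

Let detB : \det B = (1 + s * q)%:C.
Proof.
rewrite /B WE -mulmxA scalemxAl det_1D_rank_one.
rewrite -scalemxAr mxE -mulmxA -/(dotc _ _) self_adjoint_dotc_real//.
by rewrite -/q rmorphD rmorph1 rmorphM.
Qed.

(** The point is [downdate *m B = Q]: by Sherman-Morrison, [downdate] is [Q] times the inverse of
    [B]. The rank-one determinant then comes entirely from [B]. *)
Let factor : 1%:M + Rs *m Q = (1%:M + R' *m downdate) *m B.
Proof.
have dB : downdate *m B = Q.
  have e : Q *m W *m Q *m (W *m Q) = q%:C *: (Q *m W *m Q).
    by rewrite mulmxA -2!(mulmxA Q) WQW -scalemxAr -scalemxAl !mulmxA.
  rewrite /downdate /B mulmxDr mulmx1 mulmxBl -!scalemxAr -!scalemxAl e mulmxA.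
  move: (Q *m W *m Q) => X; apply/matrixP => i j; rewrite !mxE.
  transitivity (Q i j + (s%:C - k%:C * (1 + s%:C * q%:C)) * X i j); first by ring.
  by rewrite kEC subrr mul0r addr0.
rewrite mulmxDl mul1mx -mulmxA dB /Rs /B mulmxDl -scalemxAl.
by rewrite -addrA [R' *m Q + _]addrC addrA.
Qed.

Lemma det_downdate :
  \det (1%:M + Rs *m Q) = (1 + s * q)%:C * \det (1%:M + R' *m downdate).
Proof. by rewrite factor det_mulmx detB mulrC. Qed.

Lemma inv_downdate u : \det (1%:M + R' *m downdate) != 0 ->
  k * sqnormc (dotc a u) + complex.Re (dotc (downdate_vec u)
    (invmx (1%:M + R' *m downdate) *m R' *m downdate_vec u)) =
  complex.Re (dotc u (invmx (1%:M + Rs *m Q) *m Rs *m u)).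
Proof.
move=> D1.
have uD1 : (1%:M + R' *m downdate) \in unitmx by rewrite unitmxE unitfE.
have uD : (1%:M + Rs *m Q) \in unitmx.
  rewrite unitmxE unitfE det_downdate mulf_neq0//.
  by rewrite (inj_eq (@complexI R)) gt_eqF.
set T1 := invmx (1%:M + R' *m downdate) *m R'.
(* [Binv] is the inverse of [B] and [V] its adjoint, and [V] is the linear map behind
   [downdate_vec]. The quadratic form in [downdate_vec u] thus becomes one in [u] with matrix
   [Binv *m T1 *m V]. *)
pose V := 1%:M - k%:C *: (Q *m W).
pose Binv := 1%:M - k%:C *: (W *m Q).
have VH : V^t* = Binv.
  by rewrite /V adjmxD adjmxN adjmxZ adjmxM adjmx1 WH QH kH.
have -> : downdate_vec u = V *m u.
  by rewrite /downdate_vec /V mulmxBl mul1mx -scalemxAl.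
have BBinv : B *m Binv = 1%:M.
  have e : W *m Q *m (W *m Q) = q%:C *: (W *m Q) by rewrite mulmxA WQW -scalemxAl.
  rewrite /B /Binv mulmxBr mulmx1 mulmxDl mul1mx -!scalemxAr -!scalemxAl e.
  move: (W *m Q) => X; apply/matrixP => i j; rewrite !mxE.
  transitivity ((i == j)%:R + (s%:C - k%:C * (1 + s%:C * q%:C)) * X i j).
    by ring.
  by rewrite kEC subrr mul0r addr0.
(* Recursion for the matrix of the final exponent. It is checked after multiplication by [1 + Rs Q],
   where [factor] cancels [Binv] and [T1] down to [R' *m V]. *)
have key : k%:C *: W + Binv *m T1 *m V = invmx (1%:M + Rs *m Q) *m Rs.
  apply: (canRL (mulKmx uD)).
  have e2 : (1%:M + Rs *m Q) *m (Binv *m T1 *m V) = R' *m V.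
    rewrite factor -(mulmxA _ B) (mulmxA B) (mulmxA B) BBinv mul1mx mulmxA.
    by rewrite /T1 (mulKVmx uD1).
  rewrite mulmxDr e2.
  have e : Rs *m Q *m W = R' *m Q *m W + (s%:C * q%:C) *: W.
    by rewrite /Rs mulmxDl mulmxDl -!scalemxAl WQW scalerA.
  rewrite /V mulmxBr mulmx1 -!scalemxAr mulmxDl mul1mx e (mulmxA R').
  move: (R' *m Q *m W) => X; apply/matrixP => i j; rewrite !mxE.
  transitivity (R' i j + k%:C * (1 + s%:C * q%:C) * W i j); first by ring.
  by rewrite kEC.
rewrite -key; clear key BBinv; move: Binv V VH => Binv V VH.
rewrite mulmxDl -(scalemxAl _ W) dotcDr dotcZr Wx dotcZr dotcMl VH !mulmxA.
rewrite -(dotc_conj a u); case: (dotc a u) => x y; case: (dotc u _) => x' y'.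
by rewrite /sqnormc /=; ring.
Qed.

End rank_one_update.
End self_adjoint_forms.

Lemma complex_measurable_dotc d (T : measurableType d) (R : realType) n
    (f g : T -> 'cV[R[i]]_n) : mx_measurable f -> mx_measurable g ->
  complex_measurable (fun t => dotc (f t) (g t)).
Proof. by move=> mf mg; apply: mx_measurableM => //; exact: mx_measurable_adj. Qed.

Lemma measurable_qexponent d (T : measurableType d) (R : realType) n
    (Q : 'M[R[i]]_n) u (f : T -> 'cV[R[i]]_n) : mx_measurable f ->
  measurable_fun [set: T] (fun t => qexponent Q u (f t)).
Proof.
move=> mf; have [m1 _] := complex_measurable_dotc (mx_measurable_cst T u) mf.
have [m2 _] := complex_measurable_dotc mf
  (mx_measurableM (mx_measurable_cst T Q) mf).
rewrite /qexponent; apply: measurable_funB; last exact: m2.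
by apply: measurable_funM; [exact: measurable_cst|exact: m1].
Qed.

Lemma gtc0E (R : realType) (z : R[i]) : 0 < z -> z = (complex.Re z)%:C.
Proof. by case: z => x y; rewrite ltcE/= => /andP[/eqP ->]. Qed.

Section gaussian_exponent.
Context d (Omega : measurableType d) (R : realType) (P : probability Omega R).
Variables (I : finType) (beta : I -> Omega -> cborel R).
Hypothesis mbeta : forall i, measurable_fun [set: Omega] (beta i).
Hypothesis ibeta : mutually_independent P beta.
Variables (sg : I -> R).
Hypothesis sg_ge0 : forall i, 0 <= sg i.
Hypothesis lbeta : forall i, complex_gaussian P (beta i) (sg i).
Variables (n : nat) (a : I -> 'cV[R[i]]_n).

(** The second moment of the partial sum over [s], as an algebraic expression that follows the
    induction on the list; [cross_correlation_response] identifies it for the full sum. *)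
Definition covariance_mx (s : seq I) : 'M[R[i]]_n :=
  \sum_(k <- s) (sg k)%:C *: (a k *m (a k)^t*).

(** Induction on the list with [Q] and [u] general, since integrating out the head summand changes
    both. Positivity of the determinant is carried along because the step inverts the matrix of the
    shorter list. *)
Lemma integral_expR_qexponent (s : seq I) (Q : 'M[R[i]]_n) (u : 'cV[R[i]]_n) :
  uniq s ->
  self_adjoint Q -> positive_semidef Q ->
  0 < \det (1%:M + covariance_mx s *m Q) /\
  (\int[P]_w (expR (qexponent Q u (linear_combination beta a s w)))%:E =
   ((complex.Re (\det (1%:M + covariance_mx s *m Q)))^-1 *
    expR (complex.Re (dotc u
      (invmx (1%:M + covariance_mx s *m Q) *m covariance_mx s *m u))))%:E)%E.
Proof.
elim: s Q u => [|j s IH] Q u.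
  move=> _ QH Qpsd; rewrite /covariance_mx big_nil mul0mx addr0 det1; split=> //.
  rewrite mulmx0 mul0mx /dotc mulmx0 mxE /= expR0 invr1 mulr1.
  rewrite -[RHS](probability_integral_cst P 1); apply: eq_integral => w _.
  rewrite /linear_combination big_nil /qexponent /dotc !mulmx0 mxE /=.
  by rewrite mulr0 subr0 expR0.
move=> /= /andP[js us] QH Qpsd.
set q := complex.Re (dotc (a j) (Q *m a j)).
have q0 : 0 <= q by exact: Qpsd.
set k := sg j / (1 + sg j * q).
have sq0 : 0 < 1 + sg j * q by rewrite ltr_pwDl// mulr_ge0.
set W := a j *m (a j)^t*.
have WE : W = a j *m (a j)^t* by [].
clearbody W.
have [D1 IH1] := IH (downdate Q (a j) (sg j) W)
  (downdate_vec Q (a j) (sg j) W u) us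
  (self_adjoint_downdate (sg j) QH WE)
  (positive_semidef_downdate QH Qpsd (sg_ge0 j) WE).
have covE : covariance_mx (j :: s) =
    covariance_mx s + (sg j)%:C *: W.
  by rewrite /covariance_mx big_cons addrC WE.
have detE := det_downdate QH Qpsd (sg_ge0 j) WE (covariance_mx s).
rewrite -covE in detE.
have invE := inv_downdate QH Qpsd (sg_ge0 j) WE (R' := covariance_mx s) u.
rewrite -covE in invE.
split.
  rewrite detE mulr_gt0//.
  by rewrite ltcE /= eqxx.
have mS : mx_measurable (linear_combination beta a s).
  by apply/mx_measurableP; exact: measurable_linear_combination.
pose phi (z : cmx R n 1 * cborel R) := (expR (qexponent Q u
  ((z.1 : 'cV[R[i]]_n) + (z.2 : R[i]) *: a j)))%:E.
have mphi : measurable_fun setT phi.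
  apply/measurable_EFinP; apply: measurableT_comp => //.
  apply: measurable_qexponent; apply: mx_measurableD.
    apply/(@mx_measurableP _ _ _ _ _ (fst : _ -> cmx R n 1)).
    exact: measurable_fst.
  apply: mx_measurableZ; last exact: mx_measurable_cst.
  apply/(@complex_measurableP _ _ _ (snd : _ -> cborel R)).
  exact: measurable_snd.
have phi0 z : (0 <= phi z)%E by rewrite lee_fin expR_ge0.
transitivity (\int[P]_w phi (linear_combination beta a s w, beta j w))%E.
  apply: eq_integral => w _; rewrite /phi /= /linear_combination big_cons.
  by rewrite addrC.
rewrite (ge0_integral_indep (measurable_linear_combination mbeta a s) (mbeta j)
  (independent_linear_combination mbeta ibeta a us js) mphi phi0).
(* With the partial sum frozen at [x], only a scalar complex Gaussian integral remains; its value is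
   a constant times a weight in [x] of the same kind, ready for the induction hypothesis. *)
have inner w : (\int[P]_w' phi (linear_combination beta a s w, beta j w') =
    ((1 + sg j * q)^-1 * expR (k * sqnormc (dotc (a j) u)))%:E *
    (expR (qexponent (downdate Q (a j) (sg j) W)
      (downdate_vec Q (a j) (sg j) W u)
      (linear_combination beta a s w)))%:E)%E.
  set x : 'cV[R[i]]_n := linear_combination beta a s w.
  transitivity (\int[P]_w' ((expR (qexponent Q u x))%:E *
    (expR (2 * complex.Re ((dotc (a j) (u - Q *m x))^*%C * (beta j w')) -
      q * sqnormc (beta j w')))%:E))%E.
    apply: eq_integral => w' _.
    by rewrite /phi /= qexponentD// expRD EFinM.
  have mbj := mbeta j; have /complex_measurableP mbjc := mbj.
  rewrite ge0_integralZl//; last first.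
    apply/measurable_EFinP; apply: measurableT_comp => //.
    apply: measurable_funB; apply: measurable_funM => //.
      by have [] := complex_measurableM (complex_measurable_cst _
        (dotc (a j) (u - Q *m x))^*%C) mbjc.
    by case: mbjc => ? ?; apply: measurable_funD; exact: measurable_funX.
  rewrite (integral_complex_gaussian_quadratic mbjc (lbeta j))//.
  rewrite -/(sqnormc _) -!EFinM; congr EFin.
  rewrite -[RHS]mulrA [LHS]mulrCA -!expRD -/k; congr (_ * expR _).
  by rewrite (qexponent_downdate (sg j) QH WE).
under eq_integral do rewrite inner.
set c := (1 + sg j * q)^-1 * _.
pose G w := (expR (qexponent (downdate Q (a j) (sg j) W)
  (downdate_vec Q (a j) (sg j) W u) (linear_combination beta a s w)))%:E.
have mG : measurable_fun setT G.
  by apply/measurable_EFinP; apply: measurableT_comp => //; exact: measurable_qexponent.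
have G0 w : (0 <= G w)%E by rewrite lee_fin expR_ge0.
have c0 : (0 <= c%:E)%E.
  by rewrite lee_fin; apply: mulr_ge0; [rewrite invr_ge0 ltW|exact: expR_ge0].
transitivity (c%:E * \int[P]_w G w)%E.
  exact: (ge0_integralZl P measurableT mG (fun w _ => G0 w) c0).
rewrite /G IH1 -EFinM; congr EFin; rewrite /c.
rewrite detE -invE ?gt_eqF// expRD -/q -/k.
rewrite [complex.Re (_ * _)](_ : _ = (1 + sg j * q) * complex.Re
  (\det (1%:M + covariance_mx s *m downdate Q (a j) (sg j) W))); last first.
  by case: (\det _) => x y /=; ring.
by rewrite invfM mulrACA.
Qed.

End gaussian_exponent.

(** * Matrices with independent Gaussian entries *)

Section complex_matrix_rectangles.
Context (R : realType) (m n : nat).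

Definition cmx_rectangle (B : 'I_m * 'I_n -> set (cborel R)) : set (cmx R m n) :=
  [set A : 'M[R[i]]_(m, n) | forall ij, B ij (A ij.1 ij.2)].

(** A generating system closed under intersection on which independence of the entries can be
    applied directly. *)
Definition cmx_rectangles : set (set (cmx R m n)) :=
  [set cmx_rectangle B | B in [set B | forall ij, measurable (B ij)]].

Lemma measurable_cmx_rectangle B :
  (forall ij, measurable (B ij)) -> measurable (cmx_rectangle B).
Proof.
move=> mB; rewrite (_ : cmx_rectangle B =
    \bigcap_ij [set A : 'M[R[i]]_(m, n) | B ij (A ij.1 ij.2)]).
  apply: fin_bigcap_measurable => // ij _.
  by apply: sub_sigma_algebra; exists ij.1, ij.2, (B ij).
by apply/seteqP; split => [A H ij _|A H ij]; exact: H.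
Qed.

Lemma measurable_cmx_rectangles :
  @measurable _ (cmx R m n) = <<s cmx_rectangles >>.
Proof.
apply/seteqP; split.
- apply: smallest_sub; first exact: smallest_sigma_algebra.
  move=> _ [i [j [B [mB ->]]]].
  apply: sub_sigma_algebra; exists (fun ij => if ij == (i, j) then B else setT).
    by move=> ij /=; case: ifP.
  apply/seteqP; split => A.
    by move=> /(_ (i, j)); rewrite eqxx.
  by move=> BA ij; case: eqP => [->|].
- apply: smallest_sub; first exact: sigma_algebra_measurable.
  by move=> _ [B mB <-]; exact: measurable_cmx_rectangle.
Qed.

Lemma setI_closed_cmx_rectangles : setI_closed cmx_rectangles.
Proof.
move=> _ _ [B mB <-] [C mC <-]; exists (fun ij => B ij `&` C ij).
  by move=> ij; exact: measurableI.
apply/seteqP; split => [A H|A [HB HC] ij]; last by split; [exact: HB|exact: HC].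
by split=> ij; case: (H ij).
Qed.

Lemma cmx_rectanglesT : cmx_rectangles setT.
Proof. by exists (fun=> setT) => //; apply/seteqP; split. Qed.

End complex_matrix_rectangles.

Section gaussian_matrix.
Context d (Omega : measurableType d) (R : realType) (P : probability Omega R).
Variables (m n : nat) (N : Omega -> cmx R m n) (s : R).
Hypothesis mN : measurable_fun [set: Omega] N.
Hypothesis s_gt0 : 0 < s.
Hypothesis lN : forall i j,
  complex_gaussian P (fun w => (N w : 'M[R[i]]_(m, n)) i j) s.
Hypothesis iN : mutually_independent P
  (fun (ij : 'I_m * 'I_n) (w : Omega) =>
    (N w : 'M[R[i]]_(m, n)) ij.1 ij.2 : cborel R).

(** The Cameron-Martin weight: the density at [B] of the law of [N + A] relative to that of [N], as
    a product over entries so that it matches entrywise independence. *)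
Definition shift_weight (A B : 'M[R[i]]_(m, n)) : R :=
  \prod_ij expR ((2 * complex.Re ((A ij.1 ij.2)^*%C * B ij.1 ij.2) -
    sqnormc (A ij.1 ij.2)) / s).

Lemma measurable_shift_weight d' (T : measurableType d')
    (f g : T -> 'M[R[i]]_(m, n)) : mx_measurable f -> mx_measurable g ->
  measurable_fun [set: T] (fun t => shift_weight (f t) (g t)).
Proof.
move=> mf mg; apply: measurable_prod => ij _; apply: measurableT_comp => //.
apply: measurable_funM => //; apply: measurable_funB.
  apply: measurable_funM => //.
  by have [] := complex_measurableM (complex_measurable_conj (mf ij.1 ij.2)) (mg ij.1 ij.2).
by case: (mf ij.1 ij.2) => ? ?; apply: measurable_funD; exact: measurable_funX.
Qed.

(** It suffices to compare the two laws on rectangles. There both sides are products over the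
    entries, and each factor is an instance of the scalar shift formula applied to an indicator. *)
Lemma ge0_integral_gaussian_matrix_shift (A : 'M[R[i]]_(m, n))
    (phi : cmx R m n -> \bar R) :
  measurable_fun [set: cmx R m n] phi -> (forall B, (0 <= phi B)%E) ->
  (\int[P]_w phi ((N w : 'M[R[i]]_(m, n)) + A)%R =
   \int[P]_w (phi (N w) * (shift_weight A (N w))%:E))%E.
Proof.
move=> mphi phi0.
have mNx : mx_measurable (N : Omega -> 'M[R[i]]_(m, n)) by apply/mx_measurableP.
have mNA : measurable_fun setT (fun w => (N w : 'M[R[i]]_(m, n)) + A : cmx R m n).
  apply/mx_measurableP; apply: mx_measurableD => //; exact: mx_measurable_cst.
have mNij ij : measurable_fun setT
    (fun w => (N w : 'M[R[i]]_(m, n)) ij.1 ij.2 : cborel R).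
  exact/complex_measurableP.
have mshift (c : R[i]) : measurable_fun setT (fun z : cborel R => (z : R[i]) + c : cborel R).
  apply/complex_measurableP; apply: complex_measurableD.
    by apply/(@complex_measurableP _ _ _ id).
  exact: complex_measurable_cst.
have mw : measurable_fun setT (fun w => shift_weight A (N w)).
  by apply: measurable_shift_weight => //; exact: mx_measurable_cst.
have w0 w : 0 <= shift_weight A (N w).
  by apply: prodr_ge0 => ij _; exact: expR_ge0.
transitivity (\int[P]_w (phi ((N w : 'M[R[i]]_(m, n)) + A)%R * (cst 1%R w)%:E))%E.
  by apply: eq_integral => w _; rewrite mule1.
apply: (@ge0_integral_weighted_law _ _ _ _ _ _ _ P P
  (fun w => (N w : 'M[R[i]]_(m, n)) + A : cmx R m n) N (cst 1)
  (fun w => shift_weight A (N w)) mNA mN _ w0 _ mw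
  (@cmx_rectangles R m n) (@measurable_cmx_rectangles R m n)
  (@setI_closed_cmx_rectangles R m n) (@cmx_rectanglesT R m n)) => //.
  by rewrite [X in (X < _)%E](probability_integral_cst P 1) ltry.
move=> _ [B mB <-].
rewrite [LHS]integral_one; last first.
  by apply: measurable_preimage => //; exact: measurable_cmx_rectangle.
pose B' ij : set (cborel R) := (fun z => (z : R[i]) + A ij.1 ij.2) @^-1` B ij.
have mB' ij : measurable (B' ij).
  by rewrite -[B' ij]setTI; exact: (mshift (A ij.1 ij.2) measurableT).
transitivity (P [set w | forall ij, B' ij ((N w : 'M[R[i]]_(m, n)) ij.1 ij.2)]).
  congr (P _); apply/seteqP; split => w H ij; have := H ij;
  by rewrite /B' /= /preimage /= ?mxE.
rewrite (iN mB').
(* The factor of the entry [ij]: its indicator times its share of the weight. By the scalar shift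
   its mean is the probability that the shifted entry lies in [B ij]. *)
pose h ij (z : cborel R) : R := \1_(B ij) z *
  expR ((2 * complex.Re ((A ij.1 ij.2)^*%C * z) - sqnormc (A ij.1 ij.2)) / s).
have mh ij : measurable_fun setT (h ij).
  apply: measurable_funM; first exact: measurable_indic.
  apply: measurableT_comp => //; apply: measurable_funM => //.
  apply: measurable_funB => //; apply: measurable_funM => //.
  have mid : complex_measurable (fun z : cborel R => (z : R[i])).
    by apply/(@complex_measurableP _ _ _ id).
  by have [] := complex_measurableM (complex_measurable_cst _ ((A ij.1 ij.2)^*%C)) mid.
have h0 ij z : 0 <= h ij z by rewrite mulr_ge0 ?expR_ge0.
have hE ij : (\int[P]_w (h ij ((N w : 'M[R[i]]_(m, n)) ij.1 ij.2))%:E =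
    P ((fun w => (N w : 'M[R[i]]_(m, n)) ij.1 ij.2 : cborel R) @^-1` B' ij))%E.
  rewrite -integral_one; last exact: measurable_preimage.
  have mI : measurable_fun setT (fun z : cborel R => (\1_(B ij) z : R)%:E).
    by apply/measurable_EFinP; exact: measurable_indic.
  have I0 z : (0 <= (\1_(B ij) z : R)%:E)%E by rewrite lee_fin.
  have H := ge0_integral_complex_gaussian_shift (mNx ij.1 ij.2) (lN ij.1 ij.2)
    (A ij.1 ij.2) s_gt0 mI I0.
  apply: (eq_trans _ (eq_trans (esym H) _)).
    by apply: eq_integral => w _; rewrite /h EFinM.
  rewrite [RHS]integral_mkcond; apply: eq_integral => w _.
  rewrite patchE mem_preimage_set indicE.
  rewrite (_ : (_ \in B' ij) = (N w ij.1 ij.2 + A ij.1 ij.2 \in B ij)).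
    by case: (_ \in B ij).
  exact: (mem_preimage_set _ (B ij)).
transitivity (\int[P]_w (\prod_ij h ij ((N w : 'M[R[i]]_(m, n)) ij.1 ij.2))%:E)%E.
  rewrite (mutually_independent_integral_prod mNij iN h0 mh).
    by congr (_%:E); apply: eq_bigr => ij _; congr fine; exact/esym/hE.
  move=> ij; rewrite hE ltey_eq fin_num_measure//.
  exact: measurable_preimage.
rewrite [RHS]integral_mkcond; apply: eq_integral => w _; rewrite patchE.
rewrite /h big_split/=; case: ifPn => [/set_mem H|].
  rewrite big1 ?mul1r// => ij _; rewrite indicE mem_set//; exact: H.
rewrite notin_setE => /existsNP[ij Hij].
by rewrite (bigD1 ij)//= indicE (memNset Hij) !mul0r.
Qed.

End gaussian_matrix.

(** * Second moments *)

Section equal_laws.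
Context d (Omega : measurableType d) (R : realType) (P : probability Omega R).

Definition same_law d' (T : measurableType d') (X Y : Omega -> T) :=
  forall A, measurable A -> P (X @^-1` A) = P (Y @^-1` A).

Lemma same_law_generated d' (T : measurableType d') (X Y : Omega -> T)
    (G : set (set T)) :
  measurable_fun [set: Omega] X -> measurable_fun [set: Omega] Y ->
  measurable = <<s G >> -> setI_closed G -> G setT ->
  (forall A, G A -> P (X @^-1` A) = P (Y @^-1` A)) -> same_law X Y.
Proof.
move=> mX mY GE GI GT XY A mA.
pose p : {measure set T -> \bar R} := pushforward P X.
pose p' : {measure set T -> \bar R} := pushforward P Y.
apply: (measure_unique G (fun=> setT) GE GI _ _ (p mX) (p' mY)) => //.
  by rewrite bigcup_const.
move=> _; rewrite /p/= /pushforward preimage_setT ltey_eq fin_num_measure//.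
Qed.

Lemma independent_pair_same_law da db (Ta : measurableType da)
    (Tb : measurableType db) (X X' : Omega -> Ta) (Y : Omega -> Tb) :
  measurable_fun [set: Omega] X -> measurable_fun [set: Omega] X' ->
  measurable_fun [set: Omega] Y ->
  independent_pair P X Y -> independent_pair P X' Y -> same_law X X' ->
  same_law (fun w => (X w, Y w)) (fun w => (X' w, Y w)).
Proof.
move=> mX mX' mY XY X'Y XX'.
apply: (@same_law_generated _ (Ta * Tb)%type _ _
  [set A `*` B | A in measurable & B in measurable]).
- exact: measurable_fun_pair.
- exact: measurable_fun_pair.
- exact: measurable_prod_measurableType.
- move=> /= _ _ [X1 mX1 [X2 mX2 <-]] [Y1 mY1 [Y2 mY2 <-]].
  rewrite -setXI; exists (X1 `&` Y1); first exact: measurableI.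
  by exists (X2 `&` Y2) => //; exact: measurableI.
- by exists setT => //; exists setT => //; rewrite setXTT.
- move=> _ [A mA [B mB <-]].
  transitivity (P (X @^-1` A `&` Y @^-1` B)); first by [].
  by rewrite XY// XX'// -X'Y.
Qed.

Lemma integral_same_law d' (T : measurableType d') (X Y : Omega -> T)
    (f : T -> \bar R) :
  measurable_fun [set: Omega] X -> measurable_fun [set: Omega] Y ->
  same_law X Y -> measurable_fun [set: T] f ->
  (\int[P]_w f (X w) = \int[P]_w f (Y w))%E.
Proof.
move=> mX mY XY mf.
have ge0 h : measurable_fun setT h -> (forall t, (0 <= h t)%E) ->
    (\int[P]_w h (X w) = \int[P]_w h (Y w))%E.
  move=> mh h0.
  have := @ge0_integral_pushforward _ _ _ _ R X mX P setT h measurableT mh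
    (fun y _ => h0 y).
  rewrite preimage_setT => <-.
  have := @ge0_integral_pushforward _ _ _ _ R Y mY P setT h measurableT mh
    (fun y _ => h0 y).
  rewrite preimage_setT => <-.
  pose p : {measure set T -> \bar R} := pushforward P X.
  pose p' : {measure set T -> \bar R} := pushforward P Y.
  apply: (@eq_measure_integral _ _ _ setT (p' mY) (p mX)) => A mA _.
  exact: XY.
rewrite integralE [RHS]integralE; congr (_ - _)%E.
- have := ge0 (f^\+)%E (measurable_funepos mf) (funepos_ge0 f).
  by rewrite !funepos.unlock.
- have := ge0 (f^\-)%E (measurable_funeneg mf) (funeneg_ge0 f).
  by rewrite !funeneg.unlock.
Qed.

Lemma complex_gaussian_same_law (s : R) (Z Z' : Omega -> cborel R) :
  measurable_fun [set: Omega] Z -> measurable_fun [set: Omega] Z' ->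
  complex_gaussian P Z s -> complex_gaussian P Z' s -> same_law Z Z'.
Proof.
move=> mZ mZ' lZ lZ' A mA.
have [mRe mIm] := (complex_measurableP Z).1 mZ.
have [mRe' mIm'] := (complex_measurableP Z').1 mZ'.
have [B mB AE] : exists2 B : set (R * R), measurable B & A = @re_im R @^-1` B.
  by case: mA => B mB <-; exists B => //; rewrite setTI.
have sl : same_law (fun w => (complex.Re (Z w), complex.Im (Z w)))
    (fun w => (complex.Re (Z' w), complex.Im (Z' w))).
  apply: (@same_law_generated _ (R * R)%type _ _
    [set A `*` B | A in measurable & B in measurable]).
  - exact: measurable_fun_pair.
  - exact: measurable_fun_pair.
  - exact: measurable_prod_measurableType.
  - move=> /= _ _ [X1 mX1 [X2 mX2 <-]] [Y1 mY1 [Y2 mY2 <-]].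
    rewrite -setXI; exists (X1 `&` Y1); first exact: measurableI.
    by exists (X2 `&` Y2) => //; exact: measurableI.
  - by exists setT => //; exists setT => //; rewrite setXTT.
  - move=> _ [C mC [D mD <-]].
    exact: (etrans (lZ C D mC mD) (esym (lZ' C D mC mD))).
by rewrite AE; exact: sl.
Qed.

Lemma mutually_independent_pair d' (T : measurableType d') (I : finType)
    (X : I -> Omega -> T) i j : (forall i, measurable_fun [set: Omega] (X i)) ->
  mutually_independent P X -> i != j -> independent_pair P (X i) (X j).
Proof.
move=> mX iX ij A B mA mB.
pose D k := if k == i then A else if k == j then B else setT.
have mD k : measurable (D k) by rewrite /D; case: ifP => // _; case: ifP.
have := iX D mD.
have -> : [set w | forall k, D k (X k w)] = X i @^-1` A `&` X j @^-1` B.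
  apply/seteqP; split => [w H|w [Aw Bw] k].
    split; first by have := H i; rewrite /D eqxx.
    by have := H j; rewrite /D eq_sym (negbTE ij) eqxx.
  by rewrite /D; case: eqP => [->//|_]; case: eqP => [->|].
move=> ->; rewrite (bigD1 i)//= (bigD1 j) 1?eq_sym//= big1 => [|k /andP[ki kj]].
  rewrite {1}/D eqxx /D eq_sym (negbTE ij) eqxx mulr1 EFinM !fineK//;
    by apply: fin_num_measure; exact: measurable_preimage.
rewrite /D (negbTE ki) (negbTE kj) preimage_setT.
by rewrite (_ : P _ = 1%E)//; exact: probability_setT.
Qed.

Lemma independent_pair_comp d1 d2 d3 d4 (T1 : measurableType d1)
    (T2 : measurableType d2) (T3 : measurableType d3) (T4 : measurableType d4)
    (X : Omega -> T1) (Y : Omega -> T2) (f : T1 -> T3) (h : T2 -> T4) :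
  measurable_fun [set: T1] f -> measurable_fun [set: T2] h ->
  independent_pair P X Y -> independent_pair P (f \o X) (h \o Y).
Proof.
move=> mf mh XY A B mA mB.
have mfA := measurable_preimage mf mA; have mhB := measurable_preimage mh mB.
exact: (XY _ _ mfA mhB).
Qed.

End equal_laws.

(** * Complex expectations and vanishing mixed moments *)

Section complex_expectation_theory.
Context d (Omega : measurableType d) (R : realType) (P : probability Omega R).
Implicit Types Z W : Omega -> R[i].
Local Notation CE := (complex_expectation P).

Definition complex_integrable Z :=
  P.-integrable [set: Omega] (EFin \o (fun w => complex.Re (Z w))) /\
  P.-integrable [set: Omega] (EFin \o (fun w => complex.Im (Z w))).

Lemma complex_expectationE Z : CE Z =
  fine (\int[P]_w (complex.Re (Z w))%:E) +i* fine (\int[P]_w (complex.Im (Z w))%:E).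
Proof. by rewrite /complex_expectation unlock. Qed.

Lemma complex_integrableD Z W : complex_integrable Z -> complex_integrable W ->
  complex_integrable (fun w => Z w + W w).
Proof.
move=> [iZ iZ'] [iW iW']; split.
- rewrite (_ : EFin \o _ = ((EFin \o (fun w => complex.Re (Z w))) \+
    (EFin \o (fun w => complex.Re (W w))))%E); first exact: integrableD.
  by apply/funext => w /=; case: (Z w); case: (W w).
- rewrite (_ : EFin \o _ = ((EFin \o (fun w => complex.Im (Z w))) \+
    (EFin \o (fun w => complex.Im (W w))))%E); first exact: integrableD.
  by apply/funext => w /=; case: (Z w); case: (W w).
Qed.

Lemma complex_expectationD Z W : complex_integrable Z -> complex_integrable W ->
  CE (fun w => Z w + W w) = CE Z + CE W.
Proof.
move=> [iZ iZ'] [iW iW']; rewrite !complex_expectationE.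
rewrite (eq_integral (fun w => (complex.Re (Z w))%:E + (complex.Re (W w))%:E)%E);
  last by move=> w _; case: (Z w); case: (W w).
rewrite (integralD measurableT iZ iW).
rewrite [X in _ +i* fine X](eq_integral
  (fun w => (complex.Im (Z w))%:E + (complex.Im (W w))%:E)%E);
  last by move=> w _; case: (Z w); case: (W w).
rewrite (integralD measurableT iZ' iW').
have fZ := integrable_fin_num measurableT iZ.
have fZ' := integrable_fin_num measurableT iZ'.
have fW := integrable_fin_num measurableT iW.
have fW' := integrable_fin_num measurableT iW'.
by rewrite (fineD fZ fW) (fineD fZ' fW').
Qed.

Lemma complex_integrableZ (c : R[i]) Z : complex_integrable Z ->
  complex_integrable (fun w => c * Z w).
Proof.
move=> [iZ iZ']; case: c => a b; split.
- rewrite (_ : EFin \o _ = ((fun w => a%:E * (EFin \o (fun w => complex.Re (Z w))) w)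
    \- (fun w => b%:E * (EFin \o (fun w => complex.Im (Z w))) w))%E).
    by apply: integrableB => //; exact: integrableZl.
  by apply/funext => w /=; case: (Z w).
- rewrite (_ : EFin \o _ = ((fun w => a%:E * (EFin \o (fun w => complex.Im (Z w))) w)
    \+ (fun w => b%:E * (EFin \o (fun w => complex.Re (Z w))) w))%E).
    by apply: integrableD => //; exact: integrableZl.
  by apply/funext => w /=; case: (Z w).
Qed.

Lemma complex_expectationZ (c : R[i]) Z : complex_integrable Z ->
  CE (fun w => c * Z w) = c * CE Z.
Proof.
move=> [iZ iZ']; case: c => a b; rewrite !complex_expectationE.
have fZ := integrable_fin_num measurableT iZ.
have fZ' := integrable_fin_num measurableT iZ'.
rewrite (eq_integral (fun w => a%:E * (complex.Re (Z w))%:E -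
  b%:E * (complex.Im (Z w))%:E)%E); last by move=> w _; case: (Z w).
rewrite [X in _ +i* fine X](eq_integral (fun w => a%:E * (complex.Im (Z w))%:E +
  b%:E * (complex.Re (Z w))%:E)%E); last by move=> w _; case: (Z w).
rewrite (integralB measurableT (integrableZl measurableT a iZ)
  (integrableZl measurableT b iZ')).
rewrite (integralD measurableT (integrableZl measurableT a iZ')
  (integrableZl measurableT b iZ)).
rewrite !integralZl//.
by rewrite fineB ?fin_numM// fineD ?fin_numM// !fineM.
Qed.

Lemma complex_integrable0 : complex_integrable (fun=> 0).
Proof. by split; exact: integrable0. Qed.

Lemma complex_expectation0 : CE (fun=> 0) = 0.
Proof. by rewrite complex_expectationE /= !integral0. Qed.

Lemma complex_integrable_sum I (s : seq I) (Q : pred I) (F : I -> Omega -> R[i]) :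
  (forall i, complex_integrable (F i)) ->
  complex_integrable (fun w => \sum_(i <- s | Q i) F i w).
Proof.
move=> iF; elim: s => [|i s IH].
  rewrite (_ : (fun w => _) = (fun=> 0)); first exact: complex_integrable0.
  by apply/funext => w; rewrite big_nil.
rewrite (_ : (fun w => _) = (fun w =>
  (if Q i then F i w else 0) + \sum_(i <- s | Q i) F i w)).
  apply: complex_integrableD => //; case: (Q i) => //; exact: complex_integrable0.
by apply/funext => w; rewrite big_cons; case: (Q i); rewrite ?add0r.
Qed.

Lemma complex_expectation_sum I (s : seq I) (Q : pred I) (F : I -> Omega -> R[i]) :
  (forall i, complex_integrable (F i)) ->
  CE (fun w => \sum_(i <- s | Q i) F i w) = \sum_(i <- s | Q i) CE (F i).
Proof.
move=> iF; elim: s => [|i s IH].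
  rewrite big_nil -[RHS]complex_expectation0; congr (CE _).
  by apply/funext => w; rewrite big_nil.
rewrite big_cons -IH; case: ifPn => Qi.
  rewrite -complex_expectationD//; last exact: complex_integrable_sum.
  by congr (CE _); apply/funext => w; rewrite big_cons Qi.
by congr (CE _); apply/funext => w; rewrite big_cons (negbTE Qi).
Qed.

Lemma complex_integrable_conj Z : complex_integrable Z ->
  complex_integrable (fun w => (Z w)^*%C).
Proof.
move=> [iZ iZ']; split.
- rewrite (_ : EFin \o _ = EFin \o (fun w => complex.Re (Z w)))//.
  by apply/funext => w /=; case: (Z w).
- rewrite (_ : EFin \o _ = -%E \o (EFin \o (fun w => complex.Im (Z w)))).
    exact: integrableN.
  by apply/funext => w /=; case: (Z w).
Qed.

Lemma complex_expectation_conj Z : complex_integrable Z ->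
  CE (fun w => (Z w)^*%C) = (CE Z)^*%C.
Proof.
move=> [iZ iZ']; rewrite !complex_expectationE /=.
rewrite (eq_integral (fun w => (complex.Re (Z w))%:E)); last first.
  by move=> w _; case: (Z w).
congr (_ +i* _); rewrite -[RHS]fineN; congr fine.
rewrite -integralN; last first.
  by apply: fin_num_adde_defl; rewrite fin_numN; exact: integrable_neg_fin_num.
by apply: eq_integral => w _; case: (Z w).
Qed.

Definition square_integrable Z := complex_measurable Z /\
  (\int[P]_w (sqnormc (Z w))%:E < +oo)%E.

(** Real and imaginary parts of the product are bounded pointwise by
    [sqnormc (Z w) + sqnormc (W w)]; the squares fed to [nra] yield the bound. *)
Lemma complex_integrable_mul Z W : square_integrable Z -> square_integrable W ->
  complex_integrable (fun w => Z w * (W w)^*%C).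
Proof.
move=> [mZ sZ] [mW sW].
have msq V : complex_measurable V ->
    measurable_fun [set: Omega] (fun w => (sqnormc (V w))%:E).
  by move=> [mV mV']; apply/measurable_EFinP; apply: measurable_funD;
    exact: measurable_funX.
have isq V : complex_measurable V -> (\int[P]_w (sqnormc (V w))%:E < +oo)%E ->
    P.-integrable [set: Omega] (fun w => (sqnormc (V w))%:E).
  move=> mV sV; apply/integrableP; split; first exact: msq.
  by under eq_integral do rewrite gee0_abs ?lee_fin ?sqnormc_ge0//.
have iZW : P.-integrable [set: Omega]
    ((fun w => (sqnormc (Z w))%:E) \+ (fun w => (sqnormc (W w))%:E))%E.
  by apply: integrableD => //; exact: isq.
have [mRe mIm] := complex_measurableM mZ (complex_measurable_conj mW).
split; apply: (le_integrable measurableT _ _ iZW) => //=.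
- exact/measurable_EFinP.
- move=> w _; rewrite lee_fin [leRHS]ger0_norm; last first.
    exact: addr_ge0 (sqnormc_ge0 _) (sqnormc_ge0 _).
  rewrite ler_norml /sqnormc; case: (Z w) => a b; case: (W w) => x y /=.
  have := sqr_ge0 (a + x); have := sqr_ge0 (a - x).
  have := sqr_ge0 (b + y); have := sqr_ge0 (b - y).
  have := sqr_ge0 a; have := sqr_ge0 b; have := sqr_ge0 x; have := sqr_ge0 y.
  by rewrite !expr2 => *; apply/andP; split; nra.
- exact/measurable_EFinP.
- move=> w _; rewrite lee_fin [leRHS]ger0_norm; last first.
    exact: addr_ge0 (sqnormc_ge0 _) (sqnormc_ge0 _).
  rewrite ler_norml /sqnormc; case: (Z w) => a b; case: (W w) => x y /=.
  have := sqr_ge0 (a + y); have := sqr_ge0 (a - y).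
  have := sqr_ge0 (b + x); have := sqr_ge0 (b - x).
  have := sqr_ge0 a; have := sqr_ge0 b; have := sqr_ge0 x; have := sqr_ge0 y.
  by rewrite !expr2 => *; apply/andP; split; nra.
Qed.

(** The expectation equals its own opposite. With [Y] obtained from [X] by negating one symmetric
    component, this kills mixed second moments without a product rule for expectations. *)
Lemma complex_expectation_odd d' (T : measurableType d') (X Y : Omega -> T)
    (f : T -> R[i]) :
  measurable_fun [set: Omega] X -> measurable_fun [set: Omega] Y ->
  same_law P X Y -> complex_measurable f ->
  (forall w, f (Y w) = - f (X w)) ->
  complex_integrable (fun w => f (X w)) -> CE (fun w => f (X w)) = 0.
Proof.
move=> mX mY XY [mf mf'] fN [iX iX'].
have half (g : T -> R) : measurable_fun setT g ->
    P.-integrable [set: Omega] (EFin \o (fun w => g (X w))) ->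
    (forall w, g (Y w) = - g (X w)) -> (\int[P]_w (g (X w))%:E)%E = 0%E.
  move=> mg ig gN.
  have fin := integrable_fin_num measurableT ig.
  have mgE : measurable_fun setT (fun t => (g t)%:E) by exact/measurable_EFinP.
  have := integral_same_law mX mY XY mgE.
  rewrite [RHS in _ = RHS -> _](_ : _ = - \int[P]_w (g (X w))%:E)%E; last first.
    rewrite -integralN; last first.
      by apply: fin_num_adde_defl; rewrite fin_numN; exact: integrable_neg_fin_num.
    by apply: eq_integral => w _; rewrite gN.
  move: fin; case: (integral _ _ _) => // r _ [] /eqP.
  by rewrite -subr_eq0 opprK -mulr2n mulrn_eq0/= => /eqP ->.
rewrite complex_expectationE.
rewrite (half (fun t => complex.Re (f t)))//; last first.
  by move=> w; rewrite fN; case: (f _).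
rewrite (half (fun t => complex.Im (f t)))//.
by move=> w; rewrite fN; case: (f _).
Qed.

End complex_expectation_theory.

Section gaussian_moments.
Context d (Omega : measurableType d) (R : realType) (P : probability Omega R).
Local Notation CE := (complex_expectation P).

Lemma square_integrable_gaussian (Z : Omega -> R[i]) (s : R) : 0 <= s ->
  complex_measurable Z -> complex_gaussian P Z s -> square_integrable P Z.
Proof.
move=> s0 mZ lZ; split=> //.
by rewrite (integral_complex_gaussian_square mZ lZ s0) ltry.
Qed.

Lemma complex_expectation_sqnormc (Z : Omega -> R[i]) (s : R) : 0 <= s ->
  complex_measurable Z -> complex_gaussian P Z s ->
  CE (fun w => Z w * (Z w)^*%C) = s%:C.
Proof.
move=> s0 mZ lZ; rewrite complex_expectationE.
rewrite (eq_integral (fun w => (sqnormc (Z w))%:E)); last first.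
  by move=> w _; case: (Z w) => x y; rewrite /sqnormc /=; congr EFin; ring.
rewrite (integral_complex_gaussian_square mZ lZ s0) /=.
rewrite (eq_integral (cst 0%E)); last first.
  by move=> w _; case: (Z w) => x y /=; congr EFin; ring.
by rewrite integral0.
Qed.

Section family.
Variables (I : finType) (X : I -> Omega -> cborel R) (s : I -> R).
Hypotheses (mX : forall i, measurable_fun [set: Omega] (X i))
  (iX : mutually_independent P X) (s_ge0 : forall i, 0 <= s i)
  (lX : forall i, complex_gaussian P (X i) (s i)).

Let mXc i : complex_measurable (X i : Omega -> R[i]).
Proof. exact/(@complex_measurableP _ _ _ (X i)). Qed.

Lemma complex_integrable_family i j :
  complex_integrable P (fun w => (X i w : R[i]) * (X j w : R[i])^*%C).
Proof.
by apply: complex_integrable_mul; apply: square_integrable_gaussian.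
Qed.

Lemma measurable_fun_opp_cborel d' (T : measurableType d') (Z : T -> cborel R) :
  measurable_fun [set: T] Z -> measurable_fun [set: T] (fun w => - (Z w : R[i]) : cborel R).
Proof.
move=> /complex_measurableP mZ; apply/complex_measurableP.
rewrite (_ : (fun w => _) = (fun w => -1 * (Z w : R[i]))).
  by apply: complex_measurableM => //; exact: complex_measurable_cst.
by apply/funext => w; rewrite mulN1r.
Qed.

Lemma complex_expectation_family i j :
  CE (fun w => (X i w : R[i]) * (X j w : R[i])^*%C) =
  if i == j then (s i)%:C else 0.
Proof.
case: eqP => [<-|/eqP ij]; first exact: complex_expectation_sqnormc.
(* Negating [X i] preserves the law of the pair, by symmetry of the Gaussian and independence, but
   reverses the sign of the product. *)
pose NX w : cborel R := - (X i w : R[i]).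
have mNX : measurable_fun setT NX by exact: measurable_fun_opp_cborel.
have XX := mutually_independent_pair mX iX ij.
have NXX : independent_pair P NX (X j).
  apply: (@independent_pair_comp _ _ _ P _ _ _ _ _ _ _ _ (X i) (X j)
    (fun z : cborel R => - (z : R[i]) : cborel R) id) => //.
  exact: measurable_fun_opp_cborel.
have sl : same_law P (X i) NX.
  apply: (@complex_gaussian_same_law _ _ _ _ (s i)) => //.
  exact: complex_gaussian_opp.
apply: (@complex_expectation_odd _ _ _ _ _ (cborel R * cborel R)%type
  (fun w => (X i w, X j w)) (fun w => (NX w, X j w))
  (fun z => (z.1 : R[i]) * (z.2 : R[i])^*%C)).
- exact: measurable_fun_pair.
- exact: measurable_fun_pair.
- exact: independent_pair_same_law.
- apply: complex_measurableM.
    apply/(@complex_measurableP _ _ _ (fst : _ -> cborel R)).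
    exact: measurable_fst.
  apply: complex_measurable_conj.
  apply/(@complex_measurableP _ _ _ (snd : _ -> cborel R)).
  exact: measurable_snd.
- by move=> w /=; rewrite /NX mulNr.
- exact: complex_integrable_family.
Qed.

End family.

Section outer_products.
Implicit Types m n k : nat.

Definition outer_integrable m n (X : Omega -> 'cV[R[i]]_m) (Y : Omega -> 'cV[R[i]]_n) :=
  forall i j, complex_integrable P (fun w => (X w *m (Y w)^t*) i j).

(** The case [X = Y = g] is convertible to [correlation_mx P g]. *)
Definition cross_correlation m n (X : Omega -> 'cV[R[i]]_m)
    (Y : Omega -> 'cV[R[i]]_n) : 'M[R[i]]_(m, n) :=
  \matrix_(i, j) CE (fun w => (X w *m (Y w)^t*) i j).

Lemma outer_mxE m n (x : 'cV[R[i]]_m) (y : 'cV[R[i]]_n) i j :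
  (x *m y^t*) i j = x i 0 * (y j 0)^*%C.
Proof. by rewrite mxE big_ord1 !mxE. Qed.

Lemma outer_integrableD m n (X X' : Omega -> 'cV[R[i]]_m) (Y : Omega -> 'cV[R[i]]_n) :
  outer_integrable X Y -> outer_integrable X' Y ->
  outer_integrable (fun w => X w + X' w) Y.
Proof.
move=> iX iX' i j; under eq_fun do rewrite mulmxDl mxE.
exact: complex_integrableD.
Qed.

Lemma cross_correlationDl m n (X X' : Omega -> 'cV[R[i]]_m)
    (Y : Omega -> 'cV[R[i]]_n) :
  outer_integrable X Y -> outer_integrable X' Y ->
  cross_correlation (fun w => X w + X' w) Y =
  cross_correlation X Y + cross_correlation X' Y.
Proof.
move=> iX iX'; apply/matrixP => i j; rewrite !mxE.
rewrite -complex_expectationD//; congr CE; apply/funext => w.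
by rewrite mulmxDl mxE.
Qed.

Lemma outer_integrableZ m n (c : R[i]) (X : Omega -> 'cV[R[i]]_m)
    (Y : Omega -> 'cV[R[i]]_n) :
  outer_integrable X Y -> outer_integrable (fun w => c *: X w) Y.
Proof.
move=> iX i j; under eq_fun do rewrite -scalemxAl mxE.
exact: complex_integrableZ.
Qed.

Lemma cross_correlationZl m n (c : R[i]) (X : Omega -> 'cV[R[i]]_m)
    (Y : Omega -> 'cV[R[i]]_n) : outer_integrable X Y ->
  cross_correlation (fun w => c *: X w) Y = c *: cross_correlation X Y.
Proof.
move=> iX; apply/matrixP => i j; rewrite !mxE.
rewrite -complex_expectationZ//; congr CE; apply/funext => w.
by rewrite -scalemxAl mxE.
Qed.

Lemma outer_integrable_sym m n (X : Omega -> 'cV[R[i]]_m) (Y : Omega -> 'cV[R[i]]_n) :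
  outer_integrable X Y -> outer_integrable Y X.
Proof.
move=> iX i j; have := complex_integrable_conj (iX j i).
congr (complex_integrable P); apply/funext => w.
by rewrite !outer_mxE [(_ * _)^*%C]rmorphM /= conjcK mulrC.
Qed.

Lemma cross_correlation_adj m n (X : Omega -> 'cV[R[i]]_m)
    (Y : Omega -> 'cV[R[i]]_n) : outer_integrable X Y ->
  (cross_correlation X Y)^t* = cross_correlation Y X.
Proof.
move=> iX; apply/matrixP => i j; rewrite !mxE.
rewrite -[LHS]complex_expectation_conj//; congr CE; apply/funext => w.
by rewrite !outer_mxE [(_ * _)^*%C]rmorphM /= conjcK mulrC.
Qed.

Lemma dotc_mulmxE n (x y : 'cV[R[i]]_n) (A : 'M[R[i]]_n) :
  dotc x (A *m y) = \sum_i \sum_j A i j * (y *m x^t*) j i.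
Proof.
rewrite /dotc mxE; apply: eq_bigr => i _; rewrite !mxE mulr_sumr.
by apply: eq_bigr => j _; rewrite outer_mxE mulrCA; congr (_ * _); rewrite mulrC.
Qed.

Lemma complex_integrable_dotc n (X Y : Omega -> 'cV[R[i]]_n) (A : 'M[R[i]]_n) :
  outer_integrable Y X ->
  complex_integrable P (fun w => dotc (X w) (A *m Y w)).
Proof.
move=> iX; under eq_fun do rewrite dotc_mulmxE.
do 2 apply: complex_integrable_sum => ?; exact: complex_integrableZ.
Qed.

(** Writing the form as a sum over entries of the outer product reduces its mean to second moments,
    so no fourth moments or joint laws enter the mutual information. *)
Lemma complex_expectation_dotc n (X Y : Omega -> 'cV[R[i]]_n) (A : 'M[R[i]]_n) :
  outer_integrable Y X ->
  CE (fun w => dotc (X w) (A *m Y w)) = \tr (A *m cross_correlation Y X).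
Proof.
move=> iX; under eq_fun do rewrite dotc_mulmxE.
rewrite complex_expectation_sum => [|i]; last first.
  by apply: complex_integrable_sum => j; exact: complex_integrableZ.
apply: eq_bigr => i _; rewrite complex_expectation_sum => [|j]; last first.
  exact: complex_integrableZ.
rewrite mxE; apply: eq_bigr => j _.
by rewrite complex_expectationZ// mxE.
Qed.

End outer_products.

End gaussian_moments.

Section sensing_moments.
Context d (Omega : measurableType d) (R : realType) (P : probability Omega R).
Variables (I : finType) (beta : I -> Omega -> cborel R) (sg : I -> R).
Hypothesis mbeta : forall i, measurable_fun [set: Omega] (beta i).
Hypothesis ibeta : mutually_independent P beta.
Hypothesis sg_ge0 : forall i, 0 <= sg i.
Hypothesis lbeta : forall i, complex_gaussian P (beta i) (sg i).
Variables (m n : nat) (a : I -> 'cV[R[i]]_m) (N : Omega -> cmx R m n) (s : R).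
Hypothesis mN : measurable_fun [set: Omega] N.
Hypothesis s_gt0 : 0 < s.
Hypothesis lN : forall i j,
  complex_gaussian P (fun w => (N w : 'M[R[i]]_(m, n)) i j) s.
Hypothesis iN : mutually_independent P
  (fun (ij : 'I_m * 'I_n) (w : Omega) =>
    (N w : 'M[R[i]]_(m, n)) ij.1 ij.2 : cborel R).
Local Notation g := (linear_combination beta a (index_enum I)).
Local Notation cov := (covariance_mx sg a (index_enum I)).
Hypothesis gN : independent_pair P g N.
Local Notation CE := (complex_expectation P).

Let gE w i j : ((g w : 'cV[R[i]]_m) *m (g w : 'cV[R[i]]_m)^t*) i j =
  \sum_k \sum_l (a k i 0 * (a l j 0)^*%C) *
    ((beta k w : R[i]) * (beta l w : R[i])^*%C).
Proof.
rewrite outer_mxE /linear_combination !summxE rmorph_sum mulr_suml.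
apply: eq_bigr => k _; rewrite mulr_sumr; apply: eq_bigr => l _.
by rewrite !mxE rmorphM/=; ring.
Qed.

Lemma outer_integrable_response : outer_integrable P g g.
Proof.
move=> i j; under eq_fun do rewrite gE.
do 2 apply: complex_integrable_sum => ?; apply: complex_integrableZ.
exact: complex_integrable_family.
Qed.

Lemma cross_correlation_response : cross_correlation P g g = cov.
Proof.
apply/matrixP => i j; rewrite mxE; under eq_fun do rewrite gE.
have iF k l : complex_integrable P
    (fun w => (beta k w : R[i]) * (beta l w : R[i])^*%C).
  exact: complex_integrable_family.
rewrite complex_expectation_sum => [|k]; last first.
  by apply: complex_integrable_sum => l; exact: complex_integrableZ.
rewrite summxE; apply: eq_bigr => k _.
rewrite complex_expectation_sum => [|l]; last exact: complex_integrableZ.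
rewrite (bigD1 k)//= big1 ?addr0 => [|l lk]; last first.
  rewrite complex_expectationZ// (complex_expectation_family mbeta ibeta sg_ge0 lbeta).
  by rewrite eq_sym (negbTE lk) mulr0.
rewrite complex_expectationZ// (complex_expectation_family mbeta ibeta sg_ge0 lbeta).
by rewrite eqxx mxE outer_mxE mulrC.
Qed.

Variable y : 'cV[R[i]]_n.
Local Notation nu := (fun w => (N w : 'M[R[i]]_(m, n)) *m y).

Let mNij (ij : 'I_m * 'I_n) : measurable_fun setT
  (fun w => (N w : 'M[R[i]]_(m, n)) ij.1 ij.2 : cborel R).
Proof. by apply/complex_measurableP; exact: ((mx_measurableP N).1 mN). Qed.

Let lNij (ij : 'I_m * 'I_n) : complex_gaussian P
  (fun w => (N w : 'M[R[i]]_(m, n)) ij.1 ij.2) s.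
Proof. exact: lN. Qed.

Let nuE w i j : (nu w *m (nu w)^t*) i j =
  \sum_k \sum_l (y k 0 * (y l 0)^*%C) *
    ((N w : 'M[R[i]]_(m, n)) i k * ((N w : 'M[R[i]]_(m, n)) j l)^*%C).
Proof.
rewrite outer_mxE !mxE rmorph_sum mulr_suml.
apply: eq_bigr => k _; rewrite mulr_sumr; apply: eq_bigr => l _.
by rewrite rmorphM/=; ring.
Qed.

Let iNN ij kl := complex_integrable_family mNij (fun=> ltW s_gt0) lNij ij kl.

Let eNN ij kl := complex_expectation_family mNij iN (fun=> ltW s_gt0) lNij ij kl.

Lemma outer_integrable_noise : outer_integrable P nu nu.
Proof.
move=> i j; under eq_fun do rewrite nuE.
apply: complex_integrable_sum => k; apply: complex_integrable_sum => l.
by apply: complex_integrableZ; exact: (iNN (i, k) (j, l)).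
Qed.

(** Entries of [N] at distinct positions are uncorrelated, so only equal rows and equal columns
    contribute: each diagonal entry is the noise variance times the squared norm of [y]. *)
Lemma cross_correlation_noise :
  cross_correlation P nu nu = (s%:C * \sum_k (sqnormc (y k 0))%:C)%:M.
Proof.
apply/matrixP => i j; rewrite !mxE; under eq_fun do rewrite nuE.
have iF k l : complex_integrable P (fun w => (N w : 'M[R[i]]_(m, n)) i k *
    ((N w : 'M[R[i]]_(m, n)) j l)^*%C) by exact: (iNN (i, k) (j, l)).
rewrite complex_expectation_sum => [|k]; last first.
  by apply: complex_integrable_sum => l; exact: complex_integrableZ.
rewrite mulr_sumr -sumrMnl; apply: eq_bigr => k _.
rewrite complex_expectation_sum => [|l]; last exact: complex_integrableZ.
rewrite (bigD1 k)//= big1 ?addr0 => [|l lk]; last first.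
  rewrite complex_expectationZ// [CE _](eNN (i, k) (j, l)) xpair_eqE.
  by rewrite [k == l]eq_sym (negbTE lk) andbF mulr0.
rewrite complex_expectationZ// [CE _](eNN (i, k) (j, k)) xpair_eqE eqxx andbT.
case: (i == j); last by rewrite mulr0.
by rewrite sqnormcE mulr1n mulrC; congr (_ * _); rewrite mulrC.
Qed.

Let nN w : cmx R m n := - (N w : 'M[R[i]]_(m, n)).

Let mnN : measurable_fun setT nN.
Proof.
apply/mx_measurableP => i j; rewrite /nN; under eq_fun do rewrite mxE.
apply/(@complex_measurableP _ _ _ (fun w => - (N w : 'M[R[i]]_(m, n)) i j : cborel R)).
exact: (measurable_fun_opp_cborel (mNij (i, j))).
Qed.

(** On rectangles the probability is a product over entries, and each entry is a symmetric complex
    Gaussian. *)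
Let same_law_opp_noise : same_law P N nN.
Proof.
apply: (@same_law_generated _ _ _ _ _ _ _ _ (@cmx_rectangles R m n)) => //.
- exact: measurable_cmx_rectangles.
- exact: setI_closed_cmx_rectangles.
- exact: cmx_rectanglesT.
move=> _ [B mB <-].
pose D ij : set (cborel R) := (fun z => - (z : R[i]) : cborel R) @^-1` B ij.
have mD ij : measurable (D ij).
  apply: measurable_preimage => //.
  exact: (measurable_fun_opp_cborel (@measurable_id _ (cborel R) setT)).
transitivity (P [set w | forall ij, B ij ((N w : 'M[R[i]]_(m, n)) ij.1 ij.2)]).
  by [].
transitivity (P [set w | forall ij, D ij ((N w : 'M[R[i]]_(m, n)) ij.1 ij.2)]).
  rewrite (iN mB) (iN mD); congr EFin; apply: eq_bigr => ij _; congr fine.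
  have mc : complex_measurable (fun w => (N w : 'M[R[i]]_(m, n)) ij.1 ij.2).
    exact: ((mx_measurableP N).1 mN).
  apply: (@complex_gaussian_same_law _ _ _ _ s _
    (fun w => - (N w : 'M[R[i]]_(m, n)) ij.1 ij.2 : cborel R)) => //.
    exact: (measurable_fun_opp_cborel (mNij ij)).
  by apply: complex_gaussian_opp => //; exact: ltW.
congr (P _); apply/seteqP; split => w H ij; have := H ij;
  by rewrite /D /nN /preimage/= mxE.
Qed.

Let gnuE w i j : ((g w : 'cV[R[i]]_m) *m (nu w)^t*) i j =
  \sum_l (y l 0)^*%C * ((g w : 'cV[R[i]]_m) i 0 * ((N w : 'M[R[i]]_(m, n)) j l)^*%C).
Proof.
rewrite outer_mxE !mxE rmorph_sum mulr_sumr; apply: eq_bigr => l _.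
by rewrite rmorphM/=; ring.
Qed.

Let igN i j l : complex_integrable P
  (fun w => (g w : 'cV[R[i]]_m) i 0 * ((N w : 'M[R[i]]_(m, n)) j l)^*%C).
Proof.
rewrite (_ : (fun w => _) = (fun w => \sum_k a k i 0 *
  ((beta k w : R[i]) * ((N w : 'M[R[i]]_(m, n)) j l)^*%C))); last first.
  apply/funext => w; rewrite /linear_combination summxE mulr_suml.
  by apply: eq_bigr => k _; rewrite mxE mulrAC mulrA mulrC mulrA.
apply: complex_integrable_sum => k; apply: complex_integrableZ.
apply: complex_integrable_mul.
  apply: (square_integrable_gaussian (sg_ge0 k)) => //.
  exact/(@complex_measurableP _ _ _ (beta k)).
apply: (square_integrable_gaussian (ltW s_gt0)) => //.
exact: ((mx_measurableP N).1 mN).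
Qed.

Lemma outer_integrable_response_noise : outer_integrable P g nu.
Proof.
move=> i j; under eq_fun do rewrite gnuE.
by apply: complex_integrable_sum => l; exact: complex_integrableZ.
Qed.

(** Parity again: negating the whole noise matrix preserves its joint law with [g], by independence,
    and reverses the sign of every mixed product. *)
Lemma cross_correlation_response_noise : cross_correlation P g nu = 0.
Proof.
apply/matrixP => i j; rewrite !mxE; under eq_fun do rewrite gnuE.
rewrite complex_expectation_sum => [|l]; last exact: complex_integrableZ.
rewrite big1// => l _; rewrite complex_expectationZ//.
have mg : measurable_fun setT g by exact: measurable_linear_combination.
have Ng : independent_pair P N g.
  by move=> A B mA mB; rewrite setIC gN// muleC.
have nNg : independent_pair P nN g.
  apply: (@independent_pair_comp _ _ _ P _ _ _ _ _ _ _ _ N g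
    (fun A : cmx R m n => - (A : 'M[R[i]]_(m, n)) : cmx R m n) id) => //.
  apply/mx_measurableP => i' j'; under eq_fun do rewrite mxE.
  apply/(@complex_measurableP _ _ _ (fun A : cmx R m n => - (A : 'M[R[i]]_(m, n)) i' j' : cborel R)).
  apply: measurable_fun_opp_cborel.
  apply/(@complex_measurableP _ _ _ (fun A : cmx R m n => (A : 'M[R[i]]_(m, n)) i' j' : cborel R)).
  exact: mx_measurable_id.
rewrite (@complex_expectation_odd _ _ _ _ _ (cmx R m n * cmx R m 1)%type
  (fun w => (N w, g w)) (fun w => (nN w, g w))
  (fun z => (z.2 : 'cV[R[i]]_m) i 0 * ((z.1 : 'M[R[i]]_(m, n)) j l)^*%C)).
- by rewrite mulr0.
- exact: measurable_fun_pair.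
- exact: measurable_fun_pair.
- exact: independent_pair_same_law.
- apply: complex_measurableM.
    have : mx_measurable (snd : cmx R m n * cmx R m 1 -> cmx R m 1).
      by apply/mx_measurableP; exact: measurable_snd.
    exact.
  apply: complex_measurable_conj.
  have : mx_measurable (fst : cmx R m n * cmx R m 1 -> cmx R m n).
    by apply/mx_measurableP; exact: measurable_fst.
  exact.
- by move=> w /=; rewrite /nN mxE [(- _)^*%C]rmorphN mulrN.
- exact: igN.
Qed.

End sensing_moments.

(** * Mutual information given the transmitted signal *)

Section log_likelihood_moment.
Context d (Omega : measurableType d) (R : realType) (P : probability Omega R).
Local Notation C := R[i].
Variables (m : nat) (g v nu : Omega -> 'cV[C]_m) (cov : 'M[C]_m) (c t : R).
Hypotheses (c_gt0 : 0 < c) (t_ge0 : 0 <= t).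
Hypothesis vE : forall w, v w = t%:C *: g w + nu w.
Hypotheses (igg : outer_integrable P g g) (inn : outer_integrable P nu nu)
  (ign : outer_integrable P g nu).
Hypotheses (egg : cross_correlation P g g = cov)
  (enn : cross_correlation P nu nu = (c^-1%:C * t%:C)%:M)
  (egn : cross_correlation P g nu = 0).
Hypothesis detD : \det (1%:M + (c * t)%:C *: cov) != 0.
Local Notation CE := (complex_expectation P).
Local Notation T := (invmx (1%:M + (c * t)%:C *: cov) *m cov).

(** The logarithm of the density [h] of the joint law, up to the constant [ln D]. Here [v] plays the
    role of the filtered echo [Y conj z], [c] is the inverse noise variance and [t] the signal
    energy. *)
Definition log_likelihood w : R :=
  c * (2 * complex.Re (dotc (g w) (v w)) - t * complex.Re (dotc (g w) (g w))) -
  c ^+ 2 * complex.Re (dotc (v w) (T *m v w)).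

(** The complex version, linear in the sesquilinear forms, so that its mean can be computed by
    traces before the real part is taken. *)
Let L w : C := c%:C * (2 * dotc (g w) (v w) - t%:C * dotc (g w) (g w)) -
  (c ^+ 2)%:C * dotc (v w) (T *m v w).

Let Re_L w : complex.Re (L w) = log_likelihood w.
Proof.
rewrite /L /log_likelihood; case: (dotc _ (v w)) => ? ?.
case: (dotc _ (g w)) => ? ?; case: (dotc _ (T *m v w)) => ? ? /=; ring.
Qed.

Let vfE : v = fun w => t%:C *: g w + nu w. Proof. exact/funext. Qed.

Let ivx (X : Omega -> 'cV[C]_m) : outer_integrable P g X ->
  outer_integrable P nu X -> outer_integrable P v X.
Proof.
by move=> ? ?; rewrite vfE; apply: outer_integrableD => //; exact: outer_integrableZ.
Qed.

Let ivg : outer_integrable P v g.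
Proof. by apply: ivx => //; exact: outer_integrable_sym. Qed.

Let ivn : outer_integrable P v nu. Proof. exact: ivx. Qed.

Let ivv : outer_integrable P v v.
Proof. by apply: ivx; exact: outer_integrable_sym. Qed.

Let evx (X : Omega -> 'cV[C]_m) : outer_integrable P g X ->
  outer_integrable P nu X -> cross_correlation P v X =
  t%:C *: cross_correlation P g X + cross_correlation P nu X.
Proof.
move=> iX iX'; rewrite vfE cross_correlationDl//; last exact: outer_integrableZ.
by rewrite cross_correlationZl.
Qed.

Let adj_tC : (t%:C)^*%C = t%:C :> C. Proof. exact: conjc_real. Qed.

Let eng : cross_correlation P nu g = 0.
Proof.
rewrite -cross_correlation_adj// egn.
by apply/matrixP => i j; rewrite !mxE rmorph0.
Qed.

Let evg : cross_correlation P v g = t%:C *: cov.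
Proof.
rewrite evx//; last exact: outer_integrable_sym.
by rewrite egg eng addr0.
Qed.

Let evv : cross_correlation P v v = (t ^+ 2)%:C *: cov + (c^-1%:C * t%:C)%:M.
Proof.
have ign' := outer_integrable_sym ign.
rewrite evx; [|exact: outer_integrable_sym..].
rewrite -(cross_correlation_adj ivg) evg -(cross_correlation_adj ivn).
rewrite evx// egn scaler0 add0r enn -egg.
rewrite adjmxZ cross_correlation_adj// scalerA; congr (_ *: _ + _).
  by rewrite adj_tC expr2 rmorphM.
rewrite tr_scalar_mx map_scalar_mx rmorphM; congr (_ * _)%:M; exact: conjc_real.
Qed.

Let iL : complex_integrable P L.
Proof.
have i1 : complex_integrable P (fun w => dotc (g w) (v w)).
  rewrite (_ : (fun w => _) = (fun w => dotc (g w) (1%:M *m v w))).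
    exact: complex_integrable_dotc.
  by apply/funext => w; rewrite mul1mx.
have i2 : complex_integrable P (fun w => dotc (g w) (g w)).
  rewrite (_ : (fun w => _) = (fun w => dotc (g w) (1%:M *m g w))).
    exact: complex_integrable_dotc.
  by apply/funext => w; rewrite mul1mx.
have i3 : complex_integrable P (fun w => dotc (v w) (T *m v w)).
  exact: complex_integrable_dotc.
rewrite (_ : L = fun w => c%:C * 2 * dotc (g w) (v w) +
    (- (c%:C * t%:C) * dotc (g w) (g w) + - (c ^+ 2)%:C * dotc (v w) (T *m v w))).
  do 2 (apply: complex_integrableD; first exact: complex_integrableZ).
  exact: complex_integrableZ.
by apply/funext => w; rewrite /L; ring.
Qed.

Let eL : CE L = 0.
Proof.
have i1 : complex_integrable P (fun w => dotc (g w) (1%:M *m v w)).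
  exact: complex_integrable_dotc.
have i2 : complex_integrable P (fun w => dotc (g w) (1%:M *m g w)).
  exact: complex_integrable_dotc.
have i3 : complex_integrable P (fun w => dotc (v w) (T *m v w)).
  exact: complex_integrable_dotc.
rewrite (_ : L = fun w => c%:C * 2 * dotc (g w) (1%:M *m v w) +
    (- (c%:C * t%:C) * dotc (g w) (1%:M *m g w) + - (c ^+ 2)%:C * dotc (v w) (T *m v w)));
  last by apply/funext => w; rewrite /L !mul1mx; ring.
rewrite complex_expectationD; [|exact: complex_integrableZ|]; last first.
  by apply: complex_integrableD; exact: complex_integrableZ.
rewrite complex_expectationD; [|exact: complex_integrableZ..].
have E1 := etrans (complex_expectationZ (c%:C * 2) i1)
  (congr1 (fun e => c%:C * 2 * e) (complex_expectation_dotc 1%:M ivg)).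
have E2 := etrans (complex_expectationZ (- (c%:C * t%:C)) i2)
  (congr1 (fun e => - (c%:C * t%:C) * e) (complex_expectation_dotc 1%:M igg)).
have E3 := etrans (complex_expectationZ (- (c ^+ 2)%:C) i3)
  (congr1 (fun e => - (c ^+ 2)%:C * e) (complex_expectation_dotc T ivv)).
apply: (etrans (f_equal2 +%R E1 (f_equal2 +%R E2 E3))).
rewrite !mul1mx evg egg evv.
(* The second moment of [v] is [(t / c) D]. As [D] commutes with [cov], [T D = cov], so the last
   trace is [c t] times the trace of [cov] and cancels the other two, which total [2 c t - c t]
   times that trace. *)
set D := 1%:M + (c * t)%:C *: cov.
have uD : D \in unitmx by rewrite unitmxE unitfE.
have TD : invmx D *m cov *m D = cov.
  rewrite -mulmxA (_ : cov *m D = D *m cov) ?(mulKmx uD)//.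
  by rewrite /D mulmxDr mulmxDl mulmx1 mul1mx -scalemxAr -scalemxAl.
have c0 : c != 0 by rewrite gt_eqF.
have ccV : c%:C * c^-1%:C = 1 :> C by rewrite -rmorphM divff// rmorph1.
have -> : (t ^+ 2)%:C *: cov + (c^-1%:C * t%:C)%:M = (c^-1%:C * t%:C) *: D.
  rewrite /D scalerDr scale_scalar_mx mulr1 scalerA addrC; congr (_ + _ *: _).
  by rewrite expr2 !rmorphM /= mulrACA [c^-1%:C * _]mulrC ccV mul1r.
rewrite -scalemxAr TD !linearZ/=.
transitivity ((t%:C * \tr cov) * (c%:C - c%:C * (c%:C * c^-1%:C))).
  by rewrite expr2 rmorphM /=; ring.
by rewrite ccV mulr1 subrr mulr0.
Qed.

Lemma integrable_log_likelihood :
  P.-integrable [set: Omega] (EFin \o log_likelihood).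
Proof. by have [+ _] := iL; rewrite (funext Re_L). Qed.

Lemma integral_log_likelihood : (\int[P]_w (log_likelihood w)%:E = 0)%E.
Proof.
have := eL; rewrite complex_expectationE => -[+ _].
under eq_integral do rewrite Re_L.
have := integrable_fin_num measurableT integrable_log_likelihood.
by rewrite /comp; case: (integral _ _ _) => // r _ /= ->.
Qed.

End log_likelihood_moment.

(** * Divergence from an explicit density, and the joint law of echo and response *)

Section kl_divergence_density.
Context d (T : measurableType d) (R : realType).
Variables (mu nu : probability T R) (h : T -> R).
Hypothesis mh : measurable_fun [set: T] h.
Hypothesis muE : forall A, measurable A -> (mu A = \int[nu]_(t in A) (h t)%:E)%E.

Lemma measurable_log2 : measurable_fun [set: R] (@log2 R).
Proof. by apply: measurable_funM => //; exact: measurable_ln. Qed.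

(** The Radon-Nikodym derivative equals [h] only almost everywhere for [nu], whereas the divergence
    integrates against [mu]; absolute continuity carries the exceptional set over. *)
Lemma kl_div_density : kl_div mu nu = (\int[mu]_t (log2 (h t))%:E)%E.
Proof.
have dom : mu `<< nu.
  apply/null_content_dominatesP => A mA nuA0; rewrite muE//.
  apply: null_set_integral => //.
  by apply/measurable_EFinP; exact: measurable_funTS.
rewrite /kl_div; case: asboolP => // _.
set f := Radon_Nikodym _ _.
have intf : nu.-integrable setT f by exact: Radon_Nikodym_integrable.
have mf : measurable_fun setT f by exact: measurable_int intf.
have mhE : measurable_fun setT (EFin \o h) by exact/measurable_EFinP.
have fh : ae_eq nu setT f (EFin \o h).
  apply: integral_ae_eq => // A _ mA.
  by rewrite -Radon_Nikodym_integral// -muE.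
have fh' : ae_eq mu setT f (EFin \o h).
  by apply: null_dominates_ae_eq fh.
apply: ae_eq_integral => //.
- apply/measurable_EFinP; apply: (measurableT_comp measurable_log2).
  by apply: (measurableT_comp _ mf).
- by apply/measurable_EFinP; exact: (measurableT_comp measurable_log2 mh).
- by apply: filterS fh' => t /= H /H ->.
Qed.

End kl_divergence_density.

Section channel_mutual_information.
Context d (Omega : measurableType d) (R : realType) (P : probability Omega R).
Variables (I : finType) (beta : I -> Omega -> cborel R) (sg : I -> R).
Hypothesis mbeta : forall i, measurable_fun [set: Omega] (beta i).
Hypothesis ibeta : mutually_independent P beta.
Hypothesis sg_ge0 : forall i, 0 <= sg i.
Hypothesis lbeta : forall i, complex_gaussian P (beta i) (sg i).
Variables (m n : nat) (a : I -> 'cV[R[i]]_m) (N : Omega -> cmx R m n) (s : R).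
Hypothesis mN : measurable_fun [set: Omega] N.
Hypothesis s_gt0 : 0 < s.
Hypothesis lN : forall i j,
  complex_gaussian P (fun w => (N w : 'M[R[i]]_(m, n)) i j) s.
Hypothesis iN : mutually_independent P
  (fun (ij : 'I_m * 'I_n) (w : Omega) =>
    (N w : 'M[R[i]]_(m, n)) ij.1 ij.2 : cborel R).
Local Notation g := (linear_combination beta a (index_enum I)).
Local Notation cov := (covariance_mx sg a (index_enum I)).
Hypothesis gN : independent_pair P g N.
Variables (z : 'cV[R[i]]_n).
Let t : R := \sum_k sqnormc (z k 0).
(** The entrywise conjugate of [z]: applied to the echo it is the matched filter, and [z^T *m y] is
    the energy [t]. *)
Let y : 'cV[R[i]]_n := (z^T)^t*.
Let c := s^-1.
Let Q : 'M[R[i]]_m := (c * t)%:C%:M.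

Let t_ge0 : 0 <= t. Proof. by apply: sumr_ge0 => k _; exact: sqnormc_ge0. Qed.

Let c_gt0 : 0 < c. Proof. by rewrite invr_gt0. Qed.

Let QH : self_adjoint Q.
Proof.
by rewrite /self_adjoint tr_scalar_mx map_scalar_mx; congr (_%:M); exact: conjc_real.
Qed.

Lemma dotc_sqnormc k (x : 'cV[R[i]]_k) : dotc x x = (\sum_i sqnormc (x i 0))%:C.
Proof.
rewrite /dotc mxE rmorph_sum; apply: eq_bigr => i _.
by rewrite !mxE /= sqnormcE.
Qed.

Let Qpsd : positive_semidef Q.
Proof.
move=> x; rewrite mul_scalar_mx dotcZr dotc_sqnormc -rmorphM /=.
apply: mulr_ge0; first exact: mulr_ge0 (ltW c_gt0) t_ge0.
by apply: sumr_ge0 => i _; exact: sqnormc_ge0.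
Qed.

Let zy : z^T *m y = t%:C%:M.
Proof.
rewrite [LHS]mx11_scalar; congr (_%:M); rewrite mxE rmorph_sum.
by apply: eq_bigr => k _; rewrite !mxE /= sqnormcE mulrC.
Qed.

(** The entrywise inner product of [x z^T] with [A] involves [A] only through [A *m y], and the
    squared norm of [x z^T] is [t] times that of [x]; hence the scalar form [Q]. *)
Lemma shift_weight_qexponent (x : 'cV[R[i]]_m) (A : 'M[R[i]]_(m, n)) :
  shift_weight s (x *m z^T) A = expR (qexponent Q (c%:C *: (A *m y)) x).
Proof.
rewrite /shift_weight -expR_sum; congr expR.
rewrite -mulr_suml sumrB -mulr_sumr -/c.
have ReM (e : R) (u : R[i]) : complex.Re (e%:C * u) = e * complex.Re u.
  by case: u => u1 u2 /=; ring.
have e1 : \sum_(ij : 'I_m * 'I_n)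
    complex.Re (((x *m z^T) ij.1 ij.2)^*%C * A ij.1 ij.2) =
    complex.Re (dotc (A *m y) x).
  rewrite -[dotc _ _]conjcK dotc_conj.
  rewrite (_ : complex.Re (_^*%C) = complex.Re (dotc x (A *m y))); last by case: (dotc _ _).
  rewrite /dotc mxE.
  transitivity (complex.Re (\sum_i \sum_j ((x *m z^T) i j)^*%C * A i j)).
    by rewrite pair_big /= [RHS](raddf_sum (@complex.Re R)).
  congr complex.Re; apply: eq_bigr => i _; rewrite !mxE mulr_sumr.
  by apply: eq_bigr => j _; rewrite !mxE big_ord1 !mxE rmorphM /=; ring.
have e2 : \sum_(ij : 'I_m * 'I_n) sqnormc ((x *m z^T) ij.1 ij.2) =
    t * complex.Re (dotc x x).
  rewrite dotc_sqnormc /= /t mulr_suml.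
  rewrite -(pair_big xpredT xpredT (fun i j => sqnormc ((x *m z^T) i j))) /=.
  rewrite exchange_big /=; apply: eq_bigr => j _; rewrite mulr_sumr.
  apply: eq_bigr => i _; rewrite mxE big_ord1 mxE mulrC.
  by case: (x i 0) => ? ?; case: (z j 0) => ? ?; rewrite /sqnormc /=; ring.
rewrite e1 e2 /qexponent mul_scalar_mx dotcZr !ReM dotcZl.
rewrite (_ : (c%:C)^*%C = c%:C) ?ReM; last exact: conjc_real.
by ring.
Qed.

Let T := invmx (1%:M + cov *m Q) *m cov.
Let D := complex.Re (\det (1%:M + cov *m Q)).
Let u (A : 'M[R[i]]_(m, n)) : 'cV[R[i]]_m := c%:C *: (A *m y).
(** The density of the law of the echo relative to the law of the noise: by [GamE] it is the shift
    weight averaged over the target response. *)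
Let Gam (A : 'M[R[i]]_(m, n)) : R := D^-1 * expR (complex.Re (dotc (u A) (T *m u A))).

Let detD : 0 < \det (1%:M + cov *m Q).
Proof.
have [] := integral_expR_qexponent mbeta ibeta sg_ge0 lbeta a 0
  (index_enum_uniq I) QH Qpsd.
by [].
Qed.

Let D_gt0 : 0 < D.
Proof. by move: detD; rewrite {1}(gtc0E detD) ltcR. Qed.

Let Gam_gt0 A : 0 < Gam A.
Proof. by rewrite mulr_gt0 ?expR_gt0// invr_gt0. Qed.

Let GamE A : (\int[P]_w (shift_weight s ((g w : 'cV[R[i]]_m) *m z^T) A)%:E =
  (Gam A)%:E)%E.
Proof.
have [_] := integral_expR_qexponent mbeta ibeta sg_ge0 lbeta a (u A)
  (index_enum_uniq I) QH Qpsd.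
move=> <-; apply: eq_integral => w _.
by rewrite shift_weight_qexponent.
Qed.

Let mg : measurable_fun setT g. Proof. exact: measurable_linear_combination. Qed.

Let mx_g : mx_measurable (g : Omega -> 'cV[R[i]]_m).
Proof. exact: ((mx_measurableP g).1 mg). Qed.

Let mx_N : mx_measurable (N : Omega -> 'M[R[i]]_(m, n)).
Proof. exact: ((mx_measurableP N).1 mN). Qed.

Let mx_fst : mx_measurable (fst : cmx R m n * cmx R m 1 -> 'M[R[i]]_(m, n)).
Proof. exact: ((mx_measurableP (fst : _ -> cmx R m n)).1 measurable_fst). Qed.

Let mx_snd : mx_measurable (snd : cmx R m n * cmx R m 1 -> 'cV[R[i]]_m).
Proof. exact: ((mx_measurableP (snd : _ -> cmx R m 1)).1 measurable_snd). Qed.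

Let mform d' (T' : measurableType d') (f : T' -> 'M[R[i]]_(m, n)) :
  mx_measurable f ->
  measurable_fun [set: T'] (fun x => complex.Re (dotc (u (f x)) (T *m u (f x)))).
Proof.
move=> mf; have mu : mx_measurable (fun x => u (f x)).
  apply: mx_measurableZ; first exact: complex_measurable_cst.
  by apply: mx_measurableM => //; exact: mx_measurable_cst.
have [+ _] := complex_measurable_dotc mu (mx_measurableM (mx_measurable_cst _ T) mu).
exact.
Qed.

(** The density of the joint law of echo and response relative to the product of the laws of [N] and
    [g], as [joint_law] shows by shifting [N] for each frozen value of [g]. *)
Let W (p : cmx R m n * cmx R m 1) : R :=
  shift_weight s ((p.2 : 'cV[R[i]]_m) *m z^T) p.1.

Let W_ge0 p : 0 <= W p.
Proof. by apply: prodr_ge0 => ij _; exact: expR_ge0. Qed.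

Let mW : measurable_fun setT W.
Proof.
apply: measurable_shift_weight => //.
by apply: mx_measurableM => //; exact: mx_measurable_cst.
Qed.

Let Y w : cmx R m n := radar_echo (g w) z (N w).

Let mY : measurable_fun setT Y.
Proof.
apply/mx_measurableP; apply: mx_measurableD => //.
by apply: mx_measurableM => //; exact: mx_measurable_cst.
Qed.

Let joint_law (psi : cmx R m n * cmx R m 1 -> \bar R) :
  measurable_fun setT psi -> (forall p, (0 <= psi p)%E) ->
  (\int[P]_w psi (Y w, g w) =
   \int[P]_w \int[P]_w' (psi (N w', g w) * (W (N w', g w))%:E))%E.
Proof.
move=> mpsi psi0.
pose phi (p : cmx R m 1 * cmx R m n) :=
  psi ((p.1 : 'cV[R[i]]_m) *m z^T + (p.2 : 'M[R[i]]_(m, n)) : cmx R m n, p.1).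
have mx1 : mx_measurable (fst : cmx R m 1 * cmx R m n -> 'cV[R[i]]_m).
  exact: ((mx_measurableP (fst : _ -> cmx R m 1)).1 measurable_fst).
have mx2 : mx_measurable (snd : cmx R m 1 * cmx R m n -> 'M[R[i]]_(m, n)).
  exact: ((mx_measurableP (snd : _ -> cmx R m n)).1 measurable_snd).
have mphi : measurable_fun setT phi.
  apply: (measurableT_comp mpsi); apply: measurable_fun_pair; last exact: measurable_fst.
  apply/mx_measurableP; apply: mx_measurableD => //.
  by apply: mx_measurableM => //; exact: mx_measurable_cst.
transitivity (\int[P]_w phi (g w, N w))%E; first by [].
rewrite (ge0_integral_indep mg mN gN mphi); last by move=> p; exact: psi0.
apply: eq_integral => w _.
have mpw : measurable_fun setT (fun A : cmx R m n => psi (A, g w)).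
  exact: (measurableT_comp mpsi (measurable_fun_pair (@measurable_id _ _ _)
    (@measurable_cst _ _ _ _ _ _))).
have := ge0_integral_gaussian_matrix_shift mN s_gt0 lN iN
  ((g w : 'cV[R[i]]_m) *m z^T) mpw (fun A => psi0 _).
move=> <-; apply: eq_integral => w' _.
by rewrite /phi /= addrC.
Qed.

(** A marginal of [joint_law]: Tonelli exchanges the integrals, and the average of [W] over [g] at
    fixed noise is [Gam]. *)
Let output_law (phi : cmx R m n -> \bar R) :
  measurable_fun setT phi -> (forall A, (0 <= phi A)%E) ->
  (\int[P]_w phi (Y w) = \int[P]_w (phi (N w) * (Gam (N w))%:E))%E.
Proof.
move=> mphi phi0.
have mpf : measurable_fun setT (fun p : cmx R m n * cmx R m 1 => phi p.1).
  exact: (measurableT_comp mphi measurable_fst).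
rewrite (joint_law mpf (fun p => phi0 p.1)) /=.
pose F (p : Omega * Omega) := (phi (N p.2) * (W (N p.2, g p.1))%:E)%E.
have mF : measurable_fun setT F.
  have mN2 : measurable_fun setT (fun p : Omega * Omega => N p.2).
    exact: (measurableT_comp mN measurable_snd).
  have mg1 : measurable_fun setT (fun p : Omega * Omega => g p.1).
    exact: (measurableT_comp mg measurable_fst).
  apply: emeasurable_funM; first exact: (measurableT_comp mphi mN2).
  apply/measurable_EFinP.
  exact: (measurableT_comp mW (measurable_fun_pair mN2 mg1)).
have F0 p : (0 <= F p)%E by apply: mule_ge0 => //; rewrite lee_fin.
have := @fubini_tonelli _ _ _ _ R P P F mF F0.
move=> ->; apply: eq_integral => w' _.
have mWw : measurable_fun setT (fun w => (W (N w', g w))%:E).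
  apply/measurable_EFinP.
  exact: (measurableT_comp mW (measurable_fun_pair (@measurable_cst _ _ _ _ _ (N w')) mg)).
have W0w w : (0 <= (W (N w', g w))%:E)%E by rewrite lee_fin.
rewrite -GamE.
exact: (ge0_integralZl P measurableT mWw (fun w _ => W0w w) (phi0 (N w'))).
Qed.

Variable mu : probability (cmx R m n * cmx R m 1)%type R.
Hypothesis muE : forall A, measurable A -> mu A = P [set w | A (Y w, g w)].

Let YG w := (Y w, g w).

Let mYG : measurable_fun [set: Omega] YG.
Proof. exact: measurable_fun_pair. Qed.

Let ge0_integral_mu (f : cmx R m n * cmx R m 1 -> \bar R) :
  measurable_fun [set: _] f -> (forall p, (0 <= f p)%E) ->
  (\int[mu]_p f p = \int[P]_w f (Y w, g w))%E.
Proof.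
move=> mf f0; transitivity (\int[pushforward P YG]_p f p)%E.
  by apply: eq_measure_integral => A mA _; exact: muE.
exact: (ge0_integral_pushforward mYG _ measurableT mf (fun p _ => f0 p)).
Qed.

(** The likelihood ratio: conditional density of the echo given [g] over its marginal density, both
    relative to the law of the noise. *)
Let h (p : cmx R m n * cmx R m 1) : R := W p / Gam p.1.

Let mh : measurable_fun setT h.
Proof.
rewrite (_ : h = fun p => W p * (D *
    expR (- complex.Re (dotc (u p.1) (T *m u p.1))))); last first.
  by apply/funext => p; rewrite /h /Gam invfM invrK -expRN.
apply: measurable_funM => //; apply: measurable_funM => //.
apply: measurableT_comp => //; apply: measurable_funN; exact: mform.
Qed.

Let W_gt0 p : 0 < W p.
Proof. by apply: prodr_gt0 => ij _; exact: expR_gt0. Qed.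

Let h_gt0 p : 0 < h p. Proof. by rewrite divr_gt0. Qed.

(** Under the product of the marginals, echo and response come from independent samples.
    [output_law] replaces the echo by the noise at the price of [Gam], which cancels the denominator
    of [h]; the remaining weight [W] is undone by [joint_law]. *)
Let density A : measurable A ->
  (mu A = \int[distribution mu fst \x distribution mu snd]_(p in A) (h p)%:E)%E.
Proof.
move=> mA.
pose psi (p : cmx R m n * cmx R m 1) : \bar R := ((\1_A p : R)%:E * (h p)%:E)%E.
have mI : measurable_fun setT (fun p : cmx R m n * cmx R m 1 => (\1_A p : R)%:E).
  by apply/measurable_EFinP; exact: measurable_indic.
have mhE : measurable_fun setT (fun p => (h p)%:E) by exact/measurable_EFinP.
have mpsi : measurable_fun setT psi by exact: emeasurable_funM.
have psi0 p : (0 <= psi p)%E.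
  by apply: mule_ge0; rewrite lee_fin// ltW.
transitivity (\int[distribution mu fst \x distribution mu snd]_p psi p)%E; last first.
  rewrite [RHS]integral_mkcond; apply: eq_integral => p _.
  by rewrite patchE /psi indicE; case: (p \in A); rewrite ?mul1e ?mul0e.
rewrite fubini_tonelli2//.
transitivity (\int[P]_w \int[P]_w' psi (Y w', g w))%E; last first.
  pose G x := (\int[P]_w' psi (Y w', x))%E.
  have mG : measurable_fun setT G.
    pose F (p : cmx R m 1 * Omega) := psi (Y p.2, p.1).
    apply: (@measurable_fun_fubini_tonelli_F _ _ _ _ R P F); last by move=> p; exact: psi0.
    apply: (measurableT_comp mpsi); apply: measurable_fun_pair.
      exact: (measurableT_comp mY measurable_snd).
    exact: measurable_fst.
  have GE x : (\int[distribution mu fst]_A' psi (A', x) = G x)%E.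
    have mpx : measurable_fun setT (fun A' => psi (A', x)).
      exact: (measurableT_comp mpsi (measurable_fun_pair (@measurable_id _ _ _)
        (@measurable_cst _ _ _ _ _ _))).
    have mpx1 : measurable_fun setT (fun p : cmx R m n * cmx R m 1 => psi (p.1, x)).
      exact: (measurableT_comp mpx measurable_fst).
    apply: (eq_trans (ge0_integral_distribution _ mpx (fun A' => psi0 (A', x)))).
    exact: (ge0_integral_mu mpx1 (fun p => psi0 (p.1, x))).
  transitivity (\int[distribution mu snd]_x G x)%E; last first.
    by apply: eq_integral => x _; exact/esym/GE.
  have G0 x : (0 <= G x)%E by apply: integral_ge0.
  have mG2 : measurable_fun setT (fun p : cmx R m n * cmx R m 1 => G p.2).
    exact: (measurableT_comp mG measurable_snd).
  apply/esym; apply: (eq_trans (ge0_integral_distribution _ mG G0)).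
  exact: (ge0_integral_mu mG2 (fun p => G0 p.2)).
transitivity (\int[P]_w ((\1_A (Y w, g w) : R)%:E))%E.
  transitivity (P (YG @^-1` A)); first exact: muE.
  rewrite -integral_one; last exact: measurable_preimage.
  rewrite [LHS]integral_mkcond; apply: eq_integral => w _.
  by rewrite patchE mem_preimage_set indicE; case: (_ \in A).
rewrite (joint_law mI); last by move=> p; rewrite lee_fin.
apply: eq_integral => w _.
have mpw : measurable_fun setT (fun A' => psi (A', g w)).
  exact: (measurableT_comp mpsi (measurable_fun_pair (@measurable_id _ _ _)
    (@measurable_cst _ _ _ _ _ _))).
rewrite (output_law mpw (fun A' => psi0 _)); apply: eq_integral => w' _.
rewrite /psi /h -muleA; congr (_ * _)%E; rewrite -EFinM divfK//.
by rewrite gt_eqF.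
Qed.

Let v w : 'cV[R[i]]_m := (Y w : 'M[R[i]]_(m, n)) *m y.

Let vE w : v w = t%:C *: (g w : 'cV[R[i]]_m) + (N w : 'M[R[i]]_(m, n)) *m y.
Proof. by rewrite /v /Y /radar_echo mulmxDl -mulmxA zy mul_mx_scalar. Qed.

Let covQ : cov *m Q = (c * t)%:C *: cov. Proof. exact: mul_mx_scalar. Qed.

Let detD' : \det (1%:M + (c * t)%:C *: cov) != 0.
Proof. by rewrite -covQ gt_eqF. Qed.

Let enn : cross_correlation P (fun w => (N w : 'M[R[i]]_(m, n)) *m y)
  (fun w => (N w : 'M[R[i]]_(m, n)) *m y) = (c^-1%:C * t%:C)%:M.
Proof.
rewrite (cross_correlation_noise mN s_gt0 lN iN) /c invrK /t rmorph_sum.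
congr (_ * _)%:M; apply: eq_bigr => k _; rewrite !mxE.
by case: (z k 0) => ? ?; rewrite /sqnormc /= sqrrN.
Qed.

Let igg := outer_integrable_response mbeta sg_ge0 lbeta a.
Let inn := outer_integrable_noise mN s_gt0 lN y.
Let ign := outer_integrable_response_noise mbeta sg_ge0 lbeta a mN s_gt0 lN y.
Let egg := cross_correlation_response mbeta ibeta sg_ge0 lbeta a.
Let egn :=
  cross_correlation_response_noise mbeta sg_ge0 lbeta mN s_gt0 lN iN gN y.

Let ll := log_likelihood g v cov c t.

Let log2_h w : log2 (h (Y w, g w)) = (ln 2)^-1 * (ll w + ln D).
Proof.
rewrite /log2 mulrC; congr (_ * _).
rewrite /h lnM ?posrE ?invr_gt0// lnV ?posrE// /W /= shift_weight_qexponent expRK.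
rewrite /Gam lnM ?posrE ?invr_gt0 ?expR_gt0// expRK lnV ?posrE//.
have ReM (e : R) (x : R[i]) : complex.Re (e%:C * x) = e * complex.Re x.
  by case: x => x1 x2 /=; ring.
have cJ : (c%:C)^*%C = c%:C :> R[i] by exact: conjc_real.
rewrite /ll /log_likelihood /qexponent -covQ -/T /u -/(v w).
rewrite mul_scalar_mx -scalemxAr !dotcZr !dotcZl cJ !ReM.
rewrite -(dotc_conj (g w) (v w)).
by case: (dotc (g w) (v w)) => x1 x2 /=; ring.
Qed.

(** The mean of [ll] is zero, so only the constant [ln D] survives. The measure [mu] is any
    probability that agrees with the joint law, so that the result applies to values of arbitrary
    conditional kernels. *)
Lemma mutual_info_channel :
  mutual_info mu = (log2 (complex.Re (\det (1%:M + (c * t)%:C *: cov))))%:E.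
Proof.
have ill := integrable_log_likelihood cov c vE igg inn ign.
have ell := integral_log_likelihood c_gt0 vE igg inn ign egg enn egn detD'.
have iD : P.-integrable setT (fun=> (ln D)%:E).
  exact: (finite_measure_integrable_cst P (ln D)).
have iS : P.-integrable setT (fun w => (ll w)%:E + (ln D)%:E)%E.
  exact: (integrableD measurableT ill iD).
transitivity (\int[mu]_p (log2 (h p))%:E)%E.
  rewrite /mutual_info; set nu := (nu in kl_div _ nu).
  have E : forall A, measurable A -> (mu A = \int[nu]_(p in A) (h p)%:E)%E.
    exact: density.
  exact: (kl_div_density mh E).
have fE w : (log2 (h (YG w)))%:E = ((ln 2)^-1%:E * ((ll w)%:E + (ln D)%:E))%E.
  by rewrite log2_h EFinM EFinD.
have mlog : measurable_fun setT (fun p => (log2 (h p))%:E).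
  by apply/measurable_EFinP; exact: (measurableT_comp (@measurable_log2 R) mh).
have ilog : P.-integrable setT ((fun p => (log2 (h p))%:E) \o YG).
  rewrite (_ : _ \o _ = (fun w => (ln 2)^-1%:E * ((ll w)%:E + (ln D)%:E))%E).
    exact: integrableZl.
  by apply/funext => w; exact: fE.
transitivity (\int[pushforward P YG]_p (log2 (h p))%:E)%E.
  by apply: eq_measure_integral => A mA _; exact: muE.
have mYGi : P.-integrable (YG @^-1` setT) ((fun p => (log2 (h p))%:E) \o YG).
  by rewrite preimage_setT.
transitivity (\int[P]_w (log2 (h (YG w)))%:E)%E.
  exact: (integral_pushforward mYG mlog mYGi measurableT).
transitivity ((ln 2)^-1%:E * \int[P]_w ((ll w)%:E + (ln D)%:E))%E.
  rewrite -integralZl//; apply: eq_integral => w _; exact: fE.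
rewrite (integralD measurableT ill iD) ell add0e probability_integral_cst.
by rewrite -EFinM -covQ /log2 mulrC.
Qed.

End channel_mutual_information.

(** * Averaging over the transmitted signal *)

Section parametrized_law.
Local Open Scope ereal_scope.
Context d d1 d2 d3 (Omega : measurableType d) (T : measurableType d1)
  (U : measurableType d2) (V : measurableType d3) (R : realType).
Variables (P : probability Omega R) (F : U * V -> T) (X : Omega -> V).
Hypotheses (mF : measurable_fun [set: U * V] F) (mX : measurable_fun [set: Omega] X).

Lemma measurable_parametrized z : measurable_fun [set: Omega] (fun w => F (z, X w)).
Proof. exact: (measurableT_comp mF (measurable_fun_pair (measurable_cst _) mX)). Qed.

Definition parametrized_law (z : U) : pprobability T R :=
  distribution P (mfun_Sub (mem_set (measurable_parametrized z))).

Lemma parametrized_lawE z A : parametrized_law z A = P [set w | A (F (z, X w))].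
Proof. by []. Qed.

Lemma parametrized_law_integral z A : measurable A ->
  parametrized_law z A = \int[P]_w (\1_A (F (z, X w)) : R)%:E.
Proof.
move=> mA; have mpre := measurable_preimage (measurable_parametrized z) mA.
rewrite parametrized_lawE -(integral_one P mpre) [LHS]integral_mkcond.
apply: eq_integral => w _; rewrite patchE indicE.
by rewrite (mem_preimage_set (fun w => F (z, X w)) A w); case: (_ \in A).
Qed.

(** Measures are made measurable through their values on measurable sets, and each such value is a
    partial integral of a jointly measurable function. *)
Lemma measurable_parametrized_law : measurable_fun [set: U] parametrized_law.
Proof.
apply: (measurability (@pset _ _ _ : set (set (pprobability T R)))) => //.
move=> _ -[_ [r r01] [A mA <-]] <-; apply: emeasurable_fun_infty_o => //=.
pose G (p : U * Omega) := (\1_A (F (p.1, X p.2)) : R)%:E.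
rewrite (_ : (fun z => _) = (fun z => \int[P]_w G (z, w))); last first.
  by apply/funext => z; exact: parametrized_law_integral.
apply: (@measurable_fun_fubini_tonelli_F _ _ _ _ R P G); last by move=> p; rewrite lee_fin.
apply/measurable_EFinP; apply: (measurableT_comp (@measurable_indic _ _ _ _ A mA)).
apply: (measurableT_comp mF); apply: measurable_fun_pair; first exact: measurable_fst.
exact: (measurableT_comp mX measurable_snd).
Qed.

(** Freezing: as [X] is independent of [Z], conditioning on [Z = z] amounts to substituting [z] into
    [F]. This is what supplies a kernel for the definition of conditional mutual information. *)
Lemma regular_cond_dist_parametrized (Z : Omega -> U) :
  measurable_fun [set: Omega] Z -> independent_pair P Z X ->
  regular_cond_dist P (fun w => F (Z w, X w)) Z parametrized_law.
Proof.
move=> mZ ZX; split; first exact: measurable_parametrized_law.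
move=> A C mA mC.
pose phi (p : U * V) : \bar R := (\1_C p.1 * \1_A (F p) : R)%:E.
have mphi : measurable_fun setT phi.
  apply/measurable_EFinP; apply: measurable_funM.
    exact: (measurableT_comp (@measurable_indic _ _ _ _ C mC) measurable_fst).
  exact: (measurableT_comp (@measurable_indic _ _ _ _ A mA) mF).
have phi0 p : 0 <= phi p by rewrite lee_fin mulr_ge0.
have mFZX : measurable_fun setT (fun w => F (Z w, X w)).
  exact: (measurableT_comp mF (measurable_fun_pair mZ mX)).
transitivity (\int[P]_w phi (Z w, X w)).
  have mAC : measurable ((fun w => F (Z w, X w)) @^-1` A `&` Z @^-1` C).
    by apply: measurableI; exact: measurable_preimage.
  rewrite -(integral_one P mAC) [LHS]integral_mkcond.
  apply: eq_integral => w _; rewrite patchE /phi !indicE in_setI.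
  rewrite (mem_preimage_set (fun w => F (Z w, X w)) A w) mem_preimage_set.
  by case: (_ \in A); case: (_ \in C); rewrite ?mulr1 ?mulr0.
rewrite (ge0_integral_indep mZ mX ZX mphi phi0) [RHS]integral_mkcond.
apply: eq_integral => w _; rewrite patchE mem_preimage_set.
rewrite parametrized_law_integral// /phi /= indicE.
case: (Z w \in C); last by rewrite integral0_eq// => w' _; rewrite mul0r.
by apply: eq_integral => w' _; rewrite mul1r.
Qed.

End parametrized_law.

(** * Almost sure uniqueness of regular conditional distributions *)

Section rational_boxes.
Context d (T : measurableType d) (R : realType) (K : finType) (f : K -> T -> R).

(** Rational corners keep the family countable, so that one null set per box can be united into a
    single null set. *)
Definition lower_box (q : {ffun K -> rat}) : set T :=
  [set t | forall k, f k t < ratr (q k)].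

Lemma setI_closed_lower_box : setI_closed (range lower_box).
Proof.
move=> _ _ [p _ <-] [q _ <-]; exists [ffun k => Order.min (p k) (q k)] => //.
have ltmin k (y : R) : (y < ratr (Order.min (p k) (q k))) = (y < ratr (p k)) && (y < ratr (q k)).
  rewrite /Order.min; case: ifPn => [pq|]; last rewrite -leNgt => qp.
    by rewrite andb_idr// => H; apply: (lt_trans H); rewrite ltr_rat.
  by rewrite andb_idl// => H; apply: (lt_le_trans H); rewrite ler_rat.
apply/seteqP; split => t /= H.
  by split => k; have := H k; rewrite ffunE ltmin => /andP[].
by move=> k; rewrite ffunE ltmin; case: H => -> ->.
Qed.

Lemma lower_box_cover : \bigcup_n lower_box [ffun=> n%:R] = setT.
Proof.
rewrite -subTset => t _.
pose r := \big[Order.max/0%R]_k f k t.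
have [n rn] : exists n : nat, r < n%:R.
  exists (Num.bound `|r|); exact: (le_lt_trans (ler_norm _) (archi_boundP (normr_ge0 _))).
exists n => // k; rewrite ffunE ratr_nat.
by apply: le_lt_trans rn; apply: le_bigmax.
Qed.

Lemma measurable_lower_box (mf : forall k, measurable_fun [set: T] (f k)) q :
  measurable (lower_box q).
Proof.
rewrite (_ : lower_box q = \big[setI/setT]_k (f k @^-1` `]-oo, ratr (q k)[)); last first.
  apply/seteqP; split => t /=.
    move=> H; apply: (big_ind (fun A : set T => A t)) => // k _.
    by rewrite /= in_itv/=.
  by move=> H k; move: H; rewrite (bigD1 k)//= in_itv/= => -[].
by apply: bigsetI_measurable => k _; rewrite -[X in measurable X]setTI; exact: mf.
Qed.

Lemma measurable_coord_lower_box k :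
  measurable_fun [set: g_sigma_algebraType (range lower_box)] (f k).
Proof.
apply: (measurability _ (RGenInftyO.measurableE R)).
move=> _ [_ [x ->] <-]; rewrite setTI.
(* A bound on one coordinate alone is not a box; it is recovered as a countable union by taking
   rational bounds [r <= x] on the coordinate [k] and letting the common bound [n] on the others
   grow. *)
rewrite (_ : _ @^-1` _ = \bigcup_n \bigcup_(r : rat) if (ratr r : R) <= x then
   lower_box [ffun j => if j == k then r else n%:R] else set0); last first.
  apply/seteqP; split => t /=.
    rewrite in_itv/= => ftx.
    have [r /andP[ftr rx]] : exists r : rat, f k t < ratr r < x.
      by have [r] := rat_in_itvoo ftx; rewrite in_itv/= => ?; exists r.
    have [n _ tn] : (\bigcup_n lower_box [ffun=> n%:R]) t by rewrite lower_box_cover.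
    exists n => //; exists r => //; rewrite (ltW rx) => j; rewrite ffunE.
    by case: eqP => [->//|_]; have := tn j; rewrite ffunE.
  move=> [n _ [r _]]; case: ifPn => // rx /(_ k); rewrite ffunE eqxx in_itv/= => H.
  exact: lt_le_trans rx.
apply: bigcupT_measurable => n; apply: bigcupT_measurable_rat => r.
case: ifPn => _ //; apply: sub_sigma_algebra; by eexists.
Qed.

Hypothesis mf : forall k, measurable_fun [set: T] (f k).
Hypothesis idf : measurable_fun [set: g_sigma_algebraType (range lower_box)] (id : _ -> T).

(** The hypothesis [idf] says that the coordinates [f] separate enough: each measurable set of [T]
    is already measurable for the boxes. *)
Lemma measurable_lower_boxE : @measurable d T = <<s range lower_box >>.
Proof.
apply/seteqP; split => A.
  by move=> /(idf measurableT); rewrite setTI preimage_id.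
by move: A; apply: smallest_sub; [exact: sigma_algebra_measurable|
   by move=> _ [q _ <-]; exact: measurable_lower_box].
Qed.

Lemma probability_unique_lower_box (mu nu : probability T R) :
  (forall q, mu (lower_box q) = nu (lower_box q)) ->
  forall A, measurable A -> mu A = nu A.
Proof.
move=> munu A mA.
have Gg n : range lower_box (lower_box [ffun=> n%:R]) by eexists.
apply: (@measure_unique _ _ _ (range lower_box) (fun n => lower_box [ffun=> n%:R])
  measurable_lower_boxE setI_closed_lower_box Gg lower_box_cover mu nu) => //.
- by move=> _ [q _ <-]; exact: munu.
- move=> n; apply: (le_lt_trans (probability_le1 _ _)); last exact: ltry.
  exact: measurable_lower_box.
Qed.

End rational_boxes.

Section integral_off_null_set.
Local Open Scope ereal_scope.
Context d (T : measurableType d) (R : realType).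

(** The integral of a non-negative function is a supremum over the simple functions below it, which
    is monotone whether or not the function is measurable. *)
Lemma ge0_le_integral_nonmeasurable (mu : {measure set T -> \bar R}) (f g : T -> \bar R) :
  (forall t, 0 <= f t) -> (forall t, f t <= g t) -> \int[mu]_t f t <= \int[mu]_t g t.
Proof.
move=> f0 fg; rewrite !ge0_integralTE//; last by move=> t; exact: le_trans (fg t).
apply: ereal_sup_le => _ [h /= hf <-]; exists h => //= t; exact: le_trans (fg t).
Qed.

(** Meant for mutual informations of an arbitrary kernel, about which nothing is known on the null
    set. Positive and negative parts are treated separately because monotonicity is available for
    non-negative functions. *)
Lemma integral_cst_off_null_set (P : probability T R) (f : T -> \bar R) (c : R) (N : set T) :
  measurable N -> P N = 0 -> (forall t, ~ N t -> f t = c%:E) -> \int[P]_t f t = c%:E.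
Proof.
move=> mN PN0 fc.
have ge0 (g : T -> \bar R) (e : R) : (0 <= e)%R -> (forall t, 0 <= g t) ->
    (forall t, ~ N t -> g t = e%:E) -> \int[P]_t g t = e%:E.
  move=> e0 g0 ge.
  (* Measurable barriers: with [a = 0] and [a = +oo] they enclose [g], and both integrate to [e]
     because [N] is null. *)
  pose up (a : \bar R) t := if t \in N then a else e%:E.
  have mup a : measurable_fun setT (up a).
    apply: measurable_fun_ifT => //; apply: (measurable_fun_bool true) => //.
    rewrite setTI (_ : _ @^-1` _ = N)//; apply/seteqP.
    by split => t; [exact: set_mem|exact: mem_set].
  have up0 a : 0 <= a -> forall t, 0 <= up a t.
    by move=> a0 t; rewrite /up; case: ifP.
  have iup a : 0 <= a -> \int[P]_t up a t = e%:E.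
    move=> a0; rewrite -[RHS](probability_integral_cst P).
    apply: ge0_ae_eq_integral => //; first by move=> t _; exact: up0.
    exists N; split => // t; rewrite /= /up; case: ifPn => [/set_mem //|_ H].
    by exfalso; apply: H.
  apply/eqP; rewrite eq_le; apply/andP; split.
    rewrite -(iup +oo)//; apply: ge0_le_integral_nonmeasurable => // t; rewrite /up.
    by case: ifPn => [_|/negP Nt]; [exact: leey|rewrite ge// => /mem_set].
  rewrite -(iup 0)//; apply: ge0_le_integral_nonmeasurable => [t|t]; first exact: up0.
  by rewrite /up; case: ifPn => [_//|/negP Nt]; rewrite ge// => /mem_set.
rewrite integralE.
rewrite (ge0 f^\+ (Num.max c 0)%R)//; last 2 first.
- by rewrite le_max lexx orbT.
- by move=> t Nt; rewrite funeposE fc// EFin_max.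
rewrite (ge0 f^\- (Num.max (- c) 0)%R)//; last 2 first.
- by rewrite le_max lexx orbT.
- by move=> t Nt; rewrite funenegE fc// EFin_max.
by rewrite -EFinB; congr EFin; rewrite /Num.max;
  case: (ltP c 0%R) => ?; case: (ltP (- c)%R 0%R) => ?; lra.
Qed.

End integral_off_null_set.

Section uniqueness.
Local Open Scope ereal_scope.
Context d d1 d2 (Omega : measurableType d) (T : measurableType d1)
  (U : measurableType d2) (R : realType) (P : probability Omega R).
Variables (X : Omega -> T) (Z : Omega -> U).
Hypothesis mZ : measurable_fun [set: Omega] Z.

(** Both kernels evaluated at [A] have the same integrals over all measurable sets of values of [Z],
    so they agree almost everywhere for the law of [Z]. The null set found here depends on [A]. *)
Lemma regular_cond_dist_ae_unique_on (k k' : U -> pprobability T R) (A : set T) :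
  regular_cond_dist P X Z k -> regular_cond_dist P X Z k' -> measurable A ->
  exists N : set U, [/\ measurable N, P (Z @^-1` N) = 0 &
    forall z, ~ N z -> k z A = k' z A].
Proof.
move=> [mk kE] [mk' k'E] mA.
pose PZ := distribution P (mfun_Sub (mem_set mZ)).
have meval (h : U -> pprobability T R) : measurable_fun setT h ->
    measurable_fun setT (h ^~ A).
  by move=> mh; exact: (measurable_kernel (kprobability mh) A mA).
have intE (h : U -> pprobability T R) C : measurable_fun setT h -> measurable C ->
    \int[PZ]_(z in C) h z A = \int[P]_(w in Z @^-1` C) h (Z w) A.
  move=> mh mC.
  exact: (ge0_integral_pushforward mZ P mC (measurable_funTS (meval h mh))
    (fun z _ => measure_ge0 (h z) A)).
have ik : PZ.-integrable setT (k ^~ A).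
  apply: (@le_integrable _ _ _ PZ setT measurableT _ (cst 1)); first exact: meval.
    move=> z _; rewrite gee0_abs// gee0_abs//; exact: probability_le1.
  exact: finite_measure_integrable_cst.
have [N [mN N0 sub]] : ae_eq PZ setT (k ^~ A) (k' ^~ A).
  apply: integral_ae_eq => //; first exact: meval.
  by move=> C _ mC; rewrite !intE// -kE// -k'E.
exists N; split => // z Nz; apply: contrapT => H; apply/Nz/sub => /= /(_ I).
exact: H.
Qed.

(** The null sets belonging to the rational boxes are enumerated by [unpickle] and united; off the
    union the two probabilities agree on a generating system, hence everywhere. *)
Lemma regular_cond_dist_ae_unique (K : finType) (f : K -> T -> R)
    (k k' : U -> pprobability T R) :
  (forall i, measurable_fun [set: T] (f i)) ->
  measurable_fun [set: g_sigma_algebraType (range (lower_box f))] (id : _ -> T) ->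
  regular_cond_dist P X Z k -> regular_cond_dist P X Z k' ->
  exists N : set U, [/\ measurable N, P (Z @^-1` N) = 0 &
    forall z, ~ N z -> forall A, measurable A -> k z A = k' z A].
Proof.
move=> mf idf rk rk'.
have mbox q := measurable_lower_box mf q.
have /choice[N NE] q := regular_cond_dist_ae_unique_on rk rk' (mbox q).
pose N' n := if unpickle n is Some q then N q else set0.
have mN' n : measurable (N' n).
  by rewrite /N'; case: unpickle => // q; case: (NE q).
exists (\bigcup_n N' n); split.
- exact: bigcupT_measurable.
- have mZN n : measurable (Z @^-1` N' n) by exact: measurable_preimage.
  rewrite preimage_bigcup; apply/negligibleP; first exact: bigcupT_measurable.
  apply: negligible_bigcup => n; apply/(negligibleP _ (mZN n)).
  rewrite /N'; case: unpickle => [q|]; first by case: (NE q).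
  by rewrite preimage_set0 measure0.
move=> z Nz; apply: (probability_unique_lower_box mf idf) => q.
have [_ _] := NE q; apply => Nqz; apply: Nz; exists (pickle q) => //.
by rewrite /N' pickleK.
Qed.

End uniqueness.

Section output_signal_coordinates.
Context (R : realType) (m n : nat).

Definition real_coordinate (k : ('I_m * 'I_n + 'I_m * 'I_1) * bool)
    (p : cmx R m n * cmx R m 1) : R :=
  let e := match k.1 with
    | inl ij => (p.1 : 'M[R[i]]_(m, n)) ij.1 ij.2
    | inr ij => (p.2 : 'cV[R[i]]_m) ij.1 ij.2
    end in
  if k.2 then complex.Re e else complex.Im e.

Lemma measurable_real_coordinate k : measurable_fun setT (real_coordinate k).
Proof.
have mx1 : mx_measurable (fst : cmx R m n * cmx R m 1 -> 'M[R[i]]_(m, n)).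
  exact: ((mx_measurableP (fst : _ -> cmx R m n)).1 measurable_fst).
have mx2 : mx_measurable (snd : cmx R m n * cmx R m 1 -> 'cV[R[i]]_m).
  exact: ((mx_measurableP (snd : _ -> cmx R m 1)).1 measurable_snd).
case: k => [[ij|ij] b].
  by have [? ?] := mx1 ij.1 ij.2; case: b.
by have [? ?] := mx2 ij.1 ij.2; case: b.
Qed.

Lemma measurable_id_lower_box : measurable_fun
  [set: g_sigma_algebraType (range (lower_box real_coordinate))]
  (id : _ -> (cmx R m n * cmx R m 1)%type).
Proof.
have mc k := @measurable_coord_lower_box _ (cmx R m n * cmx R m 1)%type R
  (('I_m * 'I_n + 'I_m * 'I_1) * bool)%type real_coordinate k.
rewrite (_ : id = fun p => (p.1, p.2)); last by apply/funext => -[].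
apply: measurable_fun_pair.
  apply/mx_measurableP => i j; split.
    exact: (mc (inl (i, j), true)).
  exact: (mc (inl (i, j), false)).
apply/mx_measurableP => i j; split.
  exact: (mc (inr (i, j), true)).
exact: (mc (inr (i, j), false)).
Qed.

End output_signal_coordinates.

Section channel_conditional_mutual_information.
Context d (Omega : measurableType d) (R : realType) (P : probability Omega R).
Variables (I : finType) (beta : I -> Omega -> cborel R) (sg : I -> R).
Hypothesis mbeta : forall i, measurable_fun [set: Omega] (beta i).
Hypothesis ibeta : mutually_independent P beta.
Hypothesis sg_ge0 : forall i, 0 <= sg i.
Hypothesis lbeta : forall i, complex_gaussian P (beta i) (sg i).
Variables (m n : nat) (a : I -> 'cV[R[i]]_m) (N : Omega -> cmx R m n) (s : R).
Hypothesis mN : measurable_fun [set: Omega] N.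
Hypothesis s_gt0 : 0 < s.
Hypothesis lN : forall i j,
  complex_gaussian P (fun w => (N w : 'M[R[i]]_(m, n)) i j) s.
Hypothesis iN : mutually_independent P
  (fun (ij : 'I_m * 'I_n) (w : Omega) =>
    (N w : 'M[R[i]]_(m, n)) ij.1 ij.2 : cborel R).
Local Notation g := (linear_combination beta a (index_enum I)).
Local Notation cov := (covariance_mx sg a (index_enum I)).
Hypothesis gN : independent_pair P g N.
Variable Z : Omega -> cmx R n 1.
Hypothesis mZ : measurable_fun [set: Omega] Z.
Hypothesis ZgN : independent_pair P Z (fun w => (g w, N w)).
Variable t : R.
Hypothesis Zt : forall w, \sum_k sqnormc ((Z w : 'cV[R[i]]_n) k 0) = t.

(** Response and noise are grouped into one variable, independent of the signal, so that the
    freezing argument applies with the signal as parameter. *)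
Let echo (p : cmx R n 1 * (cmx R m 1 * cmx R m n)) : cmx R m n * cmx R m 1 :=
  (radar_echo p.2.1 p.1 p.2.2, p.2.1).

Let mecho : measurable_fun setT echo.
Proof.
have m21 : measurable_fun setT
    (fun p : cmx R n 1 * (cmx R m 1 * cmx R m n) => p.2.1).
  exact: (measurableT_comp measurable_fst measurable_snd).
have m22 : measurable_fun setT
    (fun p : cmx R n 1 * (cmx R m 1 * cmx R m n) => p.2.2).
  exact: (measurableT_comp measurable_snd measurable_snd).
have m1 : mx_measurable (fst : cmx R n 1 * (cmx R m 1 * cmx R m n) -> 'cV[R[i]]_n).
  exact: ((mx_measurableP (fst : _ -> cmx R n 1)).1 measurable_fst).
apply: measurable_fun_pair => //; apply/mx_measurableP; apply: mx_measurableD.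
  apply: mx_measurableM; last exact: mx_measurable_tr.
  exact: ((mx_measurableP (fun p => p.2.1 : cmx R m 1)).1 m21).
exact: ((mx_measurableP (fun p => p.2.2 : cmx R m n)).1 m22).
Qed.

Let mg : measurable_fun [set: Omega] g.
Proof. exact: measurable_linear_combination. Qed.

Let mgN : measurable_fun [set: Omega] (fun w => (g w, N w)).
Proof. exact: measurable_fun_pair. Qed.

(** The choice operator in the definition asks for two things: some kernel exists, namely [kappa],
    and by [average] every admissible kernel gives the same value, since it agrees with [kappa] off
    a null set of signals and all signals have the energy [t]. *)
Lemma cond_mutual_info_channel :
  cond_mutual_info P (fun w => radar_echo (g w) (Z w) (N w) : cmx R m n)
    (g : Omega -> cmx R m 1) Z =
  (log2 (complex.Re (\det (1%:M + (s^-1 * t)%:C *: cov))))%:E.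
Proof.
pose kappa := parametrized_law P mecho mgN.
have rk : regular_cond_dist P (fun w => echo (Z w, (g w, N w))) Z kappa.
  exact: regular_cond_dist_parametrized.
have average (k : cmx R n 1 -> pprobability (cmx R m n * cmx R m 1)%type R) :
    regular_cond_dist P (fun w => echo (Z w, (g w, N w))) Z k ->
    (\int[P]_w mutual_info (k (Z w)))%E =
    (log2 (complex.Re (\det (1%:M + (s^-1 * t)%:C *: cov))))%:E.
  move=> rk'.
  have [B [mB PB kE]] := regular_cond_dist_ae_unique mZ
    (@measurable_real_coordinate R m n) (@measurable_id_lower_box R m n) rk' rk.
  apply: (@integral_cst_off_null_set _ _ _ P _ _ (Z @^-1` B)) => //.
    exact: measurable_preimage.
  move=> w Bw; rewrite -(Zt w).
  apply: (@mutual_info_channel _ _ _ P _ beta sg mbeta ibeta sg_ge0 lbeta m n a N s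
    mN s_gt0 lN iN gN (Z w)) => A mA.
  exact: (kE _ Bw A mA).
rewrite /cond_mutual_info; apply: xget_unique.
  by exists kappa; split => //; exact/esym/average.
by move=> _ [k [rk' ->]]; exact: average.
Qed.

End channel_conditional_mutual_information.

(** * Independence of signal, response and noise, and the signal energy *)

Section independence_of_three.
Local Open Scope ereal_scope.
Context d d1 d2 d3 (Omega : measurableType d) (T1 : measurableType d1)
  (T2 : measurableType d2) (T3 : measurableType d3) (R : realType).
Variables (P : probability Omega R).
Variables (X : Omega -> T1) (Y : Omega -> T2) (Z : Omega -> T3).
Hypothesis XYZ : mutually_independent3 P X Y Z.

Lemma mutually_independent3_pair23 : independent_pair P Y Z.
Proof.
move=> B C mB mC; have := XYZ measurableT mB mC.
have -> : P (X @^-1` setT) = 1 by rewrite preimage_setT; exact: probability_setT.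
by rewrite mul1e preimage_setT setTI.
Qed.

Hypothesis mX : measurable_fun [set: Omega] X.
Hypothesis mY : measurable_fun [set: Omega] Y.
Hypothesis mZ : measurable_fun [set: Omega] Z.

Lemma mutually_independent3_pair1 : independent_pair P X (fun w => (Y w, Z w)).
Proof.
move=> A B mA mB.
have mXA := measurable_preimage mX mA.
have mYZB := measurable_preimage (measurable_fun_pair mY mZ) mB.
pose u (w : Omega) : R := \1_(X @^-1` A) w.
pose v (w : Omega) : R := fine (P (X @^-1` A)).
pose phi (p : T2 * T3) : \bar R := (\1_B p : R)%:E.
have mphi : measurable_fun setT phi by apply/measurable_EFinP; exact: measurable_indic.
have PAE : (fine (P (X @^-1` A)))%:E = P (X @^-1` A).
  by rewrite fineK//; exact: fin_num_measure.
have indicI (C : set Omega) : measurable C ->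
    \int[P]_(w in C) (u w)%:E = P (X @^-1` A `&` C).
  move=> mC; rewrite /u integral_indic//.
have H : \int[P]_w (phi (Y w, Z w) * (u w)%:E) = \int[P]_w (phi (Y w, Z w) * (v w)%:E).
  have mu : measurable_fun setT u by exact: measurable_indic.
  have u0 w : (0 <= u w)%R by [].
  have v0 w : (0 <= v w)%R by apply: fine_ge0; exact: measure_ge0.
  apply: (ge0_integral_weighted_pair_law mY mZ mY mZ mu (measurable_cst _) u0 v0) => //.
  - rewrite indicI// setIT; exact: (le_lt_trans (probability_le1 _ mXA) (ltry _)).
  - move=> C D mC mD.
    have mCD : measurable (Y @^-1` C `&` Z @^-1` D).
      by apply: measurableI; exact: measurable_preimage.
    rewrite indicI// setIA [LHS]XYZ// -muleA -PAE.
    have := integral_cst P mCD (fine (P (X @^-1` A)))%:E => /= ->; congr (_ * _).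
    exact/esym/mutually_independent3_pair23.
  - by move=> p; rewrite lee_fin.
have phiE w : phi (Y w, Z w) = (\1_((fun w => (Y w, Z w)) @^-1` B) w : R)%:E.
  by rewrite /phi !indicE (mem_preimage_set (fun w => (Y w, Z w)) B w).
transitivity (\int[P]_w (phi (Y w, Z w) * (u w)%:E)).
  rewrite -indicI// [LHS]integral_mkcond; apply: eq_integral => w _.
  by rewrite phiE indicE patchE; case: (_ \in _); rewrite ?mul1e ?mul0e.
rewrite H.
have m1 : measurable_fun setT (fun w => phi (Y w, Z w)).
  exact: (measurableT_comp mphi (measurable_fun_pair mY mZ)).
have -> : P ((fun w => (Y w, Z w)) @^-1` B) = \int[P]_w phi (Y w, Z w).
  rewrite -(integral_one P mYZB) [LHS]integral_mkcond; apply: eq_integral => w _.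
  by rewrite phiE indicE patchE; case: (_ \in _).
have PA0 : 0 <= (fine (P (X @^-1` A)))%:E by rewrite lee_fin; exact: fine_ge0.
have phi0 w : setT w -> 0 <= phi (Y w, Z w) by move=> _; rewrite lee_fin.
rewrite -PAE; apply: (eq_trans _ (ge0_integralZl P measurableT m1 phi0 PA0)).
by apply: eq_integral => w _; exact: muleC.
Qed.

End independence_of_three.

Section transmit_energy.
Context (R : realType) (L : nat) (p alphaN alphaF : R).

(** With the row [y = sqrt p q S], the energy is [y] times its adjoint. The middle factor [S S^t*]
    is [L], and the squared amplitudes in [q] add up to 1. *)
Lemma transmit_energy (S : 'M[R[i]]_(2, L)) :
  0 <= p -> 0 <= alphaN -> 0 <= alphaF -> alphaN + alphaF = 1 ->
  S *m S^t* = (L%:R)%:M ->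
  \sum_k sqnormc (transmit_signal p alphaN alphaF S k 0) = p * L%:R.
Proof.
move=> p0 aN0 aF0 aNF SS.
pose q : 'rV[R[i]]_2 := \row_(j < 2) (Num.sqrt (if j == 0 then alphaN else alphaF))%:C.
pose y := (Num.sqrt p)%:C *: (q *m S).
have cJ (e : R) : (e%:C)^*%C = e%:C by exact: conjc_real.
have qq : (q *m q^t*) 0 0 = 1.
  have qE j : q 0 j * (q^t*) j 0 = (if j == 0 then alphaN else alphaF)%:C.
    rewrite !mxE [X in _ * X]cJ -rmorphM /= -expr2 sqr_sqrtr//.
    by case: ifP.
  rewrite mxE (eq_bigr _ (fun j _ => qE j)) big_ord_recl big_ord1 /=.
  by rewrite -rmorphD /= aNF.
apply: complexI; rewrite rmorph_sum.
transitivity ((y *m y^t*) 0 0).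
  rewrite [RHS]mxE; apply: eq_bigr => k _.
  rewrite (_ : transmit_signal _ _ _ _ _ _ = y 0 k); last by rewrite mxE.
  by rewrite [LHS](sqnormcE (y 0 k)) mulrC !mxE.
have yy : y *m y^t* = (p * L%:R)%:C *: (q *m q^t*).
  rewrite /y adjmxZ adjmxM -scalemxAl -scalemxAr scalerA -mulmxA (mulmxA S) SS.
  rewrite mul_scalar_mx -scalemxAr scalerA; congr (_ *: _).
  by rewrite cJ -rmorphM /= -expr2 sqr_sqrtr// rmorphM rmorph_nat.
by rewrite yy mxE qq mulr1.
Qed.

End transmit_energy.

Section sensing_rate_formula.
Context (R : realType) d (Omega : measurableType d) (P : probability Omega R).
Variables (M L K : nat) (sigma2s alphaN alphaF : R).
Hypotheses (sigma2s_gt0 : 0 < sigma2s) (alphaN_gt0 : 0 < alphaN) (alphaF_gt0 : 0 < alphaF).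
Hypothesis alpha_sum : alphaN + alphaF = 1.
Variable S : {RV P >-> cmx R 2 L}.
Hypothesis S_orth :
  forall w, (S w : 'M[R[i]]_(2, L)) *m (S w)^t* = (L%:R)%:M.
Variables (a : 'I_K -> 'cV[R[i]]_M) (sigma2 : 'I_K -> R).
Hypothesis sigma2_ge0 : forall k, 0 <= sigma2 k.
Variable beta : 'I_K -> {RV P >-> cborel R}.
Hypothesis beta_law : forall k, complex_gaussian P (beta k) (sigma2 k).
Hypothesis beta_indep : mutually_independent P (fun k => beta k : Omega -> cborel R).
Variable Ns : {RV P >-> cmx R M L}.
Hypothesis Ns_law : forall i j,
  complex_gaussian P (fun w => (Ns w : 'M[R[i]]_(M, L)) i j) sigma2s.
Hypothesis Ns_indep : mutually_independent P
  (fun (ij : 'I_M * 'I_L) (w : Omega) =>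
     (Ns w : 'M[R[i]]_(M, L)) ij.1 ij.2 : cborel R).
Let x (p : R) : Omega -> cmx R L 1 :=
  fun w => transmit_signal p alphaN alphaF (S w).
Let g : Omega -> cmx R M 1 := fun w => target_response a (fun k => beta k w).
Let mbeta k : measurable_fun [set: Omega] (beta k : Omega -> cborel R).
Proof. exact: measurable_funP. Qed.

Let mx_p p : measurable_fun [set: Omega] (x p).
Proof.
apply/mx_measurableP; apply: mx_measurable_tr; apply: mx_measurableZ.
  exact: complex_measurable_cst.
apply: mx_measurableM; first exact: mx_measurable_cst.
exact: ((mx_measurableP (S : Omega -> cmx R 2 L)).1 (measurable_funP S)).
Qed.

Lemma correlation_response :
  correlation_mx P g = covariance_mx sigma2 a (index_enum 'I_K).
Proof. exact: (cross_correlation_response mbeta beta_indep sigma2_ge0 beta_law). Qed.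

Lemma sensing_rateE p : 0 < p -> mutually_independent3 P (x p) g Ns ->
  sensing_rate P g (x p) Ns = (L%:R^-1 * log2 (complex.Re
    (\det (1%:M + (p * L%:R * sigma2s^-1)%:C *: correlation_mx P g))))%:E.
Proof.
move=> p0 xgN; rewrite /sensing_rate correlation_response [p * _ * _]mulrC EFinM.
congr (_ * _)%E.
have mg : measurable_fun setT g by exact: (measurable_linear_combination mbeta).
apply: (cond_mutual_info_channel mbeta beta_indep sigma2_ge0 beta_law
  (measurable_funP Ns) sigma2s_gt0 Ns_law Ns_indep
  (mutually_independent3_pair23 xgN) (mx_p p)
  (mutually_independent3_pair1 xgN (mx_p p) mg (measurable_funP Ns))).
by move=> w; apply: transmit_energy => //; exact: ltW.
Qed.

End sensing_rate_formula.

(** * Spectrum of the correlation matrix and high-power limit *)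

Section psd_spectrum.
Context (C : numClosedFieldType).

Lemma rank_diag_mx (F : fieldType) n (D : 'rV[F]_n) :
  \rank (diag_mx D) = (\sum_(i < n) (D 0%R i != 0%R))%N.
Proof.
elim: n D => [|n IH] D; first by rewrite big_ord0; apply/eqP; rewrite -leqn0 rank_leq_row.
have : (D : 'rV_(1 + n)) = row_mx (lsubmx (D : 'rV_(1 + n))) (rsubmx (D : 'rV_(1 + n))).
  by rewrite hsubmxK.
move: (lsubmx _) (rsubmx _) => e D' DE.
have -> : \rank (diag_mx D) = (\rank (diag_mx e) + \rank (diag_mx D'))%N.
  by rewrite -rank_diag_block_mx -diag_mx_row -DE.
have DEl : D 0 (lshift n (0 : 'I_1)) = e 0 0.
  exact: (etrans (congr1 (fun X : 'rV_(1 + n) => X 0 (lshift n (0 : 'I_1))) DE) (row_mxEl _ _ _ _)).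
have DEr i : D 0 (rshift 1 i) = D' 0 i.
  exact: (etrans (congr1 (fun X : 'rV_(1 + n) => X 0 (rshift 1 i)) DE) (row_mxEr _ _ _ _)).
rewrite IH [RHS](@big_split_ord _ _ _ 1 n) big_ord1 /= DEl.
congr (_ + _)%N; last by apply: eq_bigr => i _; rewrite DEr.
have -> : diag_mx e = (e 0 0)%:M by apply/matrixP => i j; rewrite !mxE !ord1.
by rewrite rank_rV -scalemx1 scalemx_eq0 oner_eq0 orbF.
Qed.

Lemma char_poly_conj_mx (F : fieldType) n (V A : 'M[F]_n) : V \in unitmx ->
  char_poly (invmx V *m A *m V) = char_poly A.
Proof.
move=> Vu; have VV : map_mx polyC (invmx V) *m map_mx polyC V = 1%:M.
  by rewrite -map_mxM mulVmx// map_mx1.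
rewrite /char_poly (_ : char_poly_mx _ =
    map_mx polyC (invmx V) *m char_poly_mx A *m map_mx polyC V).
  by rewrite !det_mulmx mulrC mulrA -det_mulmx (mulmx1C VV) det1 mul1r.
rewrite /char_poly_mx mulmxBr mulmxBl !map_mxM; congr (_ - _).
by rewrite mul_mx_scalar -scalemxAl VV scalemx1.
Qed.

(** A self-adjoint matrix is normal, hence unitarily diagonalisable. Characteristic polynomial, rank
    and the determinant are invariant under the conjugation, so each is computed on the diagonal. *)
Lemma psd_spectral n (A : 'M[C]_n) : A^t* = A ->
  (forall x : 'cV[C]_n, 0 <= (x^t* *m A *m x) 0 0) ->
  exists D : 'rV[C]_n, [/\ forall i, 0 <= D 0 i,
    char_poly A = \prod_i ('X - (D 0 i)%:P),
    forall c, \det (1%:M + c *: A) = \prod_i (1 + c * D 0 i) &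
    \rank A = (\sum_i (D 0%R i != 0%R))%N].
Proof.
move=> AH Apsd.
have An : A \is normalmx by apply/normalmxP; rewrite AH.
have /orthomx_spectralP := An; set V := spectralmx A; set D := spectral_diag A => AE.
have Vu : V \is unitarymx := spectral_unitarymx A.
have Vunit : V \in unitmx by exact: unitarymx_unit.
have VV : V *m V^t* = 1%:M by apply/unitarymxP.
have DE : diag_mx D = V *m A *m V^t*.
  by rewrite AE invmx_unitary// !mulmxA VV mul1mx -mulmxA VV mulmx1.
exists D; split.
(* This vector is the eigenvector of index [i], and the form evaluated at it is the diagonal entry
   [D 0 i]. *)
- move=> i; have := Apsd (V^t* *m delta_mx i 0).
  rewrite trmx_mul map_mxM trmxCK trmx_delta map_delta_mx !mulmxA.
  rewrite -!mulmxA (mulmxA V) (mulmxA (V *m A)) -DE mulmxA -rowE -colE.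
  by rewrite !mxE eqxx mulr1n.
- rewrite {1}AE char_poly_conj_mx// char_poly_trig; last exact: diag_mx_is_trig.
  by apply: eq_bigr => i _; rewrite mxE eqxx mulr1n.
- move=> c; rewrite {1}AE.
  have -> : 1%:M + c *: (invmx V *m diag_mx D *m V) =
      invmx V *m (1%:M + c *: diag_mx D) *m V.
    by rewrite mulmxDr mulmxDl mulmx1 mulVmx// -scalemxAr -scalemxAl.
  rewrite !det_mulmx mulrC mulrA -det_mulmx mulmxV// det1 mul1r.
  have -> : 1%:M + c *: diag_mx D = diag_mx (\row_i (1 + c * D 0 i)).
    by apply/matrixP => i j; rewrite !mxE mulrnDl mulrnAr.
  by rewrite det_diag; apply: eq_bigr => i _; rewrite mxE.
- rewrite {1}AE mxrankMfree; last by rewrite row_free_unit.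
  by rewrite eqmxMfull ?row_full_unit ?unitmx_inv// rank_diag_mx.
Qed.

End psd_spectrum.

Section positive_eigenvalues.
Context (R : realType) (n : nat) (A : 'M[R[i]]_n).
Hypothesis AH : A^t* = A.
Hypothesis Apsd : forall x : 'cV[R[i]]_n, 0 <= (x^t* *m A *m x) 0 0.

(** The list [eigenvalues A] is known only as a factorisation of the characteristic polynomial.
    Uniqueness of linear factors makes it a permutation of the spectral diagonal, which transfers
    multiplicities. *)
Lemma positive_eigenvalues_spectrum : exists D : 'I_n -> R[i], [/\
  forall i, 0 <= D i,
  perm_eq (positive_eigenvalues A) [seq complex.Re (D i) | i <- enum 'I_n & 0 < D i],
  forall c, \det (1%:M + c *: A) = \prod_i (1 + c * D i) &
  \rank A = (\sum_i (D i != 0%R))%N].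
Proof.
have [D [D0 cD dD rD]] := psd_spectral AH Apsd.
exists (D 0); split => //.
rewrite /positive_eigenvalues.
have := svalP (closed_field_poly_normal (char_poly A)).
rewrite -/(eigenvalues A); move: (eigenvalues A) => e.
rewrite (monicP (char_poly_monic A)) scale1r cD.
rewrite -(big_map (D 0) xpredT (fun z => 'X - z%:P)) => /esym/prod_XsubC_eq/(perm_filter (> 0)).
move=> /(perm_map (@complex.Re R)); rewrite filter_map -map_comp.
by rewrite /index_enum -enumT.
Qed.

Lemma size_positive_eigenvalues : size (positive_eigenvalues A) = \rank A.
Proof.
have [D [D0 pD _ ->]] := positive_eigenvalues_spectrum.
rewrite (perm_size pD) size_map size_filter -sum1_count big_enum_cond /=.
by rewrite big_mkcond; apply: eq_bigr => i _; rewrite lt0r D0 andbT; case: eqP.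
Qed.

Lemma positive_eigenvalues_gt0 l : l \in positive_eigenvalues A -> 0 < l.
Proof.
by case/mapP => z; rewrite mem_filter => /andP[z0 _] ->; move: z0; rewrite ltcE => /andP[].
Qed.

(** Eigenvalues equal to zero contribute the factor 1, so the product over the whole spectrum
    shrinks to the positive part. *)
Lemma det_1D_positive_eigenvalues (c : R) :
  complex.Re (\det (1%:M + c%:C *: A)) = \prod_(l <- positive_eigenvalues A) (1 + c * l).
Proof.
have [D [D0 pD -> _]] := positive_eigenvalues_spectrum.
suff -> : \prod_i (1 + c%:C * D i) = (\prod_(l <- positive_eigenvalues A) (1 + c * l))%:C by [].
rewrite (perm_big _ pD) big_map big_filter big_enum_cond /= rmorph_prod [RHS]big_mkcond /=.
apply: eq_bigr => i _; case: ifPn => [D0i|].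
  by rewrite rmorphD rmorphM /= -(gtc0E D0i).
by rewrite lt0r D0 andbT negbK => /eqP ->; rewrite mulr0 addr0.
Qed.

End positive_eigenvalues.

Section covariance_psd.
Context (R : realType) (I : finType) (sg : I -> R) (n : nat) (a : I -> 'cV[R[i]]_n).
Hypothesis sg_ge0 : forall i, 0 <= sg i.

Lemma covariance_mx_adj s : (covariance_mx sg a s)^t* = covariance_mx sg a s.
Proof.
rewrite /covariance_mx; elim: s => [|k s IH]; first by rewrite big_nil trmx0 map_mx0.
rewrite big_cons adjmxD IH adjmxZ adjmxM trmxCK; congr (_ *: _ + _); exact: conjc_real.
Qed.

Lemma covariance_mx_psd s (x : 'cV[R[i]]_n) : 0 <= (x^t* *m covariance_mx sg a s *m x) 0 0.
Proof.
rewrite /covariance_mx mulmx_sumr mulmx_suml summxE; apply: sumr_ge0 => k _.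
rewrite -scalemxAr -scalemxAl mxE mulr_ge0 ?lecR//.
rewrite (_ : _ *m _ = (x^t* *m a k) *m (x^t* *m a k)^t*); last first.
  by rewrite adjmxM trmxCK !mulmxA.
rewrite mxE big_ord1 [X in _ * X]mxE [X in _ * X^* ]mxE mulrC.
have <- := sqnormcE ((x^t* *m a k) 0 ord0).
by rewrite lecR sqnormc_ge0.
Qed.

End covariance_psd.

(** * High-power asymptotics *)

Section high_power_limit.
Context (R : realType).

Lemma log2M (x y : R) : 0 < x -> 0 < y -> log2 (x * y) = log2 x + log2 y.
Proof. by move=> x0 y0; rewrite /log2 lnM ?posrE// mulrDl. Qed.

Lemma log2_1 : log2 (1 : R) = 0. Proof. by rewrite /log2 ln1 mul0r. Qed.

Lemma cvg_log2_inv (c : R) : log2 (1 + c * p^-1) @[p --> +oo] --> 0.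
Proof.
have invp : (fun p : R => p^-1) @ +oo --> (0 : R).
  by apply/(gtr0_cvgV0 (f := id)) => //; exact: nbhs_pinfty_gt.
have arg : (fun p : R => 1 + c * p^-1) @ +oo --> (1 : R).
  have -> : nbhs (1 : R) = nbhs (1 + c * 0) by rewrite mulr0 addr0.
  by apply: cvgD; [exact: cvg_cst|apply: cvgM => //; exact: cvg_cst].
have lnc : (fun p : R => ln (1 + c * p^-1)) @ +oo --> (0 : R).
  rewrite -[X in _ --> X](@ln1 R).
  exact: (continuous_cvg _ (continuous_ln (@ltr01 R)) arg).
by rewrite -[X in _ --> X](mul0r (ln 2)^-1); apply: cvgM => //; exact: cvg_cst.
Qed.

(** Each factor splits as [1 + p k l = p (k l) (1 + (k l)^-1 p^-1)]. Its logarithm supplies one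
    [log2 p], one constant and a remainder that vanishes, so induction on the list adds up the
    contributions. *)
Lemma cvg_log2_prod_high_power (s : seq R) (k : R) : 0 < k -> (forall l, l \in s -> 0 < l) ->
  log2 (\prod_(l <- s) (1 + p * k * l)) -
    ((size s)%:R * log2 p + \sum_(l <- s) log2 (k * l)) @[p --> +oo] --> 0.
Proof.
move=> k0; elim: s => [|x s IH] s0.
  under eq_fun do rewrite !big_nil log2_1 mul0r addr0 subr0.
  exact: cvg_cst.
have x0 : 0 < x by apply: s0; rewrite inE eqxx.
have s0' l : l \in s -> 0 < l by move=> sl; apply: s0; rewrite inE sl orbT.
have kx0 : 0 < k * x by rewrite mulr_gt0.
have := cvgD (IH s0') (cvg_log2_inv (k * x)^-1); rewrite addr0 => cvgs.
apply: (cvg_trans _ (cvgs _)).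
apply: near_eq_cvg; near=> p.
have p0 : 0 < p by near: p; exact: nbhs_pinfty_gt.
rewrite !fctE !big_cons log2M; last 2 first.
- by rewrite addr_gt0// !mulr_gt0.
- by rewrite big_seq; apply: prodr_gt0 => l /s0' l0; rewrite addr_gt0// !mulr_gt0.
have -> : 1 + p * k * x = p * (k * x) * (1 + (k * x)^-1 * p^-1).
  by field; rewrite !gt_eqF.
rewrite log2M ?mulr_gt0// ?log2M//; last by rewrite addr_gt0// mulr_gt0 ?invr_gt0.
by rewrite -natr1; ring.
Unshelve. all: by end_near. Qed.

End high_power_limit.

Theorem theorem3 (R : realType) (d : measure_display)
    (Omega : measurableType d) (P : probability Omega R)
    (M L K : nat) (M_gt0 : (0 < M)%N) (L_gt0 : (0 < L)%N)
    (sigma2s : R) (sigma2s_gt0 : 0 < sigma2s)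
    (alphaN alphaF : R) (alphaN_gt0 : 0 < alphaN) (alphaF_gt0 : 0 < alphaF)
    (alpha_sum : alphaN + alphaF = 1) (alpha_lt : alphaN < alphaF)
    (S : {RV P >-> cmx R 2 L})
    (S_orth : forall w, (S w : 'M[R[i]]_(2, L)) *m (S w)^t* = (L%:R)%:M)
    (a : 'I_K -> 'cV[R[i]]_M) (sigma2 : 'I_K -> R)
    (sigma2_ge0 : forall k, 0 <= sigma2 k)
    (beta : 'I_K -> {RV P >-> cborel R})
    (beta_law : forall k, complex_gaussian P (beta k) (sigma2 k))
    (beta_indep : mutually_independent P (fun k => beta k : Omega -> cborel R))
    (Ns : {RV P >-> cmx R M L})
    (Ns_law : forall i j,
       complex_gaussian P (fun w => (Ns w : 'M[R[i]]_(M, L)) i j) sigma2s)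
    (Ns_indep : mutually_independent P
       (fun (ij : 'I_M * 'I_L) (w : Omega) =>
          (Ns w : 'M[R[i]]_(M, L)) ij.1 ij.2 : cborel R)) :
  let x (p : R) : Omega -> cmx R L 1 :=
    fun w => transmit_signal p alphaN alphaF (S w) in
  let g : Omega -> cmx R M 1 :=
    fun w => target_response a (fun k => beta k w) in
  forall (xgN_indep : forall p, 0 < p -> mutually_independent3 P (x p) g Ns),
  let rate (p : R) : \bar R := sensing_rate P g (x p) Ns in
  let Rmx : 'M[R[i]]_M := correlation_mx P g in
  let r : nat := \rank Rmx in
  let lambda : seq R := positive_eigenvalues Rmx in
  [/\ forall p, 0 < p ->
        rate p = (L%:R^-1 * log2 (complex.Re
          (\det (1%:M + (p * L%:R * sigma2s^-1)%:C *: Rmx))))%:E,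
      size lambda = r
    & fine (rate p) -
         (r%:R / L%:R * log2 p +
          L%:R^-1 * \sum_(i < r) log2 (L%:R * lambda`_i / sigma2s))
        @[p --> +oo] --> 0].
Proof.
move=> x g xgN_indep rate Rmx r lambda.
have rateE p : 0 < p -> rate p = (L%:R^-1 * log2 (complex.Re
    (\det (1%:M + (p * L%:R * sigma2s^-1)%:C *: Rmx))))%:E.
  move=> p0; exact: (sensing_rateE sigma2s_gt0 alphaN_gt0 alphaF_gt0 alpha_sum S_orth
    sigma2_ge0 beta_law beta_indep Ns_law Ns_indep p0 (xgN_indep p p0)).
have RmxE : Rmx = covariance_mx sigma2 a (index_enum 'I_K).
  exact: (correlation_response a sigma2_ge0 beta_law beta_indep).
have RmxH : Rmx^t* = Rmx by rewrite RmxE; exact: covariance_mx_adj.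
have Rmx_psd (v : 'cV[R[i]]_M) : 0 <= (v^t* *m Rmx *m v) 0 0.
  by rewrite RmxE; exact: covariance_mx_psd.
have size_lambda : size lambda = r := size_positive_eigenvalues RmxH Rmx_psd.
split => //.
have L0 : (0 : R) < L%:R by rewrite ltr0n.
have k0 : 0 < L%:R / sigma2s by rewrite divr_gt0.
have lambda0 l : l \in lambda -> 0 < l := @positive_eigenvalues_gt0 _ _ _ l.
have lim : L%:R^-1 * (log2 (\prod_(l <- lambda) (1 + p * (L%:R / sigma2s) * l)) -
    ((size lambda)%:R * log2 p + \sum_(l <- lambda) log2 (L%:R / sigma2s * l)))
    @[p --> +oo] --> (0 : R).
  rewrite -[X in _ --> X](mulr0 (L%:R^-1 : R)); apply: cvgM; first exact: cvg_cst.
  exact: cvg_log2_prod_high_power.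
apply: (cvg_trans _ lim).
apply: near_eq_cvg; near=> p.
have p0 : 0 < p by near: p; exact: nbhs_pinfty_gt.
rewrite rateE//= det_1D_positive_eigenvalues// -/lambda -size_lambda.
have -> : \prod_(l <- lambda) (1 + p * L%:R * sigma2s^-1 * l) =
    \prod_(l <- lambda) (1 + p * (L%:R / sigma2s) * l).
  by under eq_bigr do rewrite -(mulrA p).
have -> : \sum_(i < size lambda) log2 (L%:R * lambda`_i / sigma2s) =
    \sum_(l <- lambda) log2 (L%:R / sigma2s * l).
  by rewrite (big_nth 0) big_mkord; apply: eq_bigr => i _; rewrite mulrAC.
by ring.
Unshelve. all: by end_near. Qed.
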